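(* Let $k=k_n$ be a sequence of integers with $1\le k_n<n$ such that $k_n\to\infty$ as $n\to\infty$ and $k_n=o(n^{\rho})$ for some $0<\rho<1/2$. Then, for $a\in\mathcal S_X$, $$\left\| Q_{nak}-\widetilde P_1^{k}\right\|_{TV}\longrightarrow 0\quad\text{as } n\to\infty,$$ where $Q_{nak}$ is the conditional distribution of $(X_1,\dots,X_k)$ given $\{S_{1,n}=na\}$ and $\widetilde P_1^{k}$ is the joint distribution of independent random variables $\big(\widetilde X_j^{\theta_n^a}\big)_{1\le j\le k}$.
   Context: Setting. $(X_j)_{j\ge1}$ is a sequence of independent real random variables, each absolutely continuous with respect to Lebesgue measure, with density $p_j$. Put $\Phi_j(\theta)=\mathbb E[e^{\theta X_j}]$, $\kappa_j=\log\Phi_j$, $m_j=\frac{d\kappa_j}{d\theta}$. For $\theta$ with $\Phi_j(\theta)<\infty$, $\widetilde X_j^{\theta}$ denotes a random variable with tilted density $\widetilde p_j^{\theta}(x)=e^{\theta x}p_j(x)/\Phi_j(\theta)$; its mean is $m_j(\theta)$, its variance is denoted $s_j^2(\theta)$, and $|\mu|_j^{\ell}(\theta):=\mathbb E\big[|\widetilde X_j^\theta-m_j(\theta)|^{\ell}\big]$ ($\ell$ is an index on the left). A function $f:(\alpha,\beta)\to(A,B)$ is said to satisfy $(\mathcal H)$ if it is strictly increasing, $\lim_{\theta\to\alpha}f(\theta)=A$ and $\lim_{\theta\to\beta}f(\theta)=B$. Standing assumptions: - the $X_j$ have a common support $\mathcal S_X=(A,B)$, with $A,B$ finite or not; - the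 $\Phi_j$ have the same domain of finiteness $\Theta=(\alpha,\beta)$, of non-void interior, with $\alpha,\beta$ finite or not; - for all $j\ge1$, $m_j$ satisfies $(\mathcal H)$; - there exist functions $f_+,f_-$ satisfying $(\mathcal H)$ with $f_-(\theta)\le m_j(\theta)\le f_+(\theta)$ for all $j\ge1$, $\theta\in\Theta$; - for any compact $K\subset\Theta$: $0<\inf_{j\ge1}\inf_{\theta\in K}s_j^2(\theta)\le\sup_{j\ge1}\sup_{\theta\in K}s_j^2(\theta)<\infty$; - for any compact $K\subset\Theta$: $\sup_{j\ge1}\sup_{\theta\in K}|\mu|_j^{6}(\theta)<\infty$; - each $p_j$ is of class $\mathcal C^1$ and for any compact $K\subset\Theta$: $\sup_{j\ge1}\sup_{\theta\in K}\big\|\frac{d\widetilde p_j^{\theta}}{dx}\big\|_{L^1}<\infty$. Fix $a\in\mathcal S_X$. $S_{i,n}=\sum_{j=i}^nX_j$. Under these assumptions there is a unique $\theta_n^a\in\Theta$ with $\frac1n\sum_{j=1}^n m_j(\theta_n^a)=a$. For $k<n$, $Q_{nak}$ has density $x_1^k\mapsto \big(\prod_{j=1}^kp_j(x_j)\big)\,p_{S_{k+1,n}}\big(na-\sum_{j=1}^kx_j\big)/p_{S_{1,n}}(na)$, where $p_U$ is the density of $U$. $\|P-Q\|_{TV}=\sup_{C}|P(C)-Q(C)|$ over Borel sets $C\subset\mathbb R^k$. *)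

(* Defs.v *)
From HB Require Import structures.
From mathcomp Require Import all_boot all_order all_algebra.
From mathcomp Require Import finmap.
From mathcomp Require Import all_classical all_reals all_analysis.

Set Implicit Arguments.
Unset Strict Implicit.
Unset Printing Implicit Defensive.

Import Order.TTheory GRing.Theory Num.Theory.
Import numFieldNormedType.Exports.

Local Open Scope classical_set_scope.
Local Open Scope ring_scope.

Section real_functions.
Context {R : realType}.

Definition eitv (A B : \bar R) : set R := [set x | (A < x%:E < B)%E].

(* The limits at the possibly infinite endpoints are taken in \bar R, along
   the neighbourhoods of the endpoint inside the open interval; [fine] only
   transports [f] from R to the finite points of \bar R. *)
Definition property_H (alpha beta A B : \bar R) (f : R -> R) : Prop :=
  [/\ forall t, eitv alpha beta t -> eitv A B (f t),
      forall s t, eitv alpha beta s -> eitv alpha beta t ->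
        s < t -> f s < f t,
      ((f (fine x))%:E
        @[x --> within [set x | (alpha < x < beta)%E] (nbhs alpha)] --> A) &
      ((f (fine x))%:E
        @[x --> within [set x | (alpha < x < beta)%E] (nbhs beta)] --> B)].

Definition class_C1 (f : R -> R) : Prop :=
  (forall x, derivable f x 1) /\ continuous (derive1 f).

End real_functions.

Section probability_notions.
Context d (T : measurableType d) (R : realType).

Definition is_density (P : probability T R) (U : T -> R) (p : R -> R) : Prop :=
  [/\ measurable_fun setT p,
      forall x, 0 <= p x &
      forall C : set R, measurable C ->
        P (U @^-1` C) = (\int[lebesgue_measure]_(x in C) (p x)%:E)%E].

(* Densities are evaluated at points below, so the version matters: this is the
   continuous one, which is unique when it exists. *)
Definition continuous_density (P : probability T R) (U : T -> R) : R -> R :=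
  xget (cst 0) [set p | continuous p /\ is_density P U p].

(* The topological support is closed: a law "with support (A, B)" has
   [law_support] equal to the closure of (A, B). *)
Definition law_support (P : probability T R) (U : T -> R) : set R :=
  [set x | forall V : set R, open V -> V x -> (0 < P (U @^-1` V))%E].

Definition mutually_independent (I : choiceType) (P : probability T R)
    (X : I -> {RV P >-> R}) : Prop :=
  forall (J : {fset I}) (E : I -> set R), (forall i, measurable (E i)) ->
    P (\bigcap_(i in [set` J]) X i @^-1` E i) =
    (\prod_(i <- J) P (X i @^-1` E i))%E.

Definition joint_law (k : nat) (P : probability T R)
    (X : 'I_k -> T -> R) : set (k.-tuple R) -> \bar R :=
  fun C => P [set w | C [tuple X j w | j < k]].

Definition tv_dist (mu nu : set T -> \bar R) : \bar R :=
  ereal_sup [set `|mu C - nu C|%E | C in measurable].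

End probability_notions.

Section lebesgue_tuple.
Context (R : realType) (k : nat).

Definition tuple_cons (x : measurableTypeR R * k.-tuple R) : k.+1.-tuple R :=
  [tuple of x.1 :: x.2].

Lemma measurable_tuple_cons : measurable_fun setT tuple_cons.
Proof. exact: measurable_cons. Qed.

Variable nu : {sigma_finite_measure set (k.-tuple R) -> \bar R}.

Definition cons_measure : set (k.+1.-tuple R) -> \bar R :=
  pushforward (lebesgue_measure \x nu)%E tuple_cons.

Let cons_measure0 : cons_measure set0 = 0%E.
Proof. by rewrite /cons_measure /pushforward preimage_set0 measure0. Qed.

Let cons_measure_ge0 C : (0 <= cons_measure C)%E.
Proof. exact: (measure_ge0 (lebesgue_measure \x nu)%E). Qed.

Let cons_measure_sigma_additive : semi_sigma_additive cons_measure.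
Proof.
apply: (@measure_semi_sigma_additive _ _ _
  (pushforward (lebesgue_measure \x nu)%E tuple_cons)).
exact: measurable_tuple_cons.
Qed.

HB.instance Definition _ := isMeasure.Build _ _ _ cons_measure
  cons_measure0 cons_measure_ge0 cons_measure_sigma_additive.

Let cons_measure_sigma_finite : sigma_finite setT cons_measure.
Proof.
have /sigma_finiteP[F [FT ndF Foo]] := sigma_finiteT (@lebesgue_measure R).
have /sigma_finiteP[G [GT ndG Goo]] := sigma_finiteT nu.
pose tl (t : k.+1.-tuple R) : k.-tuple R := [tuple of behead t].
pose hd (t : k.+1.-tuple R) : measurableTypeR R := thead t.
exists (fun n => hd @^-1` F n `&` tl @^-1` G n).
  apply/seteqP; split=> // t _.
  have [n _ Fn] : (\bigcup_n F n) (hd t) by rewrite -FT.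
  have [m _ Gm] : (\bigcup_m G m) (tl t) by rewrite -GT.
  exists (maxn n m) => //; split.
    exact: (subsetPset _ _ (ndF _ _ (leq_maxl n m))).
  exact: (subsetPset _ _ (ndG _ _ (leq_maxr n m))).
move=> n; have [mF Fn] := Foo n; have [mG Gn] := Goo n; split.
  apply: measurableI.
    by rewrite -[X in measurable X]setTI; exact: measurable_tnth.
  by rewrite -[X in measurable X]setTI; exact: measurable_behead.
rewrite /cons_measure /pushforward.
rewrite (_ : _ @^-1` _ = F n `*` G n).
  by rewrite product_measure1E// lte_mul_pinfty// ge0_fin_numE.
have tlK x t : tl (tuple_cons (x, t)) = t by apply/val_inj.
by apply/seteqP; split=> -[x t] /=; rewrite tlK.
Qed.

HB.instance Definition _ := Measure_isSigmaFinite.Build _ _ _ cons_measure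
  cons_measure_sigma_finite.

End lebesgue_tuple.

Fixpoint lebesgue_tuple (R : realType) (k : nat) :
    {sigma_finite_measure set (k.-tuple R) -> \bar R} :=
  if k is k'.+1 then cons_measure (lebesgue_tuple R k')
  else dirac [tuple].

Section tilting.
Context d (T : measurableType d) (R : realType) (P : probability T R).

Definition Phi (U : T -> R) (t : R) : \bar R := 'M_P U t.

Definition kappa (U : T -> R) (t : R) : R := ln (fine (Phi U t)).

Definition tilted_mean (U : T -> R) : R -> R := derive1 (kappa U).

Definition tilted_density (U : T -> R) (p : R -> R) (t x : R) : R :=
  expR (t * x) * p x / fine (Phi U t).

(* [tilted_mean U t] is the mean of the density [tilted_density U p t], so this
   is the variance of that density. *)
Definition tilted_var (U : T -> R) (p : R -> R) (t : R) : \bar R :=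
  (\int[lebesgue_measure]_x
     ((x - tilted_mean U t) ^+ 2 * tilted_density U p t x)%:E)%E.

Definition tilted_abs_moment (l : nat) (U : T -> R) (p : R -> R) (t : R) :
    \bar R :=
  (\int[lebesgue_measure]_x
     (`|x - tilted_mean U t| ^+ l * tilted_density U p t x)%:E)%E.

End tilting.

(* Indices are shifted by one: [X j] is the (j+1)-st variable of the sequence.
   Thus S_{1,n} is [partial_sum X 0 n] and S_{k+1,n} is [partial_sum X k n]. *)
Section conditioning.
Context d (T : measurableType d) (R : realType) (P : probability T R).
Variable X : nat -> {RV P >-> R}.

Definition partial_sum (i n : nat) (w : T) : R := \sum_(i <= j < n) X j w.

(* The solution t of (m_1(t) + ... + m_n(t)) / n = a in (alpha, beta). *)
Definition tilting_point (alpha beta : \bar R) (a : R) (n : nat) : R :=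
  xget 0 [set t | eitv alpha beta t /\
    n%:R^-1 * (\sum_(j < n) tilted_mean P (X j) t) = a].

Definition conditional_density (p : nat -> R -> R) (a : R) (n k : nat)
    (x : k.-tuple R) : R :=
  (\prod_(j < k) p j (tnth x j)) *
  continuous_density P (partial_sum k n) (n%:R * a - \sum_(j < k) tnth x j) /
  continuous_density P (partial_sum 0 n) (n%:R * a).

Definition conditional_law (p : nat -> R -> R) (a : R) (n k : nat) :
    set (k.-tuple R) -> \bar R :=
  fun C => (\int[lebesgue_tuple R k]_(x in C)
              (conditional_density p a n x)%:E)%E.

End conditioning.

Arguments conditional_law {d T R P} X p a n k.

(* Main.v *)
From HB Require Import structures.
Require Import Defs.
From mathcomp Require Import all_boot all_order all_algebra.
From mathcomp Require Import finmap.
From mathcomp Require Import all_classical all_reals all_analysis.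
From mathcomp Require Import measurable_realfun lebesgue_integral_under.
From mathcomp Require Import gauss_integral ring lra zify.

(* For t = theta_n^a the factors exp (t x_j) and Phi_j t cancel, so that the
   density of Q_{nak} relative to the tilted product law is
     r(x) = g_{k,n}(na - x_1 - ... - x_k) / g_{0,n}(na),
   where g_{i,n} is the density of the sum of the tilted variables of index
   i+1, ..., n. Three uniform estimates give |r - 1| <=
   C (sum_(j <= k) |x_j - m_j(t)| + k + 1) / sqrt n:
   - Mineka coupling: a C^1 density p with ||p'||_1 <= M overlaps any small
     enough translate of itself with mass >= 1/2, so that convolution by p is
     partly an average over two points h apart; comparing successive binomial
     averages yields |g_{i,n}(u) - g_{i,n}(v)| <= C (|u - v| + 1) / (n - i);
   - Lindeberg replacement against a Gaussian kernel yields
     g_{0,n}(na) >= c / sqrt n, since na is the mean of the tilted sum;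
   - the k first summands are removed one at a time, each one at cost C / n.
   Integrating bounds the total variation distance by C k / sqrt n, which tends
   to 0 because rho < 1/2. *)

Set Implicit Arguments.
Unset Strict Implicit.
Unset Printing Implicit Defensive.

Import Order.TTheory GRing.Theory Num.Theory.
Import numFieldNormedType.Exports.

Local Open Scope classical_set_scope.
Local Open Scope ring_scope.

(** * Translation invariance and convolution *)

(** Only orders of magnitude are compared: an oscillation O(k / n) against a height of at least c /
    sqrt n. No sharp local limit theorem and no characteristic function is called for; a lower bound
    of the right order at the mean suffices. The obstacle is uniformity. The tilt t = theta_n^a
    moves with n, so the tilted variables form a triangular array. The estimates on sums are
    therefore stated for arbitrary densities, with constants depending on two numbers only: M
    bounding ||p'||_1 and V bounding a centred third absolute moment. The envelopes f_- and f_+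
    confine all the tilts to one compact interval, where the assumptions supply M and V once and for
    all. The Gaussian kernel has width e sqrt n: wide enough for the n Lindeberg errors, each
    O(n^-2), to add up to O(1 / n), and, once e is small, narrow enough for the smoothed density to
    stay within a small multiple of 1 / sqrt n of the density at the mean. The Lipschitz bound
    contains |u - v| + 1 and not |u - v|, because differences are controlled at a fixed scale h
    only. *)

Section lebesgue_line.
Context {R : realType}.
Notation mu := (@lebesgue_measure R).
Implicit Types (f g p : R -> R) (c : R).

Lemma lebesgue_measure_shift c (A : set R) : measurable A ->
  pushforward mu ((fun x : R => x + c) : measurableTypeR R -> measurableTypeR R) A = mu A.
Proof.
move=> mA; apply/esym.
have mc : measurable_fun setT ((fun x : R => x + c) : measurableTypeR R -> measurableTypeR R).
  by apply: measurable_funD.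
apply: (@lebesgue_measure_unique R (pushforward mu ((fun x : R => x + c) : measurableTypeR R -> measurableTypeR R))) => //= _ [[a b]] _ <-.
rewrite /pushforward.
have -> : (fun x => x + c) @^-1` `]a, b] = `]a - c, b - c]%classic.
  by apply/seteqP; split => x /=; rewrite !in_itv/= ltrBlDr lerBrDr.
rewrite !lebesgue_measure_itv/= !lte_fin ltrD2r.
by case: ifP => // _; rewrite -!EFinB; congr (_%:E); ring.
Qed.

Lemma ge0_integral_shift (f : R -> \bar R) c : measurable_fun setT f ->
  (forall x, (0 <= f x)%E) -> (\int[mu]_x f (x + c)%R = \int[mu]_x f x)%E.
Proof.
move=> mf f0.
have mc : measurable_fun setT ((fun x : R => x + c) : measurableTypeR R -> measurableTypeR R).
  by apply: measurable_funD.
transitivity (integral (pushforward mu ((fun x : R => x + c) : measurableTypeR R -> measurableTypeR R)) setT f).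
  by rewrite (ge0_integral_pushforward mc).
by apply: eq_measure_integral => A mA _; exact: lebesgue_measure_shift.
Qed.

Lemma ge0_integral_opp (f : R -> \bar R) : measurable_fun setT f ->
  (forall x, (0 <= f x)%E) -> (\int[mu]_x f (- x)%R = \int[mu]_x f x)%E.
Proof.
move=> mf f0.
have mc : measurable_fun setT (-%R : measurableTypeR R -> measurableTypeR R) by [].
transitivity (integral (pushforward mu (-%R : measurableTypeR R -> measurableTypeR R)) setT f).
  by rewrite (ge0_integral_pushforward mc).
by apply: eq_measure_integral => A mA _; exact: lebesgue_measureN.
Qed.

Lemma ge0_integral_flip (f : R -> \bar R) c : measurable_fun setT f ->
  (forall x, (0 <= f x)%E) -> (\int[mu]_x f (c - x)%R = \int[mu]_x f x)%E.
Proof.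
move=> mf f0; rewrite -[RHS](ge0_integral_shift c)//.
rewrite -[RHS](@ge0_integral_opp (fun x => f (x + c)))//.
  by apply: eq_integral => x _; rewrite addrC.
by apply: measurableT_comp => //; exact: measurable_funD.
Qed.

Lemma integrable_shift f c : mu.-integrable setT (EFin \o f) ->
  mu.-integrable setT (EFin \o (fun x => f (x + c))).
Proof.
move=> /integrableP[/measurable_EFinP mf foo]; apply/integrableP; split.
  by apply/measurable_EFinP; apply: measurableT_comp => //; exact: measurable_funD.
rewrite (@ge0_integral_shift (fun x => `|(EFin \o f) x|%E) c)//.
by apply: measurableT_comp => //; apply/measurable_EFinP.
Qed.

Lemma Rintegral_shift f c : mu.-integrable setT (EFin \o f) ->
  \int[mu]_x f (x + c) = \int[mu]_x f x.
Proof.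
move=> fi; rewrite /Rintegral; congr fine.
rewrite integralE [RHS]integralE.
have /integrableP[mf _] := fi.
congr (_ - _)%E.
  rewrite -[RHS](@ge0_integral_shift _ c)//; first by apply: eq_integral => x _; rewrite ?funeposE ?funenegE.
  exact: measurable_funepos.
rewrite -[RHS](@ge0_integral_shift _ c)//; first by apply: eq_integral => x _; rewrite ?funeposE ?funenegE.
exact: measurable_funeneg.
Qed.

End lebesgue_line.

Section convolution_operator.
Context {R : realType}.
Notation mu := (@lebesgue_measure R).
Implicit Types (f g p q z : R -> R) (c h u : R).

Lemma EFin_Rintegral {d} {T : measurableType d} {nu : {measure set T -> \bar R}}
    {D : set T} (f : T -> R) : measurable D ->
  nu.-integrable D (EFin \o f) ->
  (\int[nu]_(x in D) f x)%:E = (\int[nu]_(x in D) (f x)%:E)%E.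
Proof. by move=> mD fi; rewrite /Rintegral fineK//; exact: integrable_fin_num. Qed.

Lemma integrable_bounded_mul c f p : measurable_fun setT f ->
  (forall x, `|f x| <= c) -> mu.-integrable setT (EFin \o p) ->
  mu.-integrable setT (EFin \o (fun x => f x * p x)).
Proof.
move=> mf fc ip.
apply: (@integrableMr _ (measurableTypeR R) R mu setT measurableT f (EFin \o p) mf _ ip).
by exists c; split; rewrite ?num_real// => y cy x _ /=; rewrite (le_trans (fc x))// ltW.
Qed.

Lemma Rintegral_bounded_mul c f p : measurable_fun setT f ->
  (forall x, `|f x| <= c) -> mu.-integrable setT (EFin \o p) ->
  (forall x, 0 <= p x) ->
  `|\int[mu]_x (f x * p x)| <= c * \int[mu]_x p x.
Proof.
move=> mf fc ip p0.
have i := integrable_bounded_mul mf fc ip.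
apply: (le_trans (le_normr_Rintegral _ i)) => //.
rewrite -RintegralZl//; apply: le_Rintegral => //.
- exact: integrable_norm.
- by apply: (integrableZl measurableT c ip).
- by move=> x _; rewrite normrM (ger0_norm (p0 x)) ler_wpM2r.
Qed.

(** Convolution is read as a Markov operator: [p] is the law of one step and [f] a bounded function,
    estimated in sup norm. Couplings of a step then become contraction estimates. *)
Definition conv_op p f : R -> R := fun u => \int[mu]_y (f (u - y) * p y).

Lemma measurable_flip f u : measurable_fun setT f ->
  measurable_fun setT (fun y : R => f (u - y)).
Proof. by move=> mf; apply: measurableT_comp => //; exact: measurable_funB. Qed.

Lemma integrable_conv c f p u : measurable_fun setT f ->
  (forall x, `|f x| <= c) -> mu.-integrable setT (EFin \o p) ->
  mu.-integrable setT (EFin \o (fun y => f (u - y) * p y)).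
Proof.
move=> mf fc ip.
by apply: (@integrable_bounded_mul c (fun y => f (u - y))) => //; exact: measurable_flip.
Qed.

Lemma conv_op_bound c f p : measurable_fun setT f ->
  (forall x, `|f x| <= c) -> mu.-integrable setT (EFin \o p) ->
  (forall x, 0 <= p x) -> \int[mu]_x p x = 1 ->
  forall u, `|conv_op p f u| <= c.
Proof.
move=> mf fc ip p0 p1 u; rewrite -[c]mulr1 -p1.
by apply: (@Rintegral_bounded_mul c (fun y => f (u - y))) => //; exact: measurable_flip.
Qed.

Lemma conv_op_continuous c f p : continuous f ->
  (forall x, `|f x| <= c) -> mu.-integrable setT (EFin \o p) ->
  continuous (conv_op p f).
Proof.
move=> cf fc ip a.
have mf := continuous_measurable_fun cf.
apply: (@continuity_under_integral R _ _ mu (fun u y => f (u - y) * p y) setT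
  measurableT (a - 1) (a + 1) _ _ (fun y => c * `|p y|)).
- by move=> x _; exact: integrable_conv fc ip.
- apply/aeW => y _ x _; apply: cvgM; last exact: cvg_cst.
  by apply: (continuous_comp (f := fun u => u - y)); [apply: cvgB => //; exact: cvg_cst|exact: cf].
- have i := integrable_norm ip; exact: (integrableZl measurableT c i).
- by move=> x _; apply/aeW => y _; rewrite normrM ler_wpM2r.
- by apply/mem_set; rewrite /= in_itv/=; apply/andP; split; lra.
Qed.

Lemma conv_opD c f g p a b : measurable_fun setT f -> measurable_fun setT g ->
  (forall x, `|f x| <= c) -> (forall x, `|g x| <= c) ->
  mu.-integrable setT (EFin \o p) ->
  conv_op p (fun x => a * f x + b * g x) =
  (fun u => a * conv_op p f u + b * conv_op p g u).
Proof.
move=> mf mg fc gc ip; apply/funext => u; rewrite /conv_op.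
have i1 := integrable_conv u mf fc ip.
have i2 := integrable_conv u mg gc ip.
rewrite -(RintegralZl _ _ i1)// -(RintegralZl _ _ i2)//.
rewrite -RintegralD//.
- by apply: eq_Rintegral => x _; ring.
- exact: (integrableZl measurableT a i1).
- exact: (integrableZl measurableT b i2).
Qed.

Lemma conv_op_translate p f h u :
  conv_op p (fun x => f (x - h)) u = conv_op p f (u - h).
Proof. by rewrite /conv_op; apply: eq_Rintegral => x _; rewrite addrAC. Qed.

(** A fair step in {0, h}. With tau the translation by h, [shift_diff h m] below is (1 - tau) ((1 +
    tau) / 2)^m, a difference smoothed by m fair steps. *)
Definition shift_avg h z : R -> R := fun x => 2^-1 * z x + 2^-1 * z (x - h).

Fixpoint shift_diff h m z : R -> R :=
  if m is m'.+1 then shift_diff h m' (shift_avg h z)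
  else fun x => z x - z (x - h).

Lemma continuous_translate f h : continuous f -> continuous (fun x => f (x - h)).
Proof.
move=> cf x.
by apply: (continuous_comp (f := fun u => u - h)); [apply: cvgB => //; exact: cvg_cst|exact: cf].
Qed.

Lemma shift_avg_continuous h z : continuous z -> continuous (shift_avg h z).
Proof.
move=> cz x; apply: cvgD; apply: cvgM; try exact: cvg_cst; first exact: cz.
exact: continuous_translate.
Qed.

Lemma shift_avg_bound h z c : (forall x, `|z x| <= c) ->
  forall x, `|shift_avg h z x| <= c.
Proof.
move=> zc x; rewrite /shift_avg -mulrDr normrM ger0_norm ?invr_ge0//.
by have := zc x; have := zc (x - h); have := ler_normD (z x) (z (x - h)); lra.
Qed.

Lemma shift_diff_continuous h m z : continuous z -> continuous (shift_diff h m z).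
Proof.
elim: m z => [|m IH] z cz /=; last exact/IH/shift_avg_continuous.
by move=> x; apply: cvgB; [exact: cz|exact: continuous_translate].
Qed.

Lemma shift_avg_conv h c p f : continuous f -> (forall x, `|f x| <= c) ->
  mu.-integrable setT (EFin \o p) ->
  shift_avg h (conv_op p f) = conv_op p (shift_avg h f).
Proof.
move=> cf fc ip; rewrite /shift_avg (@conv_opD c f (fun x => f (x - h)))//.
- by apply/funext => u; rewrite conv_op_translate.
- exact: continuous_measurable_fun.
- by apply: continuous_measurable_fun; exact: continuous_translate.
Qed.

(** Convolution commutes with combinations of translations, so the smoothed difference of a sum can
    be carried to the summands that remain after one step is split off. *)
Lemma shift_diff_conv h m c p f : continuous f -> (forall x, `|f x| <= c) ->
  mu.-integrable setT (EFin \o p) ->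
  shift_diff h m (conv_op p f) = conv_op p (shift_diff h m f).
Proof.
elim: m f => [|m IH] f cf fc ip /=.
  apply/funext => u; rewrite -conv_op_translate.
  have := @conv_opD c f (fun x => f (x - h)) p 1 (-1).
  move/(_ (continuous_measurable_fun cf)).
  move/(_ (continuous_measurable_fun (continuous_translate (h := h) cf)) fc (fun x => fc (x - h)) ip).
  move/(congr1 (fun F => F u)); rewrite mul1r mulN1r => <-.
  rewrite /conv_op; apply: eq_Rintegral => x _.
  by rewrite mul1r mulN1r.
rewrite (shift_avg_conv h cf fc ip) IH//; first exact: shift_avg_continuous.
exact: shift_avg_bound.
Qed.

(* The overlap of [p] with its translate by [h] allows to couple a step of law
   [p] with its translate: on that overlap [p] is a half-half mixture of a law
   and its translate, so [conv_op p] factors there through [shift_avg h]. *)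
Lemma conv_op_overlap h p z c0 c1 : continuous p ->
  mu.-integrable setT (EFin \o p) -> (forall x, 0 <= p x) ->
  \int[mu]_x p x = 1 ->
  2^-1 <= \int[mu]_x Num.min (p x) (p (x + h)) ->
  continuous z -> (forall x, `|z x| <= c0) ->
  (forall x, `|shift_avg h z x| <= c1) -> c1 <= c0 ->
  forall u, `|conv_op p z u| <= (c0 + c1) / 2.
Proof.
move=> cp ip p0 p1 ov cz zc0 zc1 c10 u.
set q := fun x => Num.min (p x) (p (x + h)) in ov *.
have mp := continuous_measurable_fun cp.
have mz := continuous_measurable_fun cz.
have mph : measurable_fun setT (fun x : R => p (x + h)).
  by apply: measurableT_comp => //; exact: measurable_funD.
have mq : measurable_fun setT q by exact: measurable_minr.
have q0 x : 0 <= q x by rewrite /q le_min !p0.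
have iq : mu.-integrable setT (EFin \o q).
  apply: (le_integrable measurableT) ip => //; first exact/measurable_EFinP.
  by move=> x _ /=; rewrite lee_fin !ger0_norm// ge_min lexx.
pose qh x := q (x - h).
have iqh : mu.-integrable setT (EFin \o qh) by exact: integrable_shift.
have qh1 : \int[mu]_x qh x = \int[mu]_x q x by exact: Rintegral_shift.
(* What remains of [p] once the mixture of [q] and its translate is removed; it is nonnegative
   because [q x] and [q (x - h)] are both at most [p x]. *)
pose r x := p x - (2^-1 * q x + 2^-1 * qh x).
have r0 x : 0 <= r x.
  rewrite /r /qh /q subrK.
  have : Num.min (p x) (p (x + h)) <= p x by rewrite ge_min lexx.
  have : Num.min (p (x - h)) (p x) <= p x by rewrite ge_min lexx orbT.
  lra.
have i2q : mu.-integrable setT (EFin \o (fun x => 2^-1 * q x)).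
  exact: (integrableZl measurableT 2^-1 iq).
have i2qh : mu.-integrable setT (EFin \o (fun x => 2^-1 * qh x)).
  exact: (integrableZl measurableT 2^-1 iqh).
have iqq : mu.-integrable setT (EFin \o (fun x => 2^-1 * q x + 2^-1 * qh x)).
  exact: (integrableD measurableT i2q i2qh).
have ir : mu.-integrable setT (EFin \o r) by exact: (integrableB measurableT ip iqq).
have r1 : \int[mu]_x r x = 1 - \int[mu]_x q x.
  rewrite RintegralB// p1 RintegralD// (RintegralZl _ _ iq)// (RintegralZl _ _ iqh)//.
  by rewrite qh1; lra.
have mr : measurable_fun setT r by have /integrableP[/measurable_EFinP] := ir.
have -> : conv_op p z u = conv_op r z u + conv_op q (shift_avg h z) u.
  rewrite /conv_op.
  have -> : \int[mu]_y (shift_avg h z (u - y) * q y) =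
      \int[mu]_y (z (u - y) * (2^-1 * q y + 2^-1 * qh y)).
    rewrite /shift_avg.
    have iz1 := integrable_conv u mz zc0 i2q.
    have iz2 := integrable_conv u mz zc0 i2qh.
    have iz3 := integrable_conv (u - h) mz zc0 i2q.
    transitivity (\int[mu]_y (z (u - y) * (2^-1 * q y)) +
        \int[mu]_y (z (u - h - y) * (2^-1 * q y))).
      rewrite -RintegralD//.
      by apply: eq_Rintegral => y _; rewrite (addrAC u (- h)); ring.
    rewrite -(Rintegral_shift (- h) iz3).
    rewrite -RintegralD//; last exact: (integrable_shift (- h) iz3).
    apply: eq_Rintegral => y _; rewrite /qh.
    by rewrite (_ : u - h - (y - h) = u - y); ring.
  rewrite -RintegralD//.
  - by apply: eq_Rintegral => y _; rewrite /r; ring.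
  - exact: (integrable_conv u mz zc0).
  - exact: (integrable_conv u mz zc0).
apply: (le_trans (ler_normD _ _)).
have := @Rintegral_bounded_mul c0 (fun y => z (u - y)) r (measurable_flip u mz) (fun y => zc0 _) ir r0.
have ma : measurable_fun setT (shift_avg h z).
  by apply: continuous_measurable_fun; exact: shift_avg_continuous.
have := @Rintegral_bounded_mul c1 (fun y => shift_avg h z (u - y)) q (measurable_flip u ma) (fun y => zc1 _) iq q0.
rewrite r1 -/(conv_op r z u) -/(conv_op q (shift_avg h z) u) => H1 H2.
apply: (le_trans (lerD H2 H1)).
(* With Q the mass of [q], the bound c0 (1 - Q) + c1 Q is nonincreasing in Q as c1 <= c0, so Q >=
   1/2 may be replaced by 1/2. *)
have : (c0 - c1) * 2^-1 <= (c0 - c1) * \int[mu]_x q x by rewrite ler_wpM2l// subr_ge0.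
by lra.
Qed.

End convolution_operator.

(** * Smoothing of the density of a sum *)

Section binomial_differences.
Local Open Scope nat_scope.

Lemma leq_bin_half M i l : i <= l -> l.*2 <= M -> 'C(M, i) <= 'C(M, l).
Proof.
elim: l => [|l IH]; first by rewrite leqn0 => /eqP ->.
rewrite leq_eqVlt => /predU1P[->//|il] lM.
apply: (leq_trans (IH _ _)); [lia|lia|].
have := mul_bin_left M l; nia.
Qed.

Lemma leq_bin_mid M i l : i <= l -> l <= M - i -> 'C(M, i) <= 'C(M, l).
Proof.
move=> il lM; have [h|h] := leqP l.*2 M; first exact: leq_bin_half.
by rewrite -(@bin_sub M l); [apply: leq_bin_half; lia|lia].
Qed.

Lemma sum_bin M : \sum_(0 <= l < M.+1) 'C(M, l) = 2 ^ M.
Proof.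
rewrite -[2]/(1 + 1) expnDn big_mkord; apply: eq_bigr => i _.
by rewrite !exp1n !muln1.
Qed.

(** The M - 2 i indices from i to M - i - 1 all carry a coefficient at least ['C(M, i)], and the
    whole row sums to 2^M. Truncated subtraction trivialises the other half of the row, which
    [bin_mul_gapC] recovers by symmetry. *)
Lemma bin_mul_gap M i : 'C(M, i) * (M - i.*2) <= 2 ^ M.
Proof.
have [h|h] := leqP M i.*2; first by rewrite (eqP (_ : M - i.*2 == 0)) ?muln0//; lia.
rewrite -sum_bin (big_cat_nat (n := i))/=; [|lia|lia].
rewrite (big_cat_nat (m := i) (n := M - i))/=; [|lia|lia].
suff : 'C(M, i) * (M - i.*2) <= \sum_(i <= l < M - i) 'C(M, l).
  by move=> H; apply: (leq_trans H); rewrite addnCA leq_addr.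
rewrite (_ : _ * _ = \sum_(i <= l < M - i) 'C(M, i)).
  rewrite big_nat [leqRHS]big_nat; apply: leq_sum => l /andP[il lM].
  by apply: leq_bin_mid => //; lia.
by rewrite sum_nat_const_nat mulnC; congr (_ * _); lia.
Qed.

Lemma bin_mul_gapC M i : i <= M -> 'C(M, i) * (i.*2 - M) <= 2 ^ M.
Proof.
move=> iM; rewrite -(bin_sub iM); have := bin_mul_gap M (M - i).
by rewrite (_ : M - (M - i).*2 = i.*2 - M); lia.
Qed.

End binomial_differences.

Section lattice_average.
Context {R : realType}.
Implicit Types (z f : R -> R).

(** (m + 1) (C(m, i+1) - C(m, i)) = (m + 1 - 2 (i + 1)) C(m+1, i+1), to which the two gap lemmas
    apply. Consecutive binomial weights thus differ by O(1 / m), although the largest weight is of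
    order 1 / sqrt m. *)
Lemma bin_diff_bound m i :
  `|'C(m, i.+1)%:R - 'C(m, i)%:R : R| * m.+1%:R <= 2 ^+ m.+1.
Proof.
have [im|mi] := leqP i m; last first.
  rewrite !bin_small ?subrr ?normr0 ?mul0r ?exprn_ge0//; lia.
have e1 : (m.+1 * 'C(m, i) = i.+1 * 'C(m.+1, i.+1))%N by exact: mul_bin_diag.
have e2 : (m.+1 * 'C(m, i.+1) = (m - i) * 'C(m.+1, i.+1))%N.
  by have := mul_bin_left m.+1 i.+1; have := mul_bin_diag m.+1 i.+1; rewrite /=; lia.
have b1 := bin_mul_gap m.+1 i.+1.
have b2 := @bin_mul_gapC m.+1 i.+1 im.
rewrite -(ger0_norm (ler0n R m.+1)) -normrM mulrBl -!natrM.
rewrite !(mulnC _ m.+1) e1 e2.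
have e3 : (2 : R) ^+ m.+1 = (2 ^ m.+1)%:R by rewrite natrX.
rewrite e3; have [h|h] := leqP (m - i) i.+1.
  rewrite distrC ger0_norm ?subr_ge0 ?ler_nat ?leq_mul2r ?h ?orbT//.
  by rewrite -natrB ?leq_mul2r ?h ?orbT// ler_nat; nia.
rewrite ger0_norm ?subr_ge0 ?ler_nat ?leq_mul2r ?(ltnW h) ?orbT//.
by rewrite -natrB ?leq_mul2r ?(ltnW h) ?orbT// ler_nat; nia.
Qed.

(** The coefficient of z (x - i h) in [shift_diff h m z]. The case i = 0 stands apart because C(m, i
    - 1) has to be read there as 0. *)
Let e m i : R := if i is i'.+1 then ('C(m, i)%:R - 'C(m, i')%:R) / 2 ^+ m else 1 / 2 ^+ m.

Let e_bound m i : `|e m i| <= 2 / m.+1%:R.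
Proof.
have p0 : (0 : R) < 2 ^+ m by rewrite exprn_gt0.
have m0 : (0 : R) < m.+1%:R by rewrite ltr0n.
rewrite /e; case: i => [|i] /=.
  rewrite ger0_norm; last by rewrite divr_ge0// ltW.
  rewrite ler_pdivrMr// mulrAC ler_pdivlMr// mul1r -exprS.
  by rewrite -natrX ler_nat; apply: ltnW; exact: ltn_expl.
rewrite normrM (gtr0_norm (_ : 0 < (2 ^+ m)^-1)) ?invr_gt0//.
by rewrite ler_pdivrMr// mulrAC ler_pdivlMr// -exprS; exact: bin_diff_bound.
Qed.

Let eS m i : e m.+1 i.+1 = 2^-1 * (e m i.+1 + e m i).
Proof.
rewrite /e; set p := 2 ^+ m; have -> : 2 ^+ m.+1 = 2 * p by rewrite exprS.
have p0 : p != 0 by rewrite gt_eqF// exprn_gt0.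
case: i => [|i]; first by rewrite !bin0 !bin1 -addn1 natrD; field.
by rewrite !binS !natrD; field.
Qed.

Let shift_diffE h m z x :
  shift_diff h m z x = \sum_(0 <= i < m.+2) e m i * z (x - i%:R * h).
Proof.
elim: m z x => [|m IH] z x.
  rewrite !big_nat_recl// big_geq// /e !bin0 bin_small// expr0 mul0r subr0 mul1r.
  by rewrite /= ?divr1 ?invr1 !mul1r; ring.
rewrite /= IH {IH} /shift_avg.
(* This vanishing coefficient lengthens the first of the two sums by one term, so that it lines up
   with the shifted second one. *)
have em : e m m.+2 = 0 by rewrite /e !bin_small ?subrr ?mul0r//.
transitivity (2^-1 * (\sum_(0 <= i < m.+3) e m i * z (x - i%:R * h) +
    \sum_(0 <= i < m.+2) e m i * z (x - i.+1%:R * h))).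
  rewrite [in X in _ * (X + _)]big_nat_recr// em mul0r [X in _ * (X + _)]addr0 -big_split/= mulr_sumr.
  apply: eq_bigr => i _.
  have -> : x - i.+1%:R * h = x - i%:R * h - h by rewrite -natr1; ring.
  by ring.
rewrite [in LHS]big_nat_recl//= [in RHS]big_nat_recl//= -addrA -big_split/= mulrDr.
congr (_ + _).
  rewrite /e/=; set p := 2 ^+ m; have -> : 2 ^+ m.+1 = 2 * p by rewrite exprS.
  have p0 : p != 0 by rewrite gt_eqF// exprn_gt0.
  by field.
rewrite mulr_sumr; apply: eq_bigr => i _; have := eS m i; rewrite /e/= => ->; ring.
Qed.

(** Every coefficient is O(1 / m), while the values of [z] along a lattice of step h have a bounded
    sum; nothing is lost to the number m + 2 of terms. *)
Lemma shift_diff_bound h m z V : (forall x, 0 <= z x) ->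
  (forall N x, \sum_(0 <= i < N) z (x - i%:R * h) <= V) ->
  forall x, `|shift_diff h m z x| <= 2 / m.+1%:R * V.
Proof.
move=> z0 zV x; rewrite shift_diffE; apply: (le_trans (ler_norm_sum _ _ _)).
apply: (@le_trans _ _ (\sum_(0 <= i < m.+2) 2 / m.+1%:R * z (x - i%:R * h))).
  by apply: ler_sum => i _; rewrite normrM (ger0_norm (z0 _)) ler_wpM2r.
by rewrite -mulr_sumr ler_wpM2l// divr_ge0.
Qed.

End lattice_average.

(** * Lattice sums and overlaps of C^1 densities *)

Section bounded_variation.
Context {R : realType}.
Notation mu := (@lebesgue_measure R).
Implicit Types (f p : R -> R) (a b h x : R).

Lemma class_C1_continuous f : class_C1 f -> continuous f.
Proof.
by move=> [df _] x; apply: differentiable_continuous; apply/derivable1_diffP.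
Qed.

(** Half-open intervals are used so that consecutive cells concatenate exactly. *)
Lemma C1_variation f a b : class_C1 f -> a <= b ->
  (`|f b - f a|%:E <= \int[mu]_(t in `]a, b]) `|derive1 f t|%:E)%E.
Proof.
move=> C1f; have cf := class_C1_continuous C1f.
case: C1f => df cdf; rewrite le_eqVlt => /predU1P[->|ab].
  by rewrite subrr normr0 integral_ge0.
have cdf' : {within `[a, b], continuous (derive1 f)} by exact: continuous_subspaceT.
have := @continuous_FTC2 R (derive1 f) f a b ab cdf'.
have dab : derivable_oo_LRcontinuous f a b.
  split; [by move=> x _; exact: df|exact/cvg_at_right_filter/cf|exact/cvg_at_left_filter/cf].
move=> /(_ dab (fun _ _ => erefl)) e.
have mdf : measurable_fun setT (derive1 f) by exact: continuous_measurable_fun.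
have -> : (\int[mu]_(t in `]a, b]) `|derive1 f t|%:E = \int[mu]_(t in `[a, b]) `|derive1 f t|%:E)%E.
  rewrite integral_itv_obnd_cbnd//; apply/measurable_EFinP.
  by apply: measurable_funTS; exact: measurableT_comp.
have -> : `|f b - f a|%:E = `|(f b - f a)%:E|%E by [].
rewrite EFinB -e; apply: le_abse_integral => //.
by apply/measurable_EFinP; exact: measurable_funTS.
Qed.

(** For t in the cell, [f b] exceeds [f t] by at most the variation of [f] over the cell; integrate
    this over t. *)
Lemma C1_cell f b h : class_C1 f -> (forall x, 0 <= f x) -> 0 < h ->
  ((h * f b)%:E <= \int[mu]_(t in `](b - h)%R, b]) (f t)%:E
     + h%:E * \int[mu]_(t in `](b - h)%R, b]) `|derive1 f t|%:E)%E.
Proof.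
move=> C1f f0 h0; have cf := class_C1_continuous C1f.
have mf : measurable_fun setT (EFin \o f).
  by apply/measurable_EFinP; exact: continuous_measurable_fun.
have [df cdf] := C1f.
have mdf : measurable_fun setT (fun t => `|derive1 f t|%:E).
  apply/measurable_EFinP; apply: measurableT_comp => //.
  exact: continuous_measurable_fun.
set V := (\int[mu]_(t in `](b - h)%R, b]) `|derive1 f t|%:E)%E.
have V0 : (0 <= V)%E by exact: integral_ge0.
have muI : mu `](b - h)%R, b] = h%:E.
  rewrite lebesgue_measure_itv/= lte_fin ltrBlDr ltrDl h0 -EFinB.
  by congr (_%:E); ring.
rewrite [X in (_ <= _ + X)%E](_ : _ = (\int[mu]_(t in `](b - h)%R, b]) V)%E); last first.
  by rewrite integral_cst//= [in RHS]muI muleC.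
rewrite -ge0_integralD//; last 2 first.
- by move=> x _; rewrite lee_fin.
- exact: measurable_funTS.
rewrite [X in (X <= _)%E](_ : _ = (\int[mu]_(t in `](b - h)%R, b]) (f b)%:E)%E); last first.
  by rewrite integral_cst//= [in RHS]muI -EFinM mulrC.
apply: ge0_le_integral => //.
- by move=> x _; rewrite lee_fin.
- by apply: emeasurable_funD => //; exact: measurable_funTS.
move=> t /=; rewrite in_itv/= => /andP[bt tb].
have := C1_variation C1f tb.
have : (\int[mu]_(t0 in `]t, b]) `|derive1 f t0|%:E <= V)%E.
  apply: ge0_subset_integral => //; first exact: measurable_funTS.
  by apply: subset_itvr; rewrite bnd_simp ltW.
move=> H1 H2.
rewrite (_ : f b = f t + (f b - f t)); last by ring.
rewrite EFinD leeD2l// (le_trans _ (le_trans H2 H1))// lee_fin ler_norm//.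
Qed.

Lemma C1_lattice f h x N : class_C1 f -> (forall x, 0 <= f x) -> 0 < h ->
  ((h * \sum_(0 <= i < N) f (x - i%:R * h))%:E <=
     \int[mu]_(t in `](x - N%:R * h)%R, x]) (f t)%:E
     + h%:E * \int[mu]_(t in `](x - N%:R * h)%R, x]) `|derive1 f t|%:E)%E.
Proof.
move=> C1f f0 h0; have cf := class_C1_continuous C1f.
have mf : measurable_fun setT (EFin \o f).
  by apply/measurable_EFinP; exact: continuous_measurable_fun.
have [df cdf] := C1f.
have mdf : measurable_fun setT (fun t => `|derive1 f t|%:E).
  apply/measurable_EFinP; apply: measurableT_comp => //.
  exact: continuous_measurable_fun.
elim: N => [|N IH].
  by rewrite big_geq// mulr0 adde_ge0 ?mule_ge0 ?integral_ge0 ?lee_fin// ?ltW// => t _; rewrite lee_fin.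
rewrite big_nat_recr//= mulrDr EFinD.
have := C1_cell (x - N%:R * h) C1f f0 h0.
have -> : x - N%:R * h - h = x - N.+1%:R * h by rewrite -natr1; ring.
move=> /(leeD IH) /le_trans; apply.
have sp (g : R -> \bar R) : measurable_fun setT g -> (forall x, (0 <= g x)%E) ->
    (\int[mu]_(t in `](x - N.+1%:R * h)%R, x]) g t =
     \int[mu]_(t in `](x - N.+1%:R * h)%R, (x - N%:R * h)%R]) g t +
     \int[mu]_(t in `](x - N%:R * h)%R, x]) g t)%E.
  move=> mg g0.
  have l1 : x - N.+1%:R * h <= x - N%:R * h.
    by rewrite -natr1 mulrDl lerD2l lerN2 mul1r lerDl ltW.
  have l2 : x - N%:R * h <= x.
    by rewrite lerBlDr lerDl mulr_ge0// ltW.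
  rewrite (@itv_bndbnd_setU _ _ _ (BRight (x - N%:R * h)))//.
  rewrite ge0_integral_setU//.
  - exact: measurable_funTS.
  - apply/disj_setPS => y [/=]; rewrite !in_itv/= => /andP[_ yx] /andP[].
    by rewrite ltNge yx.
rewrite !sp// [X in (_ <= _ + X)%E]ge0_muleDr ?integral_ge0//.
rewrite addeACA; set l := (X in (X <= _)%E); set r := (X in (_ <= X)%E); suff -> : l = r by [].
rewrite /l /r; congr (_ + _)%E; exact: addeC.
Qed.

(** A Riemann sum of step h exceeds the integral, at most 1, by at most h times the total variation,
    whatever the base point and the number of points. *)
Lemma C1_lattice_sum f h x M N : class_C1 f -> (forall x, 0 <= f x) -> 0 < h ->
  (\int[mu]_t (f t)%:E = 1)%E -> (\int[mu]_t `|derive1 f t|%:E <= M%:E)%E ->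
  \sum_(0 <= i < N) f (x - i%:R * h) <= h^-1 + M.
Proof.
move=> C1f f0 h0 f1 fM; have cf := class_C1_continuous C1f.
have mf : measurable_fun setT (EFin \o f).
  by apply/measurable_EFinP; exact: continuous_measurable_fun.
have [df cdf] := C1f.
have mdf : measurable_fun setT (fun t => `|derive1 f t|%:E).
  apply/measurable_EFinP; apply: measurableT_comp => //.
  exact: continuous_measurable_fun.
have := C1_lattice x N C1f f0 h0.
have H1 : (\int[mu]_(t in `](x - N%:R * h)%R, x]) (f t)%:E <= 1)%E.
  by rewrite -f1; apply: ge0_subset_integral => // t _; rewrite lee_fin.
have H2 : (\int[mu]_(t in `](x - N%:R * h)%R, x]) `|derive1 f t|%:E <= M%:E)%E.
  by apply: le_trans fM; apply: ge0_subset_integral.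
move=> /le_trans /(_ (leeD H1 (lee_wpmul2l (ltW h0 : 0 <= h%:E)%E H2))).
rewrite -EFinM -EFinD lee_fin => H.
rewrite -(ler_pM2l h0); apply: (le_trans H).
by rewrite mulrDr divff ?gt_eqF.
Qed.

(** |f (t + h) - f t| is at most the integral of |f'| over ]t, t + h]. By Tonelli, each s in ]0, h]
    then contributes the whole of ||f'||_1. *)
Lemma C1_shift_L1 f h M : class_C1 f -> 0 <= h ->
  (\int[mu]_t `|derive1 f t|%:E <= M%:E)%E ->
  (\int[mu]_t `|f (t + h)%R - f t|%:E <= (h * M)%:E)%E.
Proof.
move=> C1f h0 fM; have cf := class_C1_continuous C1f.
have mf : measurable_fun setT f by exact: continuous_measurable_fun.
have [df cdf] := C1f.
have mdf : measurable_fun setT (fun t => `|derive1 f t|).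
  by apply: measurableT_comp => //; exact: continuous_measurable_fun.
pose g (w : R * R) : \bar R := (`|derive1 f (w.2 + w.1)| * \1_(`]0, h]) w.2)%:E.
have mg : measurable_fun setT g.
  apply/measurable_EFinP; apply: measurable_funM.
    apply: (measurableT_comp mdf (f := fun t => `|derive1 f t|) (g := fun w : R * R => w.2 + w.1)).
    exact: (measurable_funD measurable_snd measurable_fst).
  by apply: (measurableT_comp (f := \1_(`]0, h]) : R -> R)).
have g0 w : (0 <= g w)%E by rewrite lee_fin mulr_ge0.
apply: (@le_trans _ _ (\int[mu]_t \int[mu]_s g (t, s))%E).
  apply: ge0_le_integral => //.
  - apply/measurable_EFinP; apply: measurableT_comp => //; apply: measurable_funB => //.
    by apply: measurableT_comp => //; exact: measurable_funD.
  - exact: measurable_fun_fubini_tonelli_F.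
  move=> t _; apply: (le_trans (C1_variation C1f (_ : t <= t + h))); first by rewrite lerDl.
  rewrite integral_mkcond -(ge0_integral_shift (f := (fun s => `|derive1 f s|%:E) \_ `]t, (t + h)%R]) t); last 2 first.
  - by apply/(measurable_restrictT _ _).1 => //; apply/measurable_EFinP; exact: measurable_funTS.
  - by move=> x; rewrite /patch; case: ifP => //; rewrite lee_fin.
  suff -> : (\int[mu]_x ((fun s => `|derive1 f s|%:E) \_ `]t, (t + h)%R]) (x + t)%R = \int[mu]_s g (t, s))%E by [].
  apply: eq_integral => s _; rewrite /g/= /patch mem_setE in_itv/= indicE mem_setE in_itv/=.
  by rewrite ltrDr addrC lerD2l; case: ifP => _; rewrite ?mulr1 ?mulr0.
rewrite fubini_tonelli//.
apply: (@le_trans _ _ (\int[mu]_s (M%:E * (\1_(`]0, h]) s)%:E))%E).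
  apply: ge0_le_integral => //.
  - by move=> s _; apply: integral_ge0.
  - exact: measurable_fun_fubini_tonelli_G.
  - by apply: measurable_funeM; apply/measurable_EFinP; exact: measurable_indic.
  move=> s _; rewrite /g/=.
  under eq_integral do rewrite EFinM muleC addrC.
  rewrite ge0_integralZl//=; last first.
    apply/measurable_EFinP; apply: (measurableT_comp mdf (g := fun x => x + s)).
    by apply: measurable_funD.
  rewrite (@ge0_integral_shift _ (fun t => `|derive1 f t|%:E))//; last by apply/measurable_EFinP.
  by rewrite muleC; apply: lee_wpmul2r; rewrite ?lee_fin.
have M0 : (0 <= M%:E)%E by apply: le_trans fM; exact: integral_ge0.
rewrite ge0_integralZl//.
  rewrite integral_indic//= setIT lebesgue_measure_itv/= lte_fin.
  by rewrite -EFinB subr0; case: ltP => h0'; rewrite -?EFinM ?mule0 lee_fin ?(mulrC M)// (le_anti (_ : 0 <= h <= 0)) ?h0 ?h0'// mul0r.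
by apply/measurable_EFinP; exact: measurable_indic.
Qed.

(** min(a, b) = (a + b - |a - b|) / 2, so the overlap is 1 minus half the L1 distance between [p]
    and its translate, and that distance is at most h M <= 1. *)
Lemma C1_overlap p h M : class_C1 p -> (forall x, 0 <= p x) ->
  (\int[mu]_t (p t)%:E = 1)%E -> (\int[mu]_t `|derive1 p t|%:E <= M%:E)%E ->
  0 <= h -> h * M <= 1 ->
  2^-1 <= \int[mu]_x Num.min (p x) (p (x + h)).
Proof.
move=> C1p p0 p1 pM h0 hM.
have mp : measurable_fun setT p by apply: continuous_measurable_fun; exact: class_C1_continuous.
have ip : mu.-integrable setT (EFin \o p).
  apply/integrableP; split; first exact/measurable_EFinP.
  by under eq_integral do rewrite /= ger0_norm//; rewrite p1 ltry.
have iph : mu.-integrable setT (EFin \o (fun x => p (x + h))) by exact: integrable_shift.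
have id : mu.-integrable setT (EFin \o (fun x => p (x + h) - p x)).
  exact: (integrableB measurableT iph ip).
have idn := integrable_norm id.
have -> : \int[mu]_x Num.min (p x) (p (x + h)) =
    \int[mu]_x (2^-1 * (p x + p (x + h)) - 2^-1 * `|p (x + h) - p x|).
  apply: eq_Rintegral => x _; case: (leP (p x) (p (x + h))) => H.
    by rewrite ger0_norm ?subr_ge0//; lra.
  by rewrite ltr0_norm ?subr_lt0//; lra.
have is' : mu.-integrable setT (EFin \o (fun x => p x + p (x + h))).
  exact: (integrableD measurableT ip iph).
rewrite RintegralB//; last 2 first.
- exact: (integrableZl measurableT 2^-1 is').
- exact: (integrableZl measurableT 2^-1 idn).
rewrite (RintegralZl _ _ is')// (RintegralZl _ _ idn)// RintegralD//.
rewrite (Rintegral_shift h ip).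
have -> : \int[mu]_x p x = 1 by rewrite /Rintegral p1.
have : \int[mu]_x `|p (x + h) - p x| <= 1.
  rewrite -lee_fin EFin_Rintegral//; apply: (le_trans (C1_shift_L1 C1p h0 pM)).
  by rewrite lee_fin.
by lra.
Qed.

End bounded_variation.

(** * Mineka's coupling and the oscillation of the density of a sum *)

Section local_equicontinuity.
Context {R : realType}.
Notation mu := (@lebesgue_measure R).
Implicit Types (p : nat -> R -> R) (h x u v M : R).

Definition C1_density M (f : R -> R) :=
  [/\ class_C1 f, forall x, 0 <= f x, (\int[mu]_x (f x)%:E = 1)%E &
      (\int[mu]_x `|derive1 f x|%:E <= M%:E)%E].

(** Density of the sum of the [l.+1] variables of index i, ..., i + l. This excludes the empty sum,
    which has no density. *)
Fixpoint sum_density p i l : R -> R :=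
  if l is l'.+1 then conv_op (p i) (sum_density p i.+1 l') else p i.

Lemma C1_density_continuous M f : C1_density M f -> continuous f.
Proof. by case=> /class_C1_continuous. Qed.

Lemma C1_density_integrable M f : C1_density M f -> mu.-integrable setT (EFin \o f).
Proof.
move=> fM; have cf := C1_density_continuous fM; case: fM => _ f0 f1 _.
apply/integrableP; split.
  by apply/measurable_EFinP; exact: continuous_measurable_fun.
by under eq_integral do rewrite /= ger0_norm//; rewrite f1 ltry.
Qed.

Lemma C1_density_Rintegral M f : C1_density M f -> \int[mu]_x f x = 1.
Proof. by case=> _ _ f1 _; rewrite /Rintegral f1. Qed.

Lemma C1_density_M_ge0 M f : C1_density M f -> 0 <= M.
Proof.
by case=> _ _ _ fM; rewrite -lee_fin; apply: le_trans fM; exact: integral_ge0.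
Qed.

(** The lattice bound with a single point and h = 1. *)
Lemma C1_density_bound M f : C1_density M f -> forall x, `|f x| <= 1 + M.
Proof.
move=> [C1f f0 f1 fM] x; rewrite ger0_norm//.
have := @C1_lattice_sum _ f 1 x M 1 C1f f0 ltr01 f1 fM.
by rewrite big_nat1 mul0r subr0 invr1.
Qed.

Section uniform.
Variables (p : nat -> R -> R) (M : R) (n : nat).
Hypothesis pM : forall i, (i < n)%N -> C1_density M (p i).

Lemma sum_density_regular l i : (i + l < n)%N ->
  continuous (sum_density p i l) /\ forall x, 0 <= sum_density p i l x <= 1 + M.
Proof.
elim: l i => [|l IH] i; rewrite ?addn0 => il /=.
  split; first exact: (C1_density_continuous (pM il)).
  move=> x; have := C1_density_bound (pM il) x.
  by have [_ f0 _ _] := pM il; rewrite ger0_norm// f0.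
have [|c b] := IH i.+1; first by rewrite addSnnS.
have bn x : `|sum_density p i.+1 l x| <= 1 + M.
  by have /andP[b0 b1] := b x; rewrite ger0_norm.
have pi := pM (leq_ltn_trans (leq_addr _ _) il).
have ip := C1_density_integrable pi.
split; first exact: conv_op_continuous ip.
move=> x; have [_ p0 _ _] := pi.
have := conv_op_bound (continuous_measurable_fun c) bn ip p0 (C1_density_Rintegral pi) x.
have : 0 <= conv_op (p i) (sum_density p i.+1 l) x.
  apply: Rintegral_ge0 => // y _; rewrite mulr_ge0//.
  by have /andP[] := b (x - y).
by move=> H; rewrite ger0_norm// H.
Qed.

Lemma shift_avg_diff h m z :
  shift_avg h (shift_diff h m z) = shift_diff h m (shift_avg h z).
Proof.
elim: m z => [|m IH] z /=; last by rewrite IH.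
by apply/funext => x; rewrite /shift_avg; ring.
Qed.

(** Let D(l, m) bound the left-hand side for all i. Splitting off one summand by [conv_op_overlap]
    gives D(l+1, m) <= (D(l, m) + D(l, m+1)) / 2: with probability at least 1/2 the summand supplies
    one more fair step. The claimed bound is a supersolution of this recursion. The case l = 0 asks
    for 2 / (m + 1) <= 8 / (4 m + 2), and with X = l + 4 m + 2 the average of 1 / X and 1 / (X + 4)
    is at most 1 / (X + 1) as soon as X >= 2. *)
Lemma sum_density_shift_diff h l m i : 0 < h -> h * M <= 1 -> (i + l < n)%N ->
  forall x, `|shift_diff h m (sum_density p i l) x| <=
    8 * (h^-1 + M) / (l + 4 * m + 2)%:R.
Proof.
move=> h0 hM; elim: l m i => [|l IH] m i; rewrite ?addn0 => il x /=.
  have [C1f f0 f1 fM] := pM il.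
  have := shift_diff_bound m f0 (fun N x => C1_lattice_sum x N C1f f0 h0 f1 fM) x.
  move=> /le_trans; apply.
  have M0 := C1_density_M_ge0 (pM il).
  have V0 : 0 <= h^-1 + M by rewrite addr_ge0// invr_ge0 ltW.
  rewrite [leRHS]mulrAC ler_wpM2r//.
  rewrite ler_pdivrMr ?ltr0n// mulrAC ler_pdivlMr ?ltr0n ?addn2// -!natrM ler_nat.
  lia.
have il1 : (i < n)%N by exact: leq_ltn_trans (leq_addr _ _) il.
have il2 : (i.+1 + l < n)%N by rewrite addSnnS.
have pi := pM il1; have ip := C1_density_integrable pi.
have M0 := C1_density_M_ge0 pi.
have V0 : 0 <= h^-1 + M by rewrite addr_ge0// invr_ge0 ltW.
have [c b] := sum_density_regular il2.
have bn y : `|sum_density p i.+1 l y| <= 1 + M.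
  by have /andP[b0 b1] := b y; rewrite ger0_norm.
rewrite (shift_diff_conv _ _ c bn ip).
have [C1f f0 f1 fM] := pi.
have le10 : 8 * (h^-1 + M) / (l + 4 * m.+1 + 2)%:R <= 8 * (h^-1 + M) / (l + 4 * m + 2)%:R.
  rewrite ler_wpM2l ?mulr_ge0// lef_pV2 ?posrE ?ltr0n ?addn2//.
  by rewrite ler_nat; lia.
have H1 y : `|shift_avg h (shift_diff h m (sum_density p i.+1 l)) y| <=
    8 * (h^-1 + M) / (l + 4 * m.+1 + 2)%:R.
  by rewrite shift_avg_diff; exact: (IH m.+1).
apply: (le_trans (conv_op_overlap (C1_density_continuous pi) ip f0
  (C1_density_Rintegral pi) (C1_overlap C1f f0 f1 fM (ltW h0) hM)
  (shift_diff_continuous c) (IH m i.+1 il2) H1 le10 x)).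
rewrite -mulrDr -!mulrA ler_wpM2l// ler_wpM2l//.
have -> : (l + 4 * m.+1 + 2)%:R = (l + 4 * m + 2)%:R + 4 :> R.
  by rewrite (_ : l + 4 * m.+1 + 2 = (l + 4 * m + 2) + 4)%N ?natrD//; lia.
have -> : (l.+1 + 4 * m + 2)%:R = (l + 4 * m + 2)%:R + 1 :> R.
  by rewrite (_ : l.+1 + 4 * m + 2 = (l + 4 * m + 2) + 1)%N ?natrD//; lia.
have : (2 : R) <= (l + 4 * m + 2)%:R by rewrite ler_nat; lia.
set X := (l + 4 * m + 2)%:R => X2; clearbody X.
have X0 : X != 0 by rewrite gt_eqF//; lra.
have X1 : X + 1 != 0 by rewrite gt_eqF//; lra.
have X4 : X + 4 != 0 by rewrite gt_eqF//; lra.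
rewrite -subr_ge0.
have -> : (X + 1)^-1 - (X^-1 + (X + 4)^-1) / 2 = (X - 2) / ((X + 1) * X * (X + 4)).
  by field; rewrite ?X4 ?X1 ?X0.
by rewrite divr_ge0 ?mulr_ge0//; lra.
Qed.

(** The product of 8 (3 M + 2), the cost of one shift since 1 / h + M <= 3 M + 2 for h >= 1 / (2 (M
    + 1)), and of 2 (M + 1), the number of shifts per unit of |u - v| + 1. *)
Definition lipschitz_cst := 16 * (M + 1) * (3 * M + 2).

(** The estimate for one shift contains 1 / h and requires h M <= 1, so all shifts are kept in
    [h0, 2 h0]: from u up to u + h0, then down to v in N equal shifts. The detour is what the added
    1 pays for. *)
Lemma sum_density_lipschitz l i u v : (i + l < n)%N ->
  `|sum_density p i l u - sum_density p i l v| <=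
    lipschitz_cst * (`|u - v| + 1) / l.+1%:R.
Proof.
move=> il; set g := sum_density p i l.
wlog uv : u v / v <= u => [H|].
  by have [/H//|/ltW/H] := leP v u; rewrite distrC (distrC v).
have M0 := C1_density_M_ge0 (pM (leq_ltn_trans (leq_addr _ _) il)).
(* With this choice h <= 2 h0 implies h M <= 1. *)
pose h0 := (2 * (M + 1))^-1.
have h00 : 0 < h0 by rewrite invr_gt0; lra.
have h0M : h0 * (2 * (M + 1)) = 1 by rewrite mulVf// gt_eqF//; lra.
have h0V : h0^-1 = 2 * (M + 1) by rewrite /h0 invrK.
clearbody h0.
pose c := 8 * (3 * M + 2) / l.+1%:R.
have step h x : h0 <= h -> h <= 2 * h0 -> `|g x - g (x - h)| <= c.
  move=> h1 h2; have hp : 0 < h by lra.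
  have hM : h * M <= 1.
    have : h * (M + 1) <= 2 * h0 * (M + 1) by rewrite ler_wpM2r//; lra.
    have -> : 2 * h0 * (M + 1) = h0 * (2 * (M + 1)) by ring.
    rewrite h0M.
    by lra.
  apply: (le_trans (sum_density_shift_diff 0 hp hM il x)).
  rewrite muln0 addn0 /c; apply: ler_pM.
  - by rewrite mulr_ge0// addr_ge0// invr_ge0 ltW.
  - by rewrite invr_ge0.
  - rewrite ler_wpM2l//.
    have : h^-1 <= h0^-1 by rewrite lef_pV2.
    by rewrite h0V; lra.
  - by rewrite lef_pV2 ?posrE ?ltr0n ?addn2// ler_nat.
have chain h N x : h0 <= h -> h <= 2 * h0 -> `|g x - g (x - N%:R * h)| <= N%:R * c.
  move=> h1 h2; elim: N => [|N IH]; first by rewrite !mul0r !subr0 subrr normr0.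
  have := step h (x - N%:R * h) h1 h2.
  have -> : x - N%:R * h - h = x - N.+1%:R * h by rewrite -natr1; ring.
  move=> H; have := ler_normD (g x - g (x - N%:R * h)) (g (x - N%:R * h) - g (x - N.+1%:R * h)).
  rewrite (_ : g x - g (x - N%:R * h) + _ = g x - g (x - N.+1%:R * h)); last by ring.
  move=> H2; apply: (le_trans H2).
  rewrite [leRHS](_ : _ = N%:R * c + c); last by rewrite -natr1; ring.
  exact: lerD.
pose H := u - v; have H0 : 0 <= H by rewrite subr_ge0.
(* (N - 1) h0 <= H < N h0, so that (H + h0) / N lies in [h0, 2 h0] even when H = 0. *)
pose N := (Num.truncn (H / h0)).+1.
have /andP[t1 t2] : (N.-1)%:R <= H / h0 < N%:R.
  by rewrite /N; apply: truncn_itv; rewrite divr_ge0// ltW.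
have N1 : N%:R = N.-1%:R + 1 :> R by rewrite natr1.
have Np : (0 : R) < N%:R by rewrite ltr0n.
rewrite ler_pdivlMr// in t1; rewrite ltr_pdivrMr// in t2.
pose h := (H + h0) / N%:R.
have hN : N%:R * h = H + h0 by rewrite /h mulrCA divff ?mulr1// gt_eqF.
have hl : h0 <= h by rewrite /h ler_pdivlMr// N1; lra.
have hr : h <= 2 * h0.
  rewrite /h ler_pdivrMr//.
  have : h0 <= h0 * N%:R by apply: ler_peMr; [exact: ltW|rewrite ler1n].
  by lra.
have := chain h N (u + h0) hl hr; rewrite hN.
have -> : u + h0 - (H + h0) = v by rewrite /H; ring.
have := step h0 (u + h0) (lexx _); rewrite addrK => /(_ ltac:(lra)).
have c0 : 0 <= c by rewrite /c divr_ge0//; lra.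
move=> s1 s2.
have : `|g u - g v| <= (N%:R + 1) * c.
  have := ler_normB (g (u + h0) - g v) (g (u + h0) - g u).
  rewrite (_ : g (u + h0) - g v - _ = g u - g v); last by ring.
  by lra.
move=> /le_trans; apply.
rewrite ger0_norm// -/H /lipschitz_cst.
apply: (@le_trans _ _ ((H * (2 * (M + 1)) + 2) * c)).
  rewrite ler_wpM2r// N1.
  have : N.-1%:R * h0 * (2 * (M + 1)) <= H * (2 * (M + 1)) by rewrite ler_wpM2r//; lra.
  by rewrite -mulrA h0M mulr1; lra.
rewrite /c !mulrA ler_wpM2r// -subr_ge0.
rewrite (_ : _ - _ = 16 * M * (3 * M + 2)); last by ring.
by rewrite !mulr_ge0//; lra.
Qed.

End uniform.
End local_equicontinuity.

(** * Lower bound of the density at the mean *)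

Section exponential_inequalities.
Context {R : realType}.
Implicit Types (t x z s : R).

(** From 1 - t <= exp (- t), multiplied by (1 + t) exp t. *)
Lemma expR_ub2 t : 0 <= t -> expR t <= 1 + t + t ^+ 2 * expR t.
Proof.
move=> t0; have e := expR_ge1Dx (- t); have et := expR_gt0 t.
have H : (1 + t) * (1 - t) <= (1 + t) * expR (- t) by rewrite ler_wpM2l//; lra.
have : (1 + t) * (1 - t) * expR t <= (1 + t) * expR (- t) * expR t.
  by rewrite ler_wpM2r// ltW.
by rewrite -mulrA -[X in _ <= X]mulrA -expRD addNr expR0; nra.
Qed.

Let e2 t : R := expR t - (1 + t + t ^+ 2 / 2).
Let e3 t : R := expR t - (1 + t + t ^+ 2 / 2 + t ^+ 3 / 6).

Let is_derive_e2 t : is_derive t 1 e2 (expR t - (1 + t)).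
Proof.
rewrite /e2; apply: is_derive_eq.
by rewrite /GRing.scale/=; lra.
Qed.

Let is_derive_e3 t : is_derive t 1 e3 (e2 t).
Proof.
rewrite /e3; apply: is_derive_eq.
by rewrite /GRing.scale/= /e2; lra.
Qed.

Let mono (f df : R -> R) x y : (forall t, is_derive t 1 f (df t)) ->
  x <= y -> (forall t, x <= t <= y -> 0 <= df t) -> f x <= f y.
Proof.
move=> fd; rewrite le_eqVlt => /predU1P[->//|xy] df0.
have [|c /[!in_itv]/= /andP[xc cy] H] := MVT xy (fun t _ => fd t).
  apply: continuous_subspaceT => t; apply: differentiable_continuous.
  by apply/derivable1_diffP; exact: ex_derive.
rewrite -subr_ge0 H; apply: mulr_ge0; last by rewrite subr_ge0 ltW.
by apply: df0; rewrite !ltW.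
Qed.

(** [e3] has derivative [e2], whose own derivative exp s - 1 - s is nonnegative, and both vanish at
    0. For t >= 0 already e2 t >= 0; for t <= 0, [e2] is nonpositive on [t, 0], whence e3 t >= 0.
    The remainder is polynomial and so stays bounded against a Gaussian. *)
Lemma expR_taylor2 t : 1 + t + t ^+ 2 / 2 - `|t| ^+ 3 / 6 <= expR t.
Proof.
have d2 s : 0 <= expR s - (1 + s) by rewrite subr_ge0 expR_ge1Dx.
have e20 : e2 0 = 0 by rewrite /e2 expR0; lra.
have e30 : e3 0 = 0 by rewrite /e3 expR0; lra.
have [t0|/ltW t0] := leP 0 t.
  have := mono is_derive_e2 t0 (fun s _ => d2 s).
  by rewrite e20 /e2 ger0_norm//; have := exprn_ge0 3 t0; lra.
have : e3 0 <= e3 t.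
  rewrite -lerN2; apply: (@mono (\- e3) (fun s => - e2 s) t 0) => // [s|s /andP[_ s0]].
    exact: is_deriveN.
  by have := mono is_derive_e2 s0 (fun s _ => d2 s); rewrite e20; lra.
by rewrite e30 /e3 ler0_norm//; lra.
Qed.

Lemma expR_ge_sqr x : 0 <= x -> x ^+ 2 / 2 <= expR x.
Proof.
by move=> x0; apply: le_trans (expR_ge1Dxn 1 x0); rewrite /= lerDr.
Qed.

Definition gauss_shape z : R := expR (- (z ^+ 2 / 2)).

Lemma gauss_shape_le1 z : gauss_shape z <= 1.
Proof. by rewrite /gauss_shape expR_le1 oppr_le0 divr_ge0 ?sqr_ge0. Qed.

Lemma gauss_shape_sqr z : z ^+ 2 * gauss_shape z <= 2.
Proof.
rewrite /gauss_shape expRN ler_pdivrMr ?expR_gt0//.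
by have := expR_ge1Dx (z ^+ 2 / 2); lra.
Qed.

Lemma gauss_shape_pow4 z : z ^+ 4 * gauss_shape z <= 8.
Proof.
rewrite /gauss_shape expRN ler_pdivrMr ?expR_gt0//.
have z0 : 0 <= z ^+ 2 / 2 by rewrite divr_ge0 ?sqr_ge0.
have := expR_ge_sqr z0; rewrite (_ : (z ^+ 2 / 2) ^+ 2 = z ^+ 4 / 4); last by field.
by lra.
Qed.

(** Taylor's formula for g = [gauss_shape], with g' = - z g and g'' = (z^2 - 1) g, and an error
    uniform in z. For |e| > 1 the left-hand side is nonpositive: its first three terms are at most
    1, 9 |e|^3 and |e|^3, whence 11. For |e| <= 1, g (z + e) = g z exp (- z e - e^2 / 2) and
    [expR_taylor2] applies, the powers of z being absorbed by g. *)
Lemma gauss_shape_taylor z e :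
  gauss_shape z - e * (z * gauss_shape z) + e ^+ 2 / 2 * ((z ^+ 2 - 1) * gauss_shape z)
    - 11 * `|e| ^+ 3 <= gauss_shape (z + e).
Proof.
have g0 : 0 < gauss_shape z by exact: expR_gt0.
have g1 := gauss_shape_le1 z.
have g2 := gauss_shape_sqr z.
have g4 := gauss_shape_pow4 z.
set g := gauss_shape z in g0 g1 g2 g4 *.
set w := `|z|; set d := `|e|.
have w0 : 0 <= w by exact: normr_ge0.
have d0 : 0 <= d by exact: normr_ge0.
have zw : z ^+ 2 = w ^+ 2 by rewrite real_normK// num_real.
have ed : e ^+ 2 = d ^+ 2 by rewrite real_normK// num_real.
have z4 : z ^+ 4 = w ^+ 4 by rewrite (exprM z 2 2) zw -exprM.
have wl : w * g <= 9.
  have : w <= 1 + w ^+ 4.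
    have [w1|w1] := leP w 1; first by rewrite (le_trans w1)// lerDl exprn_ge0.
    by rewrite (@le_trans _ _ (w ^+ 4))// ?lerDr// ler_eXnr// ltW.
  move=> H; have : w * g <= (1 + w ^+ 4) * g by rewrite ler_wpM2r// ltW.
  by rewrite -z4 mulrDl mul1r; lra.
have w3 : w ^+ 3 * g <= 9.
  have : w ^+ 3 <= 1 + w ^+ 4.
    have [w1|w1] := leP w 1.
      by rewrite (@le_trans _ _ 1)// ?exprn_ile1// lerDl exprn_ge0.
    by rewrite (@le_trans _ _ (w ^+ 4))// ?lerDr// ler_eXn2l.
  move=> H; have : w ^+ 3 * g <= (1 + w ^+ 4) * g by rewrite ler_wpM2r// ltW.
  by rewrite -z4 mulrDl mul1r; lra.
have [d1|d1] := ltP 1 d.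
  apply: (@le_trans _ _ 0); last exact: expR_ge0.
  have d13 : d <= d ^+ 3 by rewrite ler_eXnr// ltW.
  have d03 : 1 <= d ^+ 3 by rewrite exprn_ege1// ltW.
  have d23 : d ^+ 2 <= d ^+ 3 by rewrite ler_eXn2l.
  have h1 : - (e * (z * g)) <= 9 * d ^+ 3.
    rewrite (le_trans (ler_norm _))// normrN !normrM (ger0_norm (ltW g0)) -/d -/w.
    by rewrite mulrC ler_pM// mulr_ge0// ltW.
  have h2 : e ^+ 2 / 2 * ((z ^+ 2 - 1) * g) <= d ^+ 3.
    rewrite ed; apply: (@le_trans _ _ (d ^+ 2 / 2 * 2)); last by rewrite divfK.
    by rewrite ler_wpM2l ?divr_ge0 ?exprn_ge0// mulrBl mul1r; lra.
  lra.
pose t := - (z * e) - e ^+ 2 / 2.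
have -> : gauss_shape (z + e) = g * expR t.
  by rewrite /g /gauss_shape -expRD; congr expR; rewrite /t; field.
have := ler_wpM2l (ltW g0) (expR_taylor2 t).
apply: le_trans.
have tn : `|t| <= d * (w + 2^-1).
  rewrite /t; apply: (le_trans (ler_normB _ _)).
  rewrite normrN normrM -/d -/w (ger0_norm (_ : 0 <= e ^+ 2 / 2)); last by rewrite divr_ge0 ?sqr_ge0.
  rewrite ed.
  have : d ^+ 2 <= d by rewrite expr2 ler_piMl.
  by nra.
(* Convexity of the cube: (w + 1/2)^3 <= 4 (w^3 + 1/8). *)
have t3 : `|t| ^+ 3 <= d ^+ 3 * (4 * w ^+ 3 + 2^-1).
  apply: (@le_trans _ _ ((d * (w + 2^-1)) ^+ 3)); first by rewrite lerXn2r// nnegrE mulr_ge0// addr_ge0.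
  rewrite exprMn ler_wpM2l ?exprn_ge0//.
  have : 0 <= (w - 2^-1) ^+ 2 * (w + 2^-1) by rewrite mulr_ge0 ?sqr_ge0 ?addr_ge0.
  rewrite -subr_ge0 => H; rewrite (_ : _ - _ = 3 * ((w - 2^-1) ^+ 2 * (w + 2^-1))); last by field.
  by rewrite mulr_ge0.
have t2 : t ^+ 2 / 2 = z ^+ 2 * e ^+ 2 / 2 + z * e ^+ 3 / 2 + e ^+ 4 / 8 by rewrite /t; field.
have ze : - (w * d ^+ 3) <= z * e ^+ 3.
  by have := ler_norm (- (z * e ^+ 3)); rewrite normrN normrM normrX -/w -/d; lra.
have e4 : 0 <= e ^+ 4 by rewrite exprn_even_ge0.
have H1 : g * (`|t| ^+ 3 / 6) <= g * (d ^+ 3 * (4 * w ^+ 3 + 2^-1) / 6).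
  by rewrite ler_wpM2l ?(ltW g0)// ler_wpM2r.
have H2 : g * (- (w * d ^+ 3)) <= g * (z * e ^+ 3) by rewrite ler_wpM2l// ltW.
have H3 : 0 <= g * e ^+ 4 by rewrite mulr_ge0// ltW.
have H4 : d ^+ 3 * (w * g) <= d ^+ 3 * 9 by rewrite ler_wpM2l// exprn_ge0.
have H5 : d ^+ 3 * (w ^+ 3 * g) <= d ^+ 3 * 9 by rewrite ler_wpM2l// exprn_ge0.
have H6 : d ^+ 3 * g <= d ^+ 3 * 1 by rewrite ler_wpM2l// exprn_ge0.
rewrite t2 /t; nra.
Qed.

(** First-order expansion along the heat flow: at r = 1 the derivative of r^-1 g (z / r) in the
    variance r^2 is (z^2 - 1) g / 2. With s = r^2 - 1, the case s > 1 is crude. For s <= 1, g (z /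
    r) = g z exp t with t <= z^2 / 4, so half of the Gaussian exponent is left to absorb z^4. The
    constant 9 covers 32 / 4 + 1 / 2. *)
Lemma gauss_shape_heat r z : 1 <= r ->
  r^-1 * gauss_shape (z / r) <=
  gauss_shape z * (1 + (r ^+ 2 - 1) / 2 * (z ^+ 2 - 1)) + 9 * (r ^+ 2 - 1) ^+ 2.
Proof.
move=> r1; pose s := r ^+ 2 - 1.
have r0 : 0 < r by lra.
have s0 : 0 <= s by rewrite subr_ge0 exprn_ege1.
rewrite -/s.
have g0 : 0 < gauss_shape z by exact: expR_gt0.
have g1 := gauss_shape_le1 z.
have z20 : 0 <= z ^+ 2 by exact: sqr_ge0.
have rV1 : r^-1 <= 1 by rewrite invf_le1.
have rV0 : 0 < r^-1 by rewrite invr_gt0.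
have [s1|s1] := ltP 1 s.
  apply: (@le_trans _ _ 1); first by apply: mulr_ile1; rewrite ?gauss_shape_le1 ?expR_ge0 ?(ltW rV0).
  have H1 : 0 <= s * (gauss_shape z * z ^+ 2) by apply: mulr_ge0 => //; apply: mulr_ge0 => //; exact: ltW.
  have H2 : s * gauss_shape z <= s by rewrite ler_piMr.
  by nra.
pose t := z ^+ 2 / 2 * (s / r ^+ 2).
have r2 : r ^+ 2 = 1 + s by rewrite /s; ring.
have r2p : 0 < r ^+ 2 by rewrite exprn_gt0.
have eg : gauss_shape (z / r) = gauss_shape z * expR t.
  rewrite /gauss_shape -expRD; congr expR; rewrite /t /s; field.
  by rewrite gt_eqF.
have t0 : 0 <= t by rewrite /t mulr_ge0// divr_ge0// ltW.
have sr1 : s / r ^+ 2 <= s by rewrite ler_pdivrMr// r2; nra.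
have sr2 : s / r ^+ 2 <= 2^-1 by rewrite ler_pdivrMr// r2; lra.
have ts : t <= z ^+ 2 * s / 2 by rewrite /t; nra.
have tz : t <= z ^+ 2 / 4 by rewrite /t; nra.
(* Checked by squaring, since r^2 = 1 + s. *)
have rs : r^-1 <= 1 - s / 2 + s ^+ 2 / 2.
  have q0 : 0 <= 1 - s / 2 + s ^+ 2 / 2 by nra.
  rewrite -(ler_pXn2r (isT : (0 < 2)%N)) ?nnegrE ?(ltW rV0)// exprVn.
  rewrite -[(_ ^+ 2)^-1]mul1r ler_pdivrMr// r2.
  rewrite -subr_ge0 (_ : _ - _ = s ^+ 2 / 4 * (1 + 3 * s - s ^+ 2 + s ^+ 3)); last by field.
  have s3 : 0 <= s ^+ 3 by exact: exprn_ge0.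
  by apply: mulr_ge0; [rewrite divr_ge0 ?sqr_ge0|nra].
have q1 : 1 - s / 2 + s ^+ 2 / 2 <= 1 by nra.
have et := expR_ub2 t0.
have e1 : expR t <= 1 + z ^+ 2 * s / 2 + (z ^+ 2 * s / 2) ^+ 2 * expR (z ^+ 2 / 4).
  apply: (le_trans et); apply: lerD; first by rewrite lerD2l.
  apply: ler_pM; rewrite ?sqr_ge0 ?expR_ge0 ?ler_expR//.
  by rewrite lerXn2r// nnegrE (le_trans t0 ts).
have ge : gauss_shape z * (z ^+ 4 * expR (z ^+ 2 / 4)) <= 32.
  rewrite mulrCA /gauss_shape -expRD (_ : _ + _ = - (z ^+ 2 / 4)); last by field.
  rewrite expRN ler_pdivrMr ?expR_gt0//.
  have z0 : 0 <= z ^+ 2 / 4 by rewrite divr_ge0.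
  have := expR_ge_sqr z0; rewrite (_ : (z ^+ 2 / 4) ^+ 2 = z ^+ 4 / 16); last by field.
  by lra.
rewrite eg mulrCA.
have X1 : r^-1 * expR t <= (1 - s / 2 + s ^+ 2 / 2) * (1 + z ^+ 2 * s / 2) +
    (z ^+ 2 * s / 2) ^+ 2 * expR (z ^+ 2 / 4).
  set Q := 1 - s / 2 + s ^+ 2 / 2 in rs q1 *.
  apply: (@le_trans _ _ (Q * expR t)); first by rewrite ler_wpM2r ?expR_ge0.
  have Q0 : 0 <= Q by rewrite (le_trans _ rs)// ltW.
  apply: (le_trans (ler_wpM2l Q0 e1)); rewrite mulrDr lerD2l.
  by rewrite ler_piMl// mulr_ge0 ?sqr_ge0 ?expR_ge0.
have := ler_wpM2l (ltW g0) X1; move=> /le_trans; apply.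
rewrite mulrDr (_ : gauss_shape z * ((z ^+ 2 * s / 2) ^+ 2 * expR (z ^+ 2 / 4)) =
  s ^+ 2 / 4 * (gauss_shape z * (z ^+ 4 * expR (z ^+ 2 / 4)))); last by field.
have Y1 : s ^+ 2 / 4 * (gauss_shape z * (z ^+ 4 * expR (z ^+ 2 / 4))) <= s ^+ 2 / 4 * 32.
  by rewrite ler_wpM2l// divr_ge0// sqr_ge0.
have Y2 : gauss_shape z * ((1 - s / 2 + s ^+ 2 / 2) * (1 + z ^+ 2 * s / 2)) <=
   gauss_shape z * (1 + s / 2 * (z ^+ 2 - 1) + s ^+ 2 / 2).
  rewrite ler_wpM2l ?(ltW g0)// -subr_ge0.
  rewrite (_ : _ - _ = z ^+ 2 * s ^+ 2 / 4 * (1 - s)); last by field.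
  apply: mulr_ge0; last by rewrite subr_ge0.
  by apply: divr_ge0 => //; rewrite mulr_ge0 ?sqr_ge0.
have Y3 : gauss_shape z * (s ^+ 2 / 2) <= s ^+ 2 / 2 by rewrite ler_piMl// divr_ge0// sqr_ge0.
by have := sqr_ge0 s; lra.
Qed.

End exponential_inequalities.

(** * Gaussian kernels and one Lindeberg step *)

Section gaussian_kernel.
Context {R : realType}.
Notation mu := (@lebesgue_measure R).
Implicit Types (p : nat -> R -> R) (x z s : R).

(** The factor 1 / sqrt (2 pi) is omitted: the total mass is [gauss_mass] for every width, and the
    value at 0 is 1 / s. *)
Definition gauss_kernel s x : R := s^-1 * gauss_shape (x / s).

Definition gauss_mass : R := Num.sqrt (pi *+ 2).

Lemma gauss_mass_gt0 : 0 < gauss_mass.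
Proof. by rewrite sqrtr_gt0 pmulrn_lgt0// pi_gt0. Qed.

Lemma gauss_kernelE s : 0 < s -> gauss_kernel s = (fun x => gauss_mass * normal_pdf 0 s x).
Proof.
move=> s0; have s0' : s != 0 by rewrite gt_eqF.
apply/funext => x; rewrite normal_pdfE// /gauss_kernel /normal_fun.
rewrite /gauss_shape subr0 mulrA; congr (_ * expR _); last first.
  by rewrite -[_ *+ 2]mulr_natr; field.
rewrite /normal_peak -mulrnAr sqrtrM ?sqr_ge0// sqrtr_sqr ger0_norm ?(ltW s0)//.
rewrite -/gauss_mass; field.
by rewrite s0' gt_eqF// gauss_mass_gt0.
Qed.

Lemma gauss_kernel_continuous s : continuous (gauss_kernel s).
Proof.
move=> x; apply: cvgM; first exact: cvg_cst.
apply: (continuous_comp (f := fun x => - ((x / s) ^+ 2 / 2))); last exact: continuous_expR.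
apply: cvgN; apply: cvgM; last exact: cvg_cst.
apply: (@continuous_comp _ _ _ (fun x => x / s) (fun y => y ^+ 2) x); last exact: exprn_continuous.
exact: mulrr_continuous.
Qed.

Lemma gauss_kernel_ge0 s x : 0 <= s -> 0 <= gauss_kernel s x.
Proof. by move=> s0; rewrite mulr_ge0 ?invr_ge0// expR_ge0. Qed.

Lemma gauss_kernel_bound s : 0 < s -> forall x, `|gauss_kernel s x| <= s^-1.
Proof.
move=> s0 x; rewrite ger0_norm ?gauss_kernel_ge0 ?(ltW s0)//.
by rewrite /gauss_kernel ler_piMr ?gauss_shape_le1// invr_ge0 ltW.
Qed.

Lemma gauss_kernel_integrable s : 0 < s -> mu.-integrable setT (EFin \o gauss_kernel s).
Proof.
move=> s0; rewrite gauss_kernelE//.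
have i := integrable_normal_pdf 0 s.
exact: (integrableZl measurableT gauss_mass i).
Qed.

Lemma Rintegral_gauss_kernel s : 0 < s -> \int[mu]_x gauss_kernel s x = gauss_mass.
Proof.
move=> s0; rewrite gauss_kernelE//.
have i := integrable_normal_pdf 0 s.
by rewrite (RintegralZl _ _ i)// /Rintegral integral_normal_pdf mulr1.
Qed.

(** A kernel twice as wide reduces a first absolute moment to a mass. With z = x / s the claim reads
    |z| <= exp (3 z^2 / 8). *)
Lemma gauss_kernel_norm_le s x : 0 < s ->
  `|x| * gauss_kernel s x <= 2 * s * gauss_kernel (2 * s) x.
Proof.
move=> s0; have sn : s != 0 by rewrite gt_eqF.
rewrite /gauss_kernel [leLHS]mulrA [leRHS]mulrA divff ?mulf_neq0// mul1r; set z := x / s.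
have -> : `|x| / s = `|z| by rewrite /z normrM normfV (gtr0_norm s0).
have -> : x / (2 * s) = z / 2 by rewrite /z; field.
rewrite /gauss_shape.
have -> : expR (- ((z / 2) ^+ 2 / 2)) = expR (- (z ^+ 2 / 2)) * expR (3 / 8 * z ^+ 2).
  by rewrite -expRD; congr expR; field.
rewrite mulrC ler_wpM2l ?expR_ge0//.
apply: le_trans (expR_ge1Dx _).
have -> : z ^+ 2 = `|z| ^+ 2 by rewrite real_normK// num_real.
by have := sqr_ge0 (3 * `|z| - 4); nra.
Qed.

Lemma Rintegral_norm_gauss_kernel s : 0 < s ->
  mu.-integrable setT (EFin \o (fun x => `|x| * gauss_kernel s x)) /\
  \int[mu]_x (`|x| * gauss_kernel s x) <= 2 * s * gauss_mass.
Proof.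
move=> s0; have s20 : 0 < 2 * s by rewrite mulr_gt0.
have i2 := gauss_kernel_integrable s20.
have i : mu.-integrable setT (EFin \o (fun x => 2 * s * gauss_kernel (2 * s) x)).
  exact: (integrableZl measurableT (2 * s) i2).
have j : mu.-integrable setT (EFin \o (fun x => `|x| * gauss_kernel s x)).
  apply: (le_integrable measurableT) i => //.
    apply/measurable_EFinP; apply: measurable_funM; first exact: normr_measurable.
    by apply: continuous_measurable_fun; exact: gauss_kernel_continuous.
  move=> x _ /=; rewrite lee_fin.
  have A : 0 <= `|x| * gauss_kernel s x by rewrite mulr_ge0// gauss_kernel_ge0// ltW.
  have B := gauss_kernel_norm_le x s0.
  by rewrite (ger0_norm A) (ger0_norm (le_trans A B)).
split=> //; rewrite -(Rintegral_gauss_kernel s20) -(RintegralZl _ _ i2)//.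
by apply: le_Rintegral => // x _; exact: gauss_kernel_norm_le.
Qed.

(* One Lindeberg step: [gauss_kernel t] evolves [gauss_kernel s] by the heat flow
   during the time [t ^+ 2 - s ^+ 2], the variance of [f]. *)
Lemma gauss_kernel_step s t f m V x : 0 < s -> s <= t ->
  mu.-integrable setT (EFin \o f) -> (forall y, 0 <= f y) ->
  \int[mu]_y f y = 1 ->
  mu.-integrable setT (EFin \o (fun y => (y - m) * f y)) ->
  mu.-integrable setT (EFin \o (fun y => (y - m) ^+ 2 * f y)) ->
  mu.-integrable setT (EFin \o (fun y => `|y - m| ^+ 3 * f y)) ->
  \int[mu]_y ((y - m) * f y) = 0 ->
  \int[mu]_y ((y - m) ^+ 2 * f y) = t ^+ 2 - s ^+ 2 ->
  \int[mu]_y (`|y - m| ^+ 3 * f y) <= V ->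
  gauss_kernel t (x - m) - (9 * (t ^+ 2 - s ^+ 2) ^+ 2 / s ^+ 5 + 11 * V / s ^+ 4)
    <= conv_op f (gauss_kernel s) x.
Proof.
move=> s0 st i0 f0 f1 i1 i2 i3 m1 m2 m3.
have sn : s != 0 by rewrite gt_eqF.
have t0 : 0 < t by exact: lt_le_trans st.
have tn : t != 0 by rewrite gt_eqF.
pose z := (x - m) / s.
(* Coefficients, in powers of y - m, of s^-1 times the lower bound of [gauss_shape_taylor] at z with
   increment - (y - m) / s; [d] weights the cubic error. *)
pose a := s^-1 * gauss_shape z.
pose b := s^-2 * (z * gauss_shape z).
pose c := s^-3 / 2 * ((z ^+ 2 - 1) * gauss_shape z).
pose d := - (11 * s^-4).
have j0 : mu.-integrable setT (EFin \o (fun y => a * f y)) by exact: (integrableZl measurableT a i0).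
have j1 : mu.-integrable setT (EFin \o (fun y => b * ((y - m) * f y))) by exact: (integrableZl measurableT b i1).
have j2 : mu.-integrable setT (EFin \o (fun y => c * ((y - m) ^+ 2 * f y))) by exact: (integrableZl measurableT c i2).
have j3 : mu.-integrable setT (EFin \o (fun y => d * (`|y - m| ^+ 3 * f y))) by exact: (integrableZl measurableT d i3).
have j01 : mu.-integrable setT (EFin \o (fun y => a * f y + b * ((y - m) * f y))) by exact: (integrableD measurableT j0 j1).
have j23 : mu.-integrable setT (EFin \o (fun y => c * ((y - m) ^+ 2 * f y) + d * (`|y - m| ^+ 3 * f y))) by exact: (integrableD measurableT j2 j3).
have mk : measurable_fun setT (gauss_kernel s) by apply: continuous_measurable_fun; exact: gauss_kernel_continuous.
have ik := integrable_conv x mk (gauss_kernel_bound s0) i0.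
have H : a + c * (t ^+ 2 - s ^+ 2) + d * V <= conv_op f (gauss_kernel s) x.
  apply: (@le_trans _ _ (\int[mu]_y ((a * f y + b * ((y - m) * f y)) +
     (c * ((y - m) ^+ 2 * f y) + d * (`|y - m| ^+ 3 * f y))))).
    rewrite RintegralD// RintegralD// RintegralD//.
    rewrite !(RintegralZl _ _ i0, RintegralZl _ _ i1, RintegralZl _ _ i2, RintegralZl _ _ i3)//.
    rewrite f1 m1 m2 mulr0 mulr1 addr0 addrA lerD2l.
    by rewrite /d !mulNr lerN2 ler_wpM2l// mulr_ge0// invr_ge0 exprn_ge0// ltW.
  apply: le_Rintegral => //; first exact: (integrableD measurableT j01 j23).
  move=> y _; rewrite (_ : _ + _ = (a + b * (y - m) + c * (y - m) ^+ 2 + d * `|y - m| ^+ 3) * f y); last by ring.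
  rewrite ler_wpM2r//.
  have := gauss_shape_taylor z (- ((y - m) / s)).
  rewrite (_ : z + - ((y - m) / s) = (x - y) / s); last by rewrite /z; field.
  move=> /(ler_wpM2l (ltW (_ : 0 < s^-1))); rewrite invr_gt0 => /(_ s0).
  rewrite -/(gauss_kernel s (x - y)); apply: le_trans.
  rewrite normrN normrM normfV (gtr0_norm s0) le_eqVlt; apply/orP; left; apply/eqP.
  by rewrite /a /b /c /d; field.
apply: le_trans H.
have r1 : 1 <= t / s by rewrite ler_pdivlMr// mul1r.
have := gauss_shape_heat z r1.
have -> : z / (t / s) = (x - m) / t by rewrite /z; field; rewrite ?tn ?sn.
move=> /(ler_wpM2l (ltW (_ : 0 < s^-1))); rewrite invr_gt0 => /(_ s0).
have -> : s^-1 * ((t / s)^-1 * gauss_shape ((x - m) / t)) = gauss_kernel t (x - m).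
  by rewrite /gauss_kernel; field; rewrite ?tn ?sn.
move=> H; rewrite lerBlDr; apply: (le_trans H).
rewrite le_eqVlt; apply/orP; left; apply/eqP.
by rewrite /a /c /d; field.
Qed.

End gaussian_kernel.

(** * Lindeberg replacement and the lower bound *)

Section local_lower_bound.
Context {R : realType}.
Notation mu := (@lebesgue_measure R).
Implicit Types (p : nat -> R -> R) (f : R -> R) (m : nat -> R) (x s V : R).

Definition centered_third_moment V (c : R) f :=
  [/\ mu.-integrable setT (EFin \o (fun y => `|y - c| ^+ 3 * f y)),
      \int[mu]_y ((y - c) * f y) = 0 &
      \int[mu]_y (`|y - c| ^+ 3 * f y) <= V].

Lemma le_pow3 (a : R) k : (k <= 3)%N -> 0 <= a -> a ^+ k <= 1 + a ^+ 3.
Proof.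
move=> k3 a0; have [a1|a1] := leP a 1.
  by rewrite (@le_trans _ _ 1)// ?exprn_ile1// lerDl exprn_ge0.
by rewrite (@le_trans _ _ (a ^+ 3))// ?lerDr// ler_weXn2l// ltW.
Qed.

(** The function [g] is prescribed only up to its modulus, so that signed and absolute moments are
    treated at once. All are controlled by a^k <= 1 + a^3. *)
Lemma centered_moment_integrable M V c f (g : R -> R) k : (k <= 3)%N ->
  C1_density M f -> centered_third_moment V c f ->
  measurable_fun setT g -> (forall y, `|g y| = `|y - c| ^+ k) ->
  mu.-integrable setT (EFin \o (fun y => g y * f y)) /\
  `|\int[mu]_y (g y * f y)| <= 1 + V.
Proof.
move=> k3 fM [i3 _ m3] mg gk.
have i0 := C1_density_integrable fM; have f1 := C1_density_Rintegral fM.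
have [_ f0 _ _] := fM.
have mf : measurable_fun setT f.
  by apply: continuous_measurable_fun; exact: C1_density_continuous fM.
have i : mu.-integrable setT (EFin \o (fun y => f y + `|y - c| ^+ 3 * f y)).
  exact: (integrableD measurableT i0 i3).
have le y : `|g y * f y| <= f y + `|y - c| ^+ 3 * f y.
  rewrite normrM (ger0_norm (f0 y)) gk -[X in _ <= X + _]mul1r -mulrDl ler_wpM2r//.
  exact: le_pow3.
have j : mu.-integrable setT (EFin \o (fun y => g y * f y)).
  apply: (le_integrable measurableT) i => //.
    by apply/measurable_EFinP; exact: measurable_funM.
  by move=> y _ /=; rewrite lee_fin (le_trans (le y))// ler_norm.
split=> //; apply: (le_trans (le_normr_Rintegral _ j)) => //.
apply: (@le_trans _ _ (\int[mu]_y (f y + `|y - c| ^+ 3 * f y))).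
  by apply: le_Rintegral => //; exact: integrable_norm.
by rewrite RintegralD// f1 lerD2l.
Qed.

(** Expectation of f (x - Y_i - ... - Y_(i+l-1)). Here [l] counts the summands, unlike in
    [sum_density]. *)
Fixpoint conv_ops p i l f : R -> R :=
  if l is l'.+1 then conv_op (p i) (conv_ops p i.+1 l' f) else f.

Section uniform.
Variables (p : nat -> R -> R) (m : nat -> R) (M V : R) (n : nat).
Hypothesis pM : forall i, (i < n)%N -> C1_density M (p i).
Hypothesis pV : forall i, (i < n)%N -> centered_third_moment V (m i) (p i).

Lemma conv_ops_regular f c l i : (i + l <= n)%N -> continuous f ->
  (forall x, 0 <= f x <= c) ->
  continuous (conv_ops p i l f) /\ forall x, 0 <= conv_ops p i l f x <= c.
Proof.
elim: l i => [|l IH] i //= il cf fc.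
have [|//|//|cg b] := IH i.+1; first by rewrite addSnnS.
have bn x : `|conv_ops p i.+1 l f x| <= c.
  by have /andP[b0 b1] := b x; rewrite ger0_norm.
have pi : C1_density M (p i) by apply: pM; lia.
have ip := C1_density_integrable pi.
split; first exact: conv_op_continuous ip.
move=> x; have [_ p0 _ _] := pi.
have := conv_op_bound (continuous_measurable_fun cg) bn ip p0 (C1_density_Rintegral pi) x.
have : 0 <= conv_op (p i) (conv_ops p i.+1 l f) x.
  by apply: Rintegral_ge0 => // y _; rewrite mulr_ge0//; have /andP[] := b (x - y).
by move=> H; rewrite ger0_norm// H.
Qed.

(** Each summand is replaced by a Gaussian of the same variance, so t^2 is s^2 plus the sum of the
    variances, each at most 1 + V. The kernels only get wider, hence each replacement costs at most
    its error at the initial width s. Convolution by a law is positive and preserves constants, so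
    earlier errors pass through unchanged. *)
Lemma conv_ops_gauss_kernel s l i : 0 < s -> (i + l <= n)%N ->
  exists t, [/\ s <= t, t ^+ 2 <= s ^+ 2 + l%:R * (1 + V) &
  forall x, gauss_kernel t (x - \sum_(i <= j < i + l) m j)
     - l%:R * (9 * (1 + V) ^+ 2 / s ^+ 5 + 11 * V / s ^+ 4)
     <= conv_ops p i l (gauss_kernel s) x].
Proof.
set err := (_ + _ / _); move=> s0.
elim: l i => [|l IH] i il.
  by exists s; split=> [//||x]; rewrite ?mul0r ?addr0// addn0 big_geq// !subr0.
have [|t [st t2 tx]] := IH i.+1; first by rewrite addSnnS.
have ilt : (i < n)%N by lia.
have pi := pM ilt; have vi := pV ilt.
have t0 : 0 < t by exact: lt_le_trans st.
have ip := C1_density_integrable pi.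
have f1 := C1_density_Rintegral pi; have [_ f0 _ _] := pi.
have [i3 m1 m3] := vi.
have V0 : 0 <= V.
  by apply: le_trans m3; apply: Rintegral_ge0 => y _; rewrite mulr_ge0// exprn_ge0.
have mB : measurable_fun setT (fun y : R => y - m i) by exact: measurable_funB.
have [i1 _] := centered_moment_integrable (isT : (1 <= 3)%N) pi vi mB (fun y => erefl).
have [|y|i2 b2] := @centered_moment_integrable _ _ _ _ (fun y => (y - m i) ^+ 2) 2 isT pi vi.
- exact: measurable_funX.
- by rewrite normrX.
set s2 := \int[mu]_y _ in b2.
have s20 : 0 <= s2 by apply: Rintegral_ge0 => y _; rewrite mulr_ge0// sqr_ge0.
rewrite ger0_norm// in b2.
pose u := Num.sqrt (t ^+ 2 + s2).
have u2 : u ^+ 2 = t ^+ 2 + s2 by rewrite sqr_sqrtr// addr_ge0// sqr_ge0.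
have tu : t <= u by rewrite -(ler_pXn2r (isT : (0 < 2)%N)) ?nnegrE ?sqrtr_ge0 ?(ltW t0)// u2 lerDl.
exists u; split.
- exact: le_trans tu.
- by rewrite u2 -natr1; lra.
move=> x /=.
set S := \sum_(i.+1 <= j < i.+1 + l) m j in tx.
have -> : \sum_(i <= j < i + l.+1) m j = m i + S by rewrite big_ltn ?addnS ?ltnS ?leq_addr// addSn.
have := gauss_kernel_step (x - S) t0 tu ip f0 f1 i1 i2 i3 m1 _ m3.
rewrite -/s2 u2 => /(_ ltac:(ring)).
have -> : x - S - m i = x - (m i + S) by ring.
move=> H.
have err1 : 9 * (t ^+ 2 + s2 - t ^+ 2) ^+ 2 / t ^+ 5 + 11 * V / t ^+ 4 <= err.
  rewrite /err; apply: lerD; apply: ler_pM.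
  - by rewrite mulr_ge0// sqr_ge0.
  - by rewrite invr_ge0 exprn_ge0// ltW.
  - rewrite ler_wpM2l// (_ : _ - _ = s2); last by ring.
    by rewrite lerXn2r// nnegrE// addr_ge0.
  - by rewrite lef_pV2 ?posrE ?exprn_gt0// lerXn2r// nnegrE ltW.
  - by rewrite mulr_ge0.
  - by rewrite invr_ge0 exprn_ge0// ltW.
  - by [].
  - by rewrite lef_pV2 ?posrE ?exprn_gt0// lerXn2r// nnegrE ltW.
have cg : continuous (gauss_kernel t) by exact: gauss_kernel_continuous.
have mg := continuous_measurable_fun cg.
have ig := integrable_conv (x - S) mg (gauss_kernel_bound t0) ip.
have [|||cG bG] := @conv_ops_regular (gauss_kernel s) s^-1 l i.+1.
- by rewrite addSnnS.
- exact: gauss_kernel_continuous.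
- move=> y; rewrite gauss_kernel_ge0 ?(ltW s0)//=.
  by rewrite (le_trans (ler_norm _))// gauss_kernel_bound.
have bn y : `|conv_ops p i.+1 l (gauss_kernel s) y| <= s^-1.
  by have /andP[b0 b1] := bG y; rewrite ger0_norm.
have iG := integrable_conv x (continuous_measurable_fun cG) bn ip.
have ierr : mu.-integrable setT (EFin \o (fun y => l%:R * err * p i y)).
  exact: (integrableZl measurableT (l%:R * err) ip).
have H2 : conv_op (p i) (gauss_kernel t) (x - S) - l%:R * err <=
    conv_op (p i) (conv_ops p i.+1 l (gauss_kernel s)) x.
  have -> : l%:R * err = \int[mu]_y (l%:R * err * p i y).
    by rewrite (RintegralZl _ _ ip)// f1 mulr1.
  rewrite -RintegralB//.
  apply: le_Rintegral => //; first exact: (integrableB measurableT ig ierr).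
  move=> y _; rewrite -mulrBl ler_wpM2r//.
  by rewrite addrAC; exact: tx.
by rewrite -natr1; lra.
Qed.

(** Two readings of E f (x - S), by successive steps and through the density of S, related by
    Tonelli. The Lindeberg estimate on operators thus bears on [sum_density]. *)
Lemma conv_ops_sum_density f c l i x : (i + l < n)%N -> continuous f ->
  (forall x, 0 <= f x <= c) ->
  (conv_ops p i l.+1 f x)%:E =
  (\int[mu]_w (f w * sum_density p i l (x - w))%:E)%E.
Proof.
move=> il cf fc; elim: l i x il => [|l IH] i x il.
  have pi : C1_density M (p i) by apply: pM; lia.
  have fn y : `|f y| <= c by have /andP[b0 b1] := fc y; rewrite ger0_norm.
  have mf := continuous_measurable_fun cf.
  have i0 := integrable_conv x mf fn (C1_density_integrable pi).
  rewrite /= /conv_op EFin_Rintegral//.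
  rewrite -(@ge0_integral_flip _ (fun w => (f w * p i (x - w))%:E) x).
  - by apply: eq_integral => y _; rewrite subKr.
  - apply/measurable_EFinP; apply: measurable_funM => //; apply: measurable_flip.
    by apply: continuous_measurable_fun; exact: C1_density_continuous pi.
  - have [_ p0 _ _] := pi.
    by move=> y; rewrite lee_fin mulr_ge0//; have /andP[] := fc y.
have pi : C1_density M (p i) by apply: pM; lia.
have ip := C1_density_integrable pi.
have [_ p0 _ _] := pi.
have il' : (i.+1 + l < n)%N by rewrite addSnnS.
have il2 : (i.+1 + l.+1 <= n)%N by lia.
have [cg gb] := conv_ops_regular il2 cf fc.
have [cs sb] := sum_density_regular pM il'.
have gn y : `|conv_ops p i.+1 l.+1 f y| <= c by have /andP[b0 b1] := gb y; rewrite ger0_norm.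
have sn y : `|sum_density p i.+1 l y| <= 1 + M by have /andP[b0 b1] := sb y; rewrite ger0_norm.
have i1 := integrable_conv x (continuous_measurable_fun cg) gn ip.
transitivity (conv_op (p i) (conv_ops p i.+1 l.+1 f) x)%:E => //.
rewrite /conv_op EFin_Rintegral//.
set sd := sum_density p i.+1 l in IH cs sb sn *.
pose F (w : R * R) : \bar R := (f w.2 * sd (x - w.1 - w.2) * p i w.1)%:E.
have mp : measurable_fun setT (p i).
  by apply: continuous_measurable_fun; exact: C1_density_continuous pi.
have msd := continuous_measurable_fun cs.
have mf := continuous_measurable_fun cf.
have mF : measurable_fun setT F.
  apply/measurable_EFinP; apply: measurable_funM; first apply: measurable_funM.
  - exact: (measurableT_comp mf measurable_snd).
  - apply: (measurableT_comp msd (g := fun w : R * R => x - w.1 - w.2)).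
    apply: measurable_funB; last exact: measurable_snd.
    by apply: measurable_funB; [exact: measurable_cst|exact: measurable_fst].
  - exact: (measurableT_comp mp measurable_fst).
have F0 w : (0 <= F w)%E.
  rewrite lee_fin !mulr_ge0//; first by have /andP[] := fc w.2.
  by have /andP[] := sb (x - w.1 - w.2).
transitivity (\int[mu]_y \int[mu]_w F (y, w))%E.
  apply: eq_integral => y _.
  rewrite EFinM IH// muleC -ge0_integralZl//.
  - by apply: eq_integral => w _; rewrite -EFinM mulrC.
  - apply/measurable_EFinP; apply: measurable_funM => //.
    by apply: measurable_flip.
  - move=> w _; rewrite lee_fin mulr_ge0//; first by have /andP[] := fc w.
    by have /andP[] := sb (x - y - w).
  - by rewrite lee_fin.
transitivity (\int[mu]_w \int[mu]_y F (y, w))%E; first exact: (@fubini_tonelli _ _ _ _ _ mu mu F).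
apply: eq_integral => w _.
rewrite /F/=.
have i2 := integrable_conv (x - w) msd sn ip.
rewrite /conv_op EFinM EFin_Rintegral// -ge0_integralZl//.
- by apply: eq_integral => y _; rewrite -EFinM -mulrA (addrAC x).
- by have /integrableP[] := i2.
- by move=> y _; rewrite lee_fin mulr_ge0//; have /andP[] := sb (x - w - y).
- by rewrite lee_fin; have /andP[] := fc w.
Qed.

(** At the mean the Gaussian term of the Lindeberg bound is 1 / t. What it bounds is an average of
    the density around the mean with weight [gauss_kernel s]; the Lipschitz bound and the first
    absolute moment of the kernel replace this average by the value at the mean. *)
Lemma sum_density_lower s l : 0 < s -> (l < n)%N ->
  gauss_mass * sum_density p 0 l (\sum_(0 <= j < l.+1) m j) >=
   (Num.sqrt (s ^+ 2 + l.+1%:R * (1 + V)))^-1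
   - l.+1%:R * (9 * (1 + V) ^+ 2 / s ^+ 5 + 11 * V / s ^+ 4)
   - lipschitz_cst M * (2 * s + 1) * gauss_mass / l.+1%:R.
Proof.
move=> s0 ln; set x := \sum_(0 <= j < l.+1) m j.
have [|t [st t2 tx]] := @conv_ops_gauss_kernel s l.+1 0 s0; first by rewrite add0n.
have := tx x; rewrite add0n -/x subrr.
have -> : gauss_kernel t 0 = t^-1 by rewrite /gauss_kernel mul0r /gauss_shape expr0n/= mul0r oppr0 expR0 mulr1.
have t0 : 0 < t by exact: lt_le_trans st.
move=> H.
have : (Num.sqrt (s ^+ 2 + l.+1%:R * (1 + V)))^-1 <= t^-1.
  rewrite lef_pV2 ?posrE//; last by rewrite sqrtr_gt0 (lt_le_trans _ t2)// exprn_gt0.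
  by rewrite -[t]gtr0_norm// -sqrtr_sqr ler_sqrt// (le_trans _ t2)// sqr_ge0.
move=> /le_trans H1.
suff : conv_ops p 0 l.+1 (gauss_kernel s) x <=
   gauss_mass * sum_density p 0 l x + lipschitz_cst M * (2 * s + 1) * gauss_mass / l.+1%:R.
  move=> H2; rewrite lerBlDr; apply: le_trans H2; apply: le_trans H.
  by rewrite lerD2r; exact: H1.
have [i1 k1] := Rintegral_norm_gauss_kernel s0.
have i0 := gauss_kernel_integrable s0.
have cg : continuous (gauss_kernel s) by exact: gauss_kernel_continuous.
have gb y : 0 <= gauss_kernel s y <= s^-1.
  rewrite gauss_kernel_ge0 ?(ltW s0)//=.
  by rewrite (le_trans (ler_norm _))// gauss_kernel_bound.
have l0n : (0 + l < n)%N by rewrite add0n.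
have [cs sb] := sum_density_regular pM l0n.
have sn y : `|sum_density p 0 l y| <= 1 + M by have /andP[b0 b1] := sb y; rewrite ger0_norm.
have is' := integrable_conv x (continuous_measurable_fun cs) sn i0.
have e : conv_ops p 0 l.+1 (gauss_kernel s) x =
    \int[mu]_w (sum_density p 0 l (x - w) * gauss_kernel s w).
  apply: EFin_inj; rewrite (conv_ops_sum_density x l0n cg gb) EFin_Rintegral//.
  by apply: eq_integral => w _; rewrite mulrC.
rewrite e.
pose c := lipschitz_cst M / l.+1%:R.
pose a := sum_density p 0 l x + c.
have j0 : mu.-integrable setT (EFin \o (fun w => a * gauss_kernel s w)).
  exact: (integrableZl measurableT a i0).
have j1 : mu.-integrable setT (EFin \o (fun w => c * (`|w| * gauss_kernel s w))).
  exact: (integrableZl measurableT c i1).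
apply: (@le_trans _ _ (\int[mu]_w (a * gauss_kernel s w + c * (`|w| * gauss_kernel s w)))).
  apply: le_Rintegral => //; first exact: (integrableD measurableT j0 j1).
  move=> w _; rewrite [c * _]mulrA -mulrDl ler_wpM2r ?gauss_kernel_ge0 ?(ltW s0)//.
  have := sum_density_lipschitz pM (x - w) x l0n.
  rewrite (_ : x - w - x = - w); last by ring.
  rewrite normrN => /(le_trans (ler_norm _)).
  by rewrite lerBlDl (_ : _ + _ / _ = a + c * `|w|)//; rewrite /a /c; ring.
rewrite RintegralD// (RintegralZl _ _ i0)// (RintegralZl _ _ i1)// Rintegral_gauss_kernel//.
have c0 : 0 <= c.
  have M0 := C1_density_M_ge0 (pM (leq_ltn_trans (leq0n l) ln)).
  by rewrite /c divr_ge0// /lipschitz_cst !mulr_ge0//; lra.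
rewrite [leRHS](_ : _ = a * gauss_mass + c * (2 * s * gauss_mass)); last by rewrite /a /c; ring.
by rewrite lerD2l ler_wpM2l.
Qed.

End uniform.

End local_lower_bound.

(** * Uniform ratio of the densities of two sums *)

Section density_ratio.
Context {R : realType}.
Notation mu := (@lebesgue_measure R).
Implicit Types (p : nat -> R -> R) (m : nat -> R) (M V : R).

(** [sum_density_lower] with width s = e sqrt n, where n = l + 1. The main term is at least w / sqrt
    n. The choice of [e] lets the Lipschitz error take at most a quarter of it; beyond [N] the O(1 /
    n) errors, collected in [D], take at most another quarter, and half remains. *)
Lemma sum_density_at_mean M V : 0 <= M -> 0 <= V ->
  exists2 c : R, 0 < c & exists N : nat, forall p m l,
    (forall j, (j < l.+1)%N -> C1_density M (p j)) ->
    (forall j, (j < l.+1)%N -> centered_third_moment V (m j) (p j)) ->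
    (N <= l)%N ->
    c / Num.sqrt l.+1%:R <= sum_density p 0 l (\sum_(0 <= j < l.+1) m j).
Proof.
move=> M0 V0.
pose w : R := (Num.sqrt (2 + V))^-1.
have w0 : 0 < w by rewrite invr_gt0 sqrtr_gt0; lra.
pose L := lipschitz_cst M.
have L0 : 0 <= L by rewrite /L /lipschitz_cst !mulr_ge0//; lra.
have Z0 := @gauss_mass_gt0 R; set Z : R := gauss_mass in Z0.
have LZ : 0 <= L * Z by rewrite mulr_ge0// ltW.
pose e := Num.min 1 (w / (8 * (L * Z) + 1)).
have D0 : 0 < 8 * (L * Z) + 1 by lra.
have e0 : 0 < e by rewrite lt_min ltr01 divr_gt0.
have e1 : e <= 1 by rewrite ge_min lexx.
have ew : 2 * (L * Z) * e <= w / 4.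
  have : e * (8 * (L * Z) + 1) <= w by rewrite -ler_pdivlMr// ge_min lexx orbT.
  by lra.
pose D := 9 * (1 + V) ^+ 2 / e ^+ 5 + 11 * V / e ^+ 4 + L * Z.
have DD : 0 <= D.
  have e5 k : 0 <= e ^+ k by rewrite exprn_ge0// ltW.
  apply: addr_ge0 => //; apply: addr_ge0; apply: divr_ge0 => //; apply: mulr_ge0 => //.
  exact: sqr_ge0.
exists (w / (2 * Z)); first by rewrite divr_gt0// mulr_gt0.
exists (Num.truncn ((4 * D / w) ^+ 2)) => p m l pM pV Nl.
pose r : R := Num.sqrt l.+1%:R.
have r2 : r ^+ 2 = l.+1%:R by rewrite sqr_sqrtr.
have r0 : 0 < r by rewrite sqrtr_gt0 ltr0n.
have rn : r != 0 by rewrite gt_eqF.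
have r1 : 1 <= r by rewrite -sqrtr1 ler_sqrt// ler1n.
have Dr : D / r <= w / 4.
  have Dw : 0 <= 4 * D / w by rewrite divr_ge0 ?mulr_ge0// ltW.
  have : 4 * D / w <= r.
    rewrite -(ler_pXn2r (isT : (0 < 2)%N)) ?nnegrE ?(ltW r0)// r2.
    apply: ltW; apply: lt_le_trans (truncnS_gt _) _.
    by rewrite ler_nat ltnS.
  rewrite ler_pdivrMr// => H.
  by rewrite ler_pdivrMr//; lra.
have := sum_density_lower pM pV (mulr_gt0 e0 r0) (ltnSn l).
set g := sum_density _ _ _ _; rewrite -/L -/Z -r2 => H.
have sq : w / r <= (Num.sqrt ((e * r) ^+ 2 + r ^+ 2 * (1 + V)))^-1.
  rewrite /w -invfM lef_pV2 ?posrE ?mulr_gt0 ?sqrtr_gt0//; last 2 first.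
  - by lra.
  - by rewrite ltr_wpDl ?sqr_ge0// mulr_gt0 ?exprn_gt0//; lra.
  rewrite -[r in leRHS]gtr0_norm// -sqrtr_sqr -sqrtrM; last by lra.
  rewrite ler_sqrt; last by apply: mulr_ge0; [lra|exact: sqr_ge0].
  rewrite exprMn (_ : (2 + V) * r ^+ 2 = r ^+ 2 * 1 + r ^+ 2 * (1 + V)); last by ring.
  by rewrite lerD2r mulrC ler_wpM2l ?sqr_ge0// exprn_ile1// ltW.
have T1 : r ^+ 2 * (9 * (1 + V) ^+ 2 / (e * r) ^+ 5 + 11 * V / (e * r) ^+ 4) +
    L * (2 * (e * r) + 1) * Z / r ^+ 2 <= (D / r + 2 * (L * Z) * e) / r.
  rewrite [leLHS](_ : _ = (9 * (1 + V) ^+ 2 / e ^+ 5 / r + 11 * V / e ^+ 4 + L * Z) / r ^+ 2 + 2 * (L * Z) * e / r); last first.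
    by field; rewrite rn gt_eqF.
  rewrite [leRHS](_ : _ = D / r ^+ 2 + 2 * (L * Z) * e / r); last by field.
  rewrite lerD2r ler_wpM2r ?invr_ge0 ?sqr_ge0// /D lerD2r lerD2r.
  rewrite ler_pdivrMr// ler_peMr// divr_ge0 ?exprn_ge0 ?(ltW e0)// mulr_ge0// sqr_ge0//.
have T2 : (D / r + 2 * (L * Z) * e) / r <= (w / 2) / r.
  by rewrite ler_wpM2r ?invr_ge0 ?(ltW r0)//; lra.
have T3 : w / 2 / r <= Z * g.
  apply: le_trans H; rewrite -addrA -opprD lerBrDr.
  apply: (le_trans (lerD (lexx _) (le_trans T1 T2))).
  by apply: le_trans sq; rewrite -mulrDl ler_wpM2r ?invr_ge0 ?(ltW r0)//; lra.
rewrite -(ler_pM2l Z0); apply: le_trans T3.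
rewrite le_eqVlt; apply/orP; left; apply/eqP; rewrite sqrtr_sqr (gtr0_norm r0); field.
by rewrite rn gt_eqF.
Qed.

Section uniform.
Variables (p : nat -> R -> R) (m : nat -> R) (M V : R) (n : nat).
Hypothesis pM : forall i, (i < n)%N -> C1_density M (p i).
Hypothesis pV : forall i, (i < n)%N -> centered_third_moment V (m i) (p i).

(** The density of the longer sum at y is the mean of the shorter one at y - Y, with Y of law [p i].
    Moving the argument to y - m i costs the Lipschitz bound, with E|Y - m i| + 1 <= 2 + V. *)
Lemma sum_density_peel i l y : (i + l.+1 < n)%N ->
  `|sum_density p i l.+1 y - sum_density p i.+1 l (y - m i)| <=
    lipschitz_cst M * (2 + V) / l.+1%:R.
Proof.
move=> il; have ilt : (i < n)%N by lia.
have il' : (i.+1 + l < n)%N by rewrite addSnnS.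
have pi := pM ilt; have vi := pV ilt.
have ip := C1_density_integrable pi; have f1 := C1_density_Rintegral pi.
have [_ f0 _ _] := pi.
have [cs sb] := sum_density_regular pM il'.
set g := sum_density p i.+1 l in cs sb *.
have gn z : `|g z| <= 1 + M by have /andP[b0 b1] := sb z; rewrite ger0_norm.
have mB : measurable_fun setT (fun z : R => z - m i) by exact: measurable_funB.
have mN : measurable_fun setT (fun z : R => `|z - m i|) by exact: measurableT_comp.
have [i1 b1] := @centered_moment_integrable _ _ _ _ _ (fun z => `|z - m i|) 1 isT pi vi mN
  (fun y => normr_id _).
have i2 := integrable_conv y (continuous_measurable_fun cs) gn ip.
pose c := lipschitz_cst M / l.+1%:R.
have c0 : 0 <= c.
  have M0 := C1_density_M_ge0 pi.
  by rewrite /c divr_ge0// /lipschitz_cst !mulr_ge0//; lra.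
have i3 : mu.-integrable setT (EFin \o (fun z => g (y - m i) * p i z)).
  exact: (integrableZl measurableT (g (y - m i)) ip).
have -> : sum_density p i l.+1 y - g (y - m i) =
    \int[mu]_z (g (y - z) * p i z - g (y - m i) * p i z).
  by rewrite RintegralB// (RintegralZl _ _ ip)// f1 mulr1.
have i4 : mu.-integrable setT (EFin \o (fun z => g (y - z) * p i z - g (y - m i) * p i z)).
  exact: (integrableB measurableT i2 i3).
have i5 : mu.-integrable setT (EFin \o (fun z => `|z - m i| * p i z + p i z)).
  exact: (integrableD measurableT i1 ip).
apply: (le_trans (le_normr_Rintegral _ i4)) => //.
apply: (@le_trans _ _ (\int[mu]_z (c * (`|z - m i| * p i z + p i z)))).
  apply: le_Rintegral => //; first exact: integrable_norm.
    exact: (integrableZl measurableT c i5).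
  move=> z _; rewrite -mulrBl normrM (ger0_norm (f0 z)) -[X in _ * (_ + X)]mul1r -mulrDl mulrA.
  rewrite ler_wpM2r//; have := sum_density_lipschitz pM (y - z) (y - m i) il'.
  rewrite (_ : y - z - (y - m i) = - (z - m i)); last by ring.
  by rewrite normrN /c mulrAC.
rewrite (RintegralZl _ _ i5)// RintegralD// f1 [leRHS]mulrAC -/c ler_wpM2l//.
by move: b1; rewrite ger0_norm; [lra|apply: Rintegral_ge0 => z _; rewrite mulr_ge0].
Qed.

(** Every removal costs at most as much as the last one, made on the shortest sum. *)
Lemma sum_density_peel_n k l y : (k + l < n)%N ->
  `|sum_density p 0 (k + l) y - sum_density p k l (y - \sum_(0 <= j < k) m j)| <=
    k%:R * (lipschitz_cst M * (2 + V) / l.+1%:R).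
Proof.
elim: k l y => [|k IH] l y kl.
  by rewrite add0n big_geq// subr0 subrr normr0 mul0r.
have kl' : (k + l.+1 < n)%N by rewrite -addSnnS.
have h1 := IH l.+1 y kl'; rewrite -addSnnS in h1.
have h2 := sum_density_peel (y - \sum_(0 <= j < k) m j) kl'.
rewrite big_nat_recr//= opprD addrA.
apply: (le_trans (ler_distD (sum_density p k l.+1 (y - \sum_(0 <= j < k) m j)) _ _)).
rewrite -natr1 mulrDl mul1r; apply: lerD => //.
apply: (le_trans h1); rewrite ler_wpM2l//.
have M0 := C1_density_M_ge0 (pM (leq_ltn_trans (leq0n _) kl)).
have V0 : 0 <= V.
  have [_ f0 _ _] := pM (leq_ltn_trans (leq0n _) kl).
  have [_ _ m3] := pV (leq_ltn_trans (leq0n _) kl).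
  by apply: le_trans m3; apply: Rintegral_ge0 => z _; rewrite mulr_ge0// exprn_ge0.
rewrite ler_wpM2l//.
  by rewrite /lipschitz_cst !mulr_ge0//; lra.
by rewrite lef_pV2 ?posrE ?ltr0n// ler_nat.
Qed.

End uniform.

(** Two moves lead from the numerator to the denominator: u is brought to the mean of the first k
    summands, at the Lipschitz cost, then these summands are put back. Both costs carry 1 / (n - k),
    at most 2 / n as k <= n / 2, and division by c / sqrt n leaves 1 / sqrt n. A sum of n - k
    variables has index [(n - k).-1]. *)
Lemma sum_density_ratio M V : 0 <= M -> 0 <= V ->
  exists2 C : R, 0 <= C & exists N : nat, forall p m n k u,
    (forall j, (j < n)%N -> C1_density M (p j)) ->
    (forall j, (j < n)%N -> centered_third_moment V (m j) (p j)) ->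
    (N < n)%N -> (k.*2 <= n)%N -> (0 < n)%N ->
    0 < sum_density p 0 n.-1 (\sum_(0 <= j < n) m j) /\
    `|sum_density p k (n - k).-1 (\sum_(0 <= j < n) m j - u) /
      sum_density p 0 n.-1 (\sum_(0 <= j < n) m j) - 1| <=
    C * (`|u - \sum_(0 <= j < k) m j| + k%:R + 1) / Num.sqrt n%:R.
Proof.
move=> M0 V0; have [c c0 [N Nc]] := sum_density_at_mean M0 V0.
pose L := lipschitz_cst M.
have L0 : 0 <= L by rewrite /L /lipschitz_cst !mulr_ge0//; lra.
exists (2 * L * (2 + V) / c).
  by rewrite divr_ge0 ?(ltW c0)// !mulr_ge0//; lra.
exists N => p m n k u pM pV Nn kn n0.
set x := \sum_(0 <= j < n) m j; set y := \sum_(0 <= j < k) m j.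
have nn : n.-1.+1 = n by rewrite prednK.
have lo : c / Num.sqrt n%:R <= sum_density p 0 n.-1 x.
  have := Nc p m n.-1; rewrite nn => /(_ pM pV); apply.
  by rewrite -ltnS nn.
pose r : R := Num.sqrt n%:R.
have r2 : r ^+ 2 = n%:R by rewrite sqr_sqrtr.
have r0 : 0 < r by rewrite sqrtr_gt0 ltr0n.
have rn : r != 0 by rewrite gt_eqF.
rewrite -/r in lo *.
set g0 := sum_density p 0 n.-1 x in lo *.
have g00 : 0 < g0 by apply: lt_le_trans lo; rewrite divr_gt0.
split=> //.
set g := sum_density p k (n - k).-1 (x - u).
have kl : (k + (n - k).-1 = n.-1)%N by lia.
have kln : (k + (n - k).-1 < n)%N by rewrite kl; lia.
have h1 := sum_density_peel_n pM pV x kln.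
rewrite kl -/g0 -/y in h1.
have h2 := sum_density_lipschitz pM (x - u) (x - y) kln.
rewrite -/g (_ : x - u - (x - y) = - (u - y)) ?normrN in h2; last by ring.
set g1 := sum_density p k (n - k).-1 (x - y) in h1 h2.
have inv : ((n - k).-1.+1)%:R^-1 <= 2 / r ^+ 2.
  rewrite r2 ler_pdivlMr ?ltr0n// mulrC ler_pdivrMr ?ltr0n// -natrM ler_nat.
  lia.
have h3 : `|g - g0| <= 2 * L * (2 + V) * (`|u - y| + k%:R + 1) / r ^+ 2.
  apply: (le_trans (ler_distD g1 _ _)); rewrite (distrC g1).
  apply: (le_trans (lerD h2 h1)).
  rewrite -/L.
  apply: (@le_trans _ _ (L * (2 + V) * (`|u - y| + k%:R + 1) * (n - k).-1.+1%:R^-1)).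
    rewrite (mulrA _ _ (_^-1)) -mulrDl ler_wpM2r ?invr_ge0//.
    rewrite -subr_ge0 [leRHS](_ : _ = L * (1 + V) * (`|u - y| + 1)); last by ring.
    by rewrite mulr_ge0 ?addr_ge0// mulr_ge0// addr_ge0.
  rewrite [leRHS](_ : _ = L * (2 + V) * (`|u - y| + k%:R + 1) * (2 / r ^+ 2)); last by ring.
  rewrite ler_wpM2l//; apply: mulr_ge0; last by rewrite !addr_ge0.
  by apply: mulr_ge0 => //; rewrite addr_ge0.
have -> : g / g0 - 1 = (g - g0) / g0 by field; rewrite gt_eqF.
rewrite normrM normfV (gtr0_norm g00) ler_pdivrMr//.
apply: (le_trans h3).
apply: (@le_trans _ _ (2 * L * (2 + V) / c * (`|u - y| + k%:R + 1) / r * (c / r))).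
  rewrite le_eqVlt; apply/orP; left; apply/eqP; field.
  by rewrite rn gt_eqF.
rewrite ler_wpM2l// divr_ge0 ?(ltW r0)// mulr_ge0 ?addr_ge0//.
by rewrite divr_ge0 ?(ltW c0)// !mulr_ge0//; lra.
Qed.

End density_ratio.

(** * Laws of tuples and of partial sums *)

Section density_integral.
Context {d d'} {T : measurableType d} {T' : measurableType d'} {R : realType}.
Variables (mu : {measure set T -> \bar R}) (nu : {measure set T' -> \bar R}).
Variables (U : T -> T') (w : T' -> R).
Hypothesis mU : measurable_fun setT U.
Hypothesis mw : measurable_fun setT w.
Hypothesis w0 : forall x, 0 <= w x.
Hypothesis muE : forall C, measurable C ->
  mu (U @^-1` C) = (\int[nu]_(x in C) (w x)%:E)%E.

Import HBNNSimple.

Let nnsfun_density (g : {nnsfun T' >-> R}) :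
  (\int[mu]_x (g (U x))%:E = \int[nu]_x (g x * w x)%:E)%E.
Proof.
pose s := fset_set (range g).
have gE := fimfunEord g.
have mA i : measurable (g @^-1` [set s`_i]) by [].
have c0 (i : 'I_(#|` s|)) : 0 <= s`_i.
  have : s`_i \in s by rewrite mem_nth.
  by rewrite in_fset_set// inE => -[x _ <-].
have mI i : measurable_fun setT (fun x => (s`_i * \1_(g @^-1` [set s`_i]) x)%:E).
  by apply/measurable_EFinP; apply: measurable_funM => //; exact: measurable_indic.
transitivity (\int[mu]_x \sum_(i < #|` s|) (s`_i * \1_(g @^-1` [set s`_i]) (U x))%:E)%E.
  by apply: eq_integral => x _; rewrite gE sumEFin.
rewrite ge0_integral_sum//; last 2 first.
- by move=> i; exact: (measurableT_comp (mI i) mU).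
- by move=> i x _; rewrite lee_fin mulr_ge0.
transitivity (\int[nu]_x \sum_(i < #|` s|) (s`_i * \1_(g @^-1` [set s`_i]) x * w x)%:E)%E; last first.
  by apply: eq_integral => x _; rewrite gE sumEFin mulr_suml.
rewrite ge0_integral_sum//; last 2 first.
- move=> i; apply/measurable_EFinP; apply: measurable_funM => //; exact/measurable_EFinP/mI.
- by move=> i x _; rewrite lee_fin !mulr_ge0.
apply: eq_bigr => i _.
under eq_integral do rewrite EFinM.
under [RHS]eq_integral do rewrite -mulrA EFinM.
rewrite ge0_integralZl//; last 2 first.
- apply/measurable_EFinP; apply: (measurableT_comp (f := \1_(g @^-1` [set s`_i]) : T' -> R)) => //.
- by rewrite lee_fin.
rewrite [RHS]ge0_integralZl//; last 3 first.
- by apply/measurable_EFinP; apply: measurable_funM.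
- by move=> x _; rewrite lee_fin mulr_ge0.
- by rewrite lee_fin.
congr (_ * _)%E.
have e1 x : \1_(g @^-1` [set s`_i]) (U x) = \1_(U @^-1` (g @^-1` [set s`_i])) x :> R by [].
under eq_integral do rewrite e1.
rewrite integral_indic ?setIT//; last by rewrite -[X in measurable X]setTI; exact: mU.
rewrite muE// integral_mkcond; apply: eq_integral => x _.
by rewrite /patch indicE; case: ifP => _; rewrite ?mul1r ?mul0r.
Qed.

(** Simple functions, then monotone convergence. The base measure [nu] is left free so as to cover
    real variables and tuples alike. *)
Lemma ge0_integral_density (h : T' -> \bar R) : measurable_fun setT h ->
  (forall x, (0 <= h x)%E) ->
  (\int[mu]_x h (U x) = \int[nu]_x (h x * (w x)%:E))%E.
Proof.
move=> mh h0; pose g := nnsfun_approx measurableT mh.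
have gh x : (g n x)%:E @[n --> \oo] --> h x by exact: cvg_nnsfun_approx.
have ndg x m n : (m <= n)%N -> g m x <= g n x.
  by move=> mn; exact/lefP/nd_nnsfun_approx.
transitivity (limn (fun n => \int[mu]_x (g n (U x))%:E))%E.
  rewrite -monotone_convergence//.
  - by apply: eq_integral => x _; apply/esym/cvg_lim => //; exact: gh.
  - by move=> n; apply/measurable_EFinP; exact: (measurableT_comp (f := g n)).
  - by move=> n x _; rewrite lee_fin.
  - by move=> x _ m n mn; rewrite lee_fin; exact: ndg.
transitivity (limn (fun n => \int[nu]_x (g n x * w x)%:E))%E.
  by congr (limn _); apply/funext => n; exact: nnsfun_density.
rewrite -monotone_convergence//.
- apply: eq_integral => x _; apply/cvg_lim => //.
  under eq_fun do rewrite EFinM.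
  by apply: cvgeZr => //; exact: gh.
- by move=> n; apply/measurable_EFinP; exact: measurable_funM.
- by move=> n x _; rewrite lee_fin mulr_ge0.
- by move=> x _ m n mn; rewrite lee_fin ler_wpM2r//; exact: ndg.
Qed.

End density_integral.

Section density_measure.
Context d (T : measurableType d) (R : realType).
Variables (nu : {measure set T -> \bar R}) (w : T -> R).
Hypotheses (mw : measurable_fun setT w) (w0 : forall x, 0 <= w x).

Definition density_measure (C : set T) : \bar R := (\int[nu]_(x in C) (w x)%:E)%E.

Let density_measure0 : density_measure set0 = 0%E.
Proof. exact: integral_set0. Qed.

Let density_measure_ge0 C : (0 <= density_measure C)%E.
Proof. by apply: integral_ge0 => x _; rewrite lee_fin. Qed.

Let density_measure_sigma_additive : semi_sigma_additive density_measure.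
Proof.
move=> F mF tF mUF; rewrite /density_measure ge0_integral_bigcup//; last 2 first.
- by apply: measurable_funTS; exact/measurable_EFinP.
- by move=> x _; rewrite lee_fin.
by apply: is_cvg_ereal_nneg_natsum_cond => n _ _; exact: density_measure_ge0.
Qed.

(** [density_measure] is packed as a measure, under the hypotheses on [w], so that uniqueness of
    measures can be applied to it. *)
Lemma density_measureP : exists m : {measure set T -> \bar R},
  forall C, m C = density_measure C.
Proof.
pose m := HB.pack_for {measure set T -> \bar R} density_measure
  (isMeasure.Build _ _ _ density_measure density_measure0 density_measure_ge0
    density_measure_sigma_additive).
by exists m.
Qed.

End density_measure.

Section lebesgue_tuple_integral.
Context {R : realType}.
Notation mu := (@lebesgue_measure R).

Lemma integral_lebesgue_tuple0 (h : 0.-tuple R -> \bar R) :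
  measurable_fun setT h -> (\int[lebesgue_tuple R 0]_t h t = h [tuple])%E.
Proof. by move=> mh; rewrite /= integral_dirac// diracT mul1e. Qed.

Lemma integral_lebesgue_tupleS k (h : k.+1.-tuple R -> \bar R) :
  measurable_fun setT h -> (forall t, (0 <= h t)%E) ->
  (\int[lebesgue_tuple R k.+1]_t h t =
   \int[mu]_x \int[lebesgue_tuple R k]_t h (tuple_cons (x, t)))%E.
Proof.
move=> mh h0.
transitivity (integral (pushforward (mu \x lebesgue_tuple R k)%E (@tuple_cons R k)) setT h).
  by apply: eq_measure_integral => [|A mA _ /=]; first exact: measurable_tuple_cons.
rewrite ge0_integral_pushforward//; last exact: measurable_tuple_cons.
rewrite (fubini_tonelli1 (h \o @tuple_cons R k))//.
- by apply: measurableT_comp => //; exact: measurable_tuple_cons.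
- by move=> x; exact: h0.
Qed.

Lemma tnth_tuple_cons0 k x (t : k.-tuple R) : tnth (tuple_cons (x, t)) ord0 = x.
Proof. by rewrite (tnth_nth 0). Qed.

Lemma tnth_tuple_consS k x (t : k.-tuple R) j :
  tnth (tuple_cons (x, t)) (lift ord0 j) = tnth t j.
Proof. by rewrite !(tnth_nth 0). Qed.

Lemma measurable_prod_tnth k (f : 'I_k -> R -> R) :
  (forall j, measurable_fun setT (f j)) ->
  measurable_fun setT (fun t : k.-tuple R => \prod_(j < k) f j (tnth t j)).
Proof.
move=> mf; apply: measurable_prod => j _.
exact: (measurableT_comp (mf j) (measurable_tnth j)).
Qed.

Lemma integral_lebesgue_tuple_prod k (f : 'I_k -> R -> R) :
  (forall j, measurable_fun setT (f j)) -> (forall j x, 0 <= f j x) ->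
  (\int[lebesgue_tuple R k]_t (\prod_(j < k) f j (tnth t j))%:E =
   \prod_(j < k) \int[mu]_x (f j x)%:E)%E.
Proof.
elim: k f => [|k IH] f mf f0.
  by rewrite integral_lebesgue_tuple0 ?big_ord0//; apply/measurable_EFinP; exact: measurable_prod_tnth.
rewrite integral_lebesgue_tupleS; last 2 first.
- by apply/measurable_EFinP; exact: measurable_prod_tnth.
- by move=> t; rewrite lee_fin prodr_ge0.
rewrite big_ord_recl.
have mp := measurable_prod_tnth (fun j => mf (lift ord0 j)).
transitivity (\int[mu]_x ((f ord0 x)%:E * \prod_(j < k) \int[mu]_x (f (lift ord0 j) x)%:E))%E.
  apply: eq_integral => x _.
  rewrite -(IH (fun j => f (lift ord0 j)))// -ge0_integralZl//.
  - apply: eq_integral => t _; rewrite big_ord_recl tnth_tuple_cons0 EFinM.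
    by congr (_ * _%:E)%E; apply: eq_bigr => j _; rewrite tnth_tuple_consS.
  - exact/measurable_EFinP.
  - by move=> t _; rewrite lee_fin prodr_ge0.
  - by rewrite lee_fin.
rewrite ge0_integralZr//.
- by apply/measurable_EFinP; exact: mf.
- by move=> x _; rewrite lee_fin.
- by apply: prode_ge0 => j _; apply: integral_ge0 => x _; rewrite lee_fin.
Qed.

End lebesgue_tuple_integral.

(** * Law of a tuple of independent variables *)

Section tuple_law.
Context {R : realType}.
Notation mu := (@lebesgue_measure R).

Definition tuple_box k (E : 'I_k -> set R) : set (k.-tuple R) :=
  [set t | forall j, E j (tnth t j)].

Definition tuple_boxes k : set (set (k.-tuple R)) :=
  [set C | exists2 E : 'I_k -> set R, forall j, measurable (E j) & C = tuple_box E].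

Lemma measurable_tuple_box k (E : 'I_k -> set R) :
  (forall j, measurable (E j)) -> measurable (tuple_box E).
Proof.
move=> mE; have -> : tuple_box E =
    \bigcap_(j in [set: 'I_k]) ((fun t : k.-tuple R => tnth t j) @^-1` E j).
  by apply/seteqP; split => t H; [move=> j _; exact: H|move=> j; exact: H].
apply: fin_bigcap_measurable => // j _.
by rewrite -[X in measurable X]setTI; exact: measurable_tnth.
Qed.

Lemma tuple_boxes_setI k : setI_closed (@tuple_boxes k).
Proof.
move=> _ _ [E mE ->] [F mF ->]; exists (fun j => E j `&` F j).
  by move=> j; exact: measurableI.
apply/seteqP; split=> t; first by move=> [tE tF] j; split; [exact: tE|exact: tF].
by move=> H; split=> j; have [] := H j.
Qed.

Lemma tuple_boxes_generate k :
  @measurable _ (k.-tuple R) = <<s @tuple_boxes k >>.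
Proof.
apply/seteqP; split.
  apply: smallest_sub; first exact: smallest_sigma_algebra.
  rewrite -bigcup_seq; apply: bigcup_sub => i _ C [B mB <-].
  apply: sub_sigma_algebra; exists (fun j => if j == i then B else setT).
    by move=> j; case: ifP.
  rewrite setTI; apply/seteqP; split=> t /=.
    by move=> tB j; case: eqP => // ->.
  by move=> /(_ i); rewrite eqxx.
apply: smallest_sub; first exact: sigma_algebra_measurable.
by move=> _ [E mE ->]; exact: measurable_tuple_box.
Qed.

(** Both sides are measures in C that agree on boxes, a generating class closed under intersection:
    on a box the left one factors by independence and the right one by Tonelli. *)
Lemma independent_tuple_law d (T : measurableType d) (P : probability T R) k
    (Y : 'I_k -> {RV P >-> R}) (f : 'I_k -> R -> R) :
  mutually_independent Y -> (forall j, is_density P (Y j) (f j)) ->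
  forall C, measurable C ->
  P ((fun x => [tuple Y j x | j < k]) @^-1` C) =
  (\int[lebesgue_tuple R k]_(t in C) (\prod_(j < k) f j (tnth t j))%:E)%E.
Proof.
move=> Yi Yf C mC.
have mf j : measurable_fun setT (f j) by have [] := Yf j.
have f0 j x : 0 <= f j x by have [_ + _] := Yf j; exact.
pose w (t : k.-tuple R) := \prod_(j < k) f j (tnth t j).
have mw : measurable_fun setT w by exact: measurable_prod_tnth.
have w0 t : 0 <= w t by exact: prodr_ge0.
have [m mE] := density_measureP (lebesgue_tuple R k) mw w0.
pose Yt (x : T) : k.-tuple R := [tuple Y j x | j < k].
have mY : measurable_fun setT Yt.
  apply/measurable_fun_tnthP => j.
  rewrite (_ : _ \o _ = Y j); last by apply/funext => x /=; rewrite tnth_mktuple.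
  exact: measurable_funP.
rewrite -[RHS]/(density_measure (lebesgue_tuple R k) w C) -mE.
rewrite -[LHS]/(pushforward P Yt C).
apply: (measure_unique (@tuple_boxes k) (fun=> setT)) => //.
- exact: tuple_boxes_generate.
- exact: tuple_boxes_setI.
- by move=> _; exists (fun=> setT) => //; apply/seteqP; split.
- by rewrite bigcup_const//; exists 0%N.
- move=> _ [E mEE ->]; rewrite mE /density_measure /pushforward.
  pose J := [fset j in enum 'I_k]%fset.
  have Jin j : j \in J by rewrite !inE/= mem_enum.
  transitivity (P (\bigcap_(j in [set` J]) Y j @^-1` E j)).
    congr (P _); apply/seteqP; split=> x /= H j; first by move=> _; have := H j; rewrite tnth_mktuple.
    by rewrite tnth_mktuple; apply: H; exact: Jin.
  rewrite Yi// (perm_big (index_enum 'I_k)); last first.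
    apply: uniq_perm; [exact: fset_uniq|exact: index_enum_uniq|] => j.
    by rewrite mem_index_enum; exact: Jin.
  rewrite integral_mkcond.
  transitivity (\int[lebesgue_tuple R k]_t (\prod_(j < k) (\1_(E j) (tnth t j) * f j (tnth t j)))%:E)%E.
    rewrite (integral_lebesgue_tuple_prod (f := fun j x => \1_(E j) x * f j x)).
    - apply: eq_bigr => j _; have [_ _ ->//] := Yf j.
      rewrite integral_mkcond; apply: eq_integral => x _.
      by rewrite /patch indicE; case: ifP => _; rewrite ?mul1r ?mul0r.
    - by move=> j; apply: measurable_funM => //; exact: measurable_indic.
    - by move=> j x; rewrite mulr_ge0.
  apply: eq_integral => t _; rewrite /patch; case: ifPn => [/set_mem tE|/negP tE].
    by congr (_%:E); apply: eq_bigr => j _; rewrite indicE mem_set ?mul1r.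
  have [j tEj] : exists j, ~ E j (tnth t j).
    by apply/existsNP => H; apply: tE; exact: mem_set.
  by rewrite (bigD1 j)//= indicE memNset// !mul0r.
- by move=> _ /=; rewrite /pushforward preimage_setT probability_setT ltry.
Qed.

End tuple_law.

Section sum_law.
Context {R : realType}.
Notation mu := (@lebesgue_measure R).

Lemma ge0_integral_is_density d (T : measurableType d) (P : probability T R)
    (U : {RV P >-> R}) (f : R -> R) (h : R -> \bar R) :
  is_density P U f -> measurable_fun setT h -> (forall x, (0 <= h x)%E) ->
  (\int[P]_w h (U w) = \int[mu]_x (h x * (f x)%:E))%E.
Proof.
move=> [mf f0 fE] mh h0.
apply: (@ge0_integral_density _ _ T (measurableTypeR R) R P mu U f) => //.
have mU : measurable_fun setT (U : T -> R) by exact: measurable_funP.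
exact: mU.
Qed.

Lemma mutually_independent_comp d (T : measurableType d) (P : probability T R)
    (I I' : choiceType) (X : I -> {RV P >-> R}) (g : I' -> I) :
  injective g -> mutually_independent X -> mutually_independent (fun i => X (g i)).
Proof.
move=> gi Xi J E mE.
(* Events are transported along [g], with the full event off its range; by injectivity the chosen
   preimage is the right one. *)
pose E' i := if pselect (exists j, g j = i) is left e then E (projT1 (cid e)) else setT.
have E'g j : E' (g j) = E j.
  rewrite /E'; case: pselect => [e|]; last by case; exists j.
  by case: cid => j' /= /gi ->.
have mE' i : measurable (E' i) by rewrite /E'; case: pselect.
pose J' := [fset g j | j in J]%fset.
have := Xi J' E' mE'.
have -> : \bigcap_(i in [set` J']) X i @^-1` E' i = \bigcap_(j in [set` J]) X (g j) @^-1` E j.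
  apply/seteqP; split=> x /= H i iJ.
    by have := H (g i); rewrite /preimage/= E'g; apply; apply/imfsetP; exists i.
  by case/imfsetP: iJ => j jJ ->; rewrite /preimage/= E'g; exact: H.
by rewrite big_imfset/=; [under eq_bigr do rewrite E'g|move=> x y _ _; exact: gi].
Qed.

Section uniform.
Variables (p : nat -> R -> R) (M : R) (n : nat).
Hypothesis pM : forall i, (i < n)%N -> C1_density M (p i).

(** The test function is general because the induction, once the first coordinate x is fixed, is
    applied to s -> psi (x + s). A translation and Tonelli then produce the convolution by [p i]. *)
Lemma integral_lebesgue_tuple_sum k i (psi : R -> R) : (i + k < n)%N ->
  measurable_fun setT psi -> (forall x, 0 <= psi x) ->
  (\int[lebesgue_tuple R k.+1]_t
     (psi (\sum_(j < k.+1) tnth t j) * \prod_(j < k.+1) p (i + j)%N (tnth t j))%:E =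
   \int[mu]_u (psi u * sum_density p i k u)%:E)%E.
Proof.
have mp j : (j < n)%N -> measurable_fun setT (p j).
  by move=> /pM /C1_density_continuous /continuous_measurable_fun.
have p0 j x : (j < n)%N -> 0 <= p j x by move=> /pM[].
have mh k' i' (psi' : R -> R) : (i' + k' <= n)%N -> measurable_fun setT psi' ->
  measurable_fun setT (fun t : k'.-tuple R =>
    (psi' (\sum_(j < k') tnth t j) * \prod_(j < k') p (i' + j)%N (tnth t j))).
  move=> ik mpsi'; apply: measurable_funM.
    apply: (measurableT_comp mpsi'); apply: measurable_sum => j.
    exact: measurable_tnth.
  by apply: (measurable_prod_tnth (f := fun j : 'I_k' => p (i' + j)%N)) => j; apply: mp; have := ltn_ord j; lia.
have h0 k' i' (psi' : R -> R) (t : k'.-tuple R) : (i' + k' <= n)%N -> (forall x, 0 <= psi' x) ->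
    0 <= psi' (\sum_(j < k') tnth t j) * \prod_(j < k') p (i' + j)%N (tnth t j).
  move=> ik psi0'; rewrite mulr_ge0// prodr_ge0// => j _.
  by apply: p0; have := ltn_ord j; lia.
elim: k i psi => [|k IH] i psi ik mpsi psi0.
  have i1 : (i + 1 <= n)%N by lia.
  rewrite integral_lebesgue_tupleS; last 2 first.
  - by apply/measurable_EFinP; exact: (mh 1%N i psi).
  - by move=> t; rewrite lee_fin; exact: (h0 1%N i psi).
  apply: eq_integral => x _; rewrite integral_lebesgue_tuple0.
    by rewrite !big_ord_recl !big_ord0 tnth_tuple_cons0 addr0 mulr1 addn0.
  apply/measurable_EFinP.
  apply: (measurableT_comp (mh 1%N i psi i1 mpsi) (g := fun t => tuple_cons (x, t))).
  exact: (measurableT_comp (measurable_tuple_cons (k := 0)) (pair1_measurable _)).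
have i1 : (i + k.+2 <= n)%N by lia.
have i2 : (i.+1 + k.+1 <= n)%N by lia.
have i3 : (i.+1 + k < n)%N by lia.
have i4 : (i < n)%N by lia.
rewrite integral_lebesgue_tupleS; last 2 first.
- by apply/measurable_EFinP; exact: (mh k.+2 i psi).
- by move=> t; rewrite lee_fin; exact: (h0 k.+2 i psi).
have [cs sb] := sum_density_regular pM i3.
set g := sum_density p i.+1 k in cs sb *.
have mg := continuous_measurable_fun cs.
pose F (w : R * R) : \bar R := (psi w.2 * g (w.2 - w.1) * p i w.1)%:E.
have mF : measurable_fun setT F.
  apply/measurable_EFinP; apply: measurable_funM; first apply: measurable_funM.
  - exact: (measurableT_comp mpsi measurable_snd).
  - apply: (measurableT_comp mg (g := fun w : R * R => w.2 - w.1)).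
    exact: (measurable_funB measurable_snd measurable_fst).
  - exact: (measurableT_comp (mp _ i4) measurable_fst).
have F0 w : (0 <= F w)%E.
  rewrite lee_fin !mulr_ge0//; last exact: p0.
  by have /andP[] := sb (w.2 - w.1).
transitivity (\int[mu]_x \int[mu]_u F (x, u))%E.
  apply: eq_integral => x _.
  have mpx : measurable_fun setT (fun s : R => psi (x + s)).
    by apply: (measurableT_comp mpsi); exact: measurable_funD.
  transitivity (\int[lebesgue_tuple R k.+1]_t ((p i x)%:E *
    (psi (x + \sum_(j < k.+1) tnth t j) * \prod_(j < k.+1) p (i.+1 + j)%N (tnth t j))%:E))%E.
    apply: eq_integral => t _; rewrite -EFinM.
    have -> : \sum_(j < k.+2) tnth (tuple_cons (x, t)) j = x + \sum_(j < k.+1) tnth t j.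
      rewrite big_ord_recl tnth_tuple_cons0; congr (_ + _).
      by apply: eq_bigr => j _; rewrite tnth_tuple_consS.
    have -> : \prod_(j < k.+2) p (i + j)%N (tnth (tuple_cons (x, t)) j) =
        p i x * \prod_(j < k.+1) p (i.+1 + j)%N (tnth t j).
      rewrite big_ord_recl tnth_tuple_cons0 addn0; congr (_ * _).
      by apply: eq_bigr => j _; rewrite tnth_tuple_consS addSnnS.
    by congr (_%:E); ring.
  rewrite ge0_integralZl//; last 3 first.
  - by apply/measurable_EFinP; exact: (mh k.+1 i.+1 (fun s => psi (x + s))).
  - by move=> t _; rewrite lee_fin; exact: (h0 k.+1 i.+1 (fun s => psi (x + s))).
  - by rewrite lee_fin p0.
  rewrite (IH i.+1 (fun s => psi (x + s)))// -/g.
  rewrite -(@ge0_integral_shift _ (fun u => F (x, u)) x); last 2 first.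
  - exact: (measurableT_comp mF (pair1_measurable _)).
  - by move=> u; exact: F0.
  rewrite -ge0_integralZl//; last 3 first.
  - by apply/measurable_EFinP; exact: measurable_funM.
  - by move=> u _; rewrite lee_fin mulr_ge0//; have /andP[] := sb u.
  - by rewrite lee_fin p0.
  apply: eq_integral => u _; rewrite /F/= -EFinM addrK (addrC u x).
  by congr (_%:E); ring.
transitivity (\int[mu]_u \int[mu]_x F (x, u))%E; first exact: (@fubini_tonelli _ _ _ _ _ mu mu F).
apply: eq_integral => u _; rewrite /F/=.
have gn z : `|g z| <= 1 + M by have /andP[b0 b1] := sb z; rewrite ger0_norm.
have ii := integrable_conv u mg gn (C1_density_integrable (pM i4)).
rewrite /conv_op EFinM EFin_Rintegral// -ge0_integralZl//.
- by apply: eq_integral => x _; rewrite -EFinM mulrA.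
- by have /integrableP[] := ii.
- by move=> x _; rewrite lee_fin mulr_ge0 ?p0//; have /andP[] := sb (u - x).
- by rewrite lee_fin.
Qed.

End uniform.
End sum_law.

Section partial_sum_density.
Context {R : realType} d (T : measurableType d) (P : probability T R).
Notation mu := (@lebesgue_measure R).

Lemma partial_sum_is_density (X : nat -> {RV P >-> R}) (p : nat -> R -> R) M n i l :
  mutually_independent X -> (forall j, is_density P (X j) (p j)) ->
  (forall j, (j < n)%N -> C1_density M (p j)) -> (i + l < n)%N ->
  is_density P (partial_sum X i (i + l).+1) (sum_density p i l).
Proof.
move=> Xi Xp pM il.
have [cs sb] := sum_density_regular pM il.
split; first exact: continuous_measurable_fun.
  by move=> x; have /andP[] := sb x.
move=> C mC.
pose Y (j : 'I_l.+1) := X (i + j)%N.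
have Yi : mutually_independent Y.
  apply: (mutually_independent_comp (g := fun j : 'I_l.+1 => (i + j)%N)) Xi => a b /addnI.
  exact: val_inj.
pose D : set (l.+1.-tuple R) := [set t | C (\sum_(j < l.+1) tnth t j)].
have ms : measurable_fun setT (fun t : l.+1.-tuple R => \sum_(j < l.+1) tnth t j).
  by apply: measurable_sum => j; exact: measurable_tnth.
have mD : measurable D by rewrite -[D]setTI; exact: ms.
have := independent_tuple_law Yi (fun j => Xp (i + j)%N) mD.
have -> : (fun x => [tuple Y j x | j < l.+1]) @^-1` D = partial_sum X i (i + l).+1 @^-1` C.
  apply/seteqP; suff e x : \sum_(j < l.+1) tnth [tuple Y j x | j < l.+1] j = partial_sum X i (i + l).+1 x.
    by split=> x /=; rewrite /D/= e.
  rewrite /partial_sum -addnS -{1}[i]add0n big_addn addKn big_mkord.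
  by apply: eq_bigr => j _; rewrite tnth_mktuple /Y addnC.
move=> ->.
transitivity (\int[lebesgue_tuple R l.+1]_t
     (\1_C (\sum_(j < l.+1) tnth t j) * \prod_(j < l.+1) p (i + j)%N (tnth t j))%:E)%E.
  rewrite integral_mkcond; apply: eq_integral => t _.
  rewrite /patch indicE; have -> : (t \in D) = (\sum_(j < l.+1) tnth t j \in C) by [].
  by case: ifP => _; rewrite ?mul1r ?mul0r.
rewrite (integral_lebesgue_tuple_sum pM il)//.
rewrite [RHS]integral_mkcond; apply: eq_integral => x _.
by rewrite /patch indicE; case: ifP => _; rewrite ?mul1r ?mul0r.
Qed.

(** If f x > g x, then f >= g + e / 2 on some ball C by continuity, and the mass that the law gives
    to C would exceed itself by e / 2 times the measure of C. *)
Lemma continuous_density_le (U : T -> R) (f g : R -> R) : measurable_fun setT U ->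
  continuous f -> continuous g -> is_density P U f -> is_density P U g ->
  forall x, f x <= g x.
Proof.
move=> mU cf cg [mf f0 fE] [mg g0 gE] x; rewrite leNgt; apply/negP => gf.
pose e := f x - g x; have e0 : 0 < e by rewrite subr_gt0.
have cfg : {for x, continuous (fun y => f y - g y)} by apply: cvgB; [exact: cf|exact: cg].
have e20 : 0 < e / 2 by rewrite divr_gt0.
have /cvgrPdist_lt /(_ _ e20) [r /= r0 Hr] := cfg.
pose C : set R := ball x r.
have mC : measurable C by exact: measurable_ball.
have le y : C y -> g y + e / 2 <= f y.
  by move=> /Hr; rewrite /= ltr_norml => /andP[_]; rewrite /e; lra.
have : (\int[mu]_(y in C) (g y + e / 2)%:E <= \int[mu]_(y in C) (f y)%:E)%E.
  apply: ge0_le_integral => //.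
  - by move=> y _; rewrite lee_fin addr_ge0// ltW// divr_gt0.
  - by apply/measurable_EFinP; apply: measurable_funTS; exact: measurable_funD.
  - by apply/measurable_EFinP; exact: measurable_funTS.
have -> : (\int[mu]_(y in C) (g y + e / 2)%:E =
    \int[mu]_(y in C) (g y)%:E + \int[mu]_(y in C) (e / 2)%:E)%E.
  under eq_integral do rewrite EFinD.
  rewrite ge0_integralD//.
  - by move=> y _; rewrite lee_fin.
  - by apply/measurable_EFinP; exact: measurable_funTS.
  - by move=> y _; rewrite lee_fin ltW.
rewrite -fE// -gE// integral_cst//= (lebesgue_measure_ball _ (ltW r0)).
rewrite -[P _]fineK ?fin_num_measure//; last first.
  by rewrite -[U @^-1` C]setTI; exact: mU.
rewrite -EFinM -EFinD lee_fin gerDl leNgt mulr_gt0//.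
by rewrite mulrn_wgt0.
Qed.

(** Any explicit continuous density is the one selected by [xget], so the densities that
    [conditional_density] evaluates at points can be replaced by [sum_density]. *)
Lemma continuous_densityE (U : T -> R) (f : R -> R) : measurable_fun setT U ->
  continuous f -> is_density P U f -> continuous_density P U = f.
Proof.
move=> mU cf Uf; rewrite /continuous_density; case: xgetP => [g -> [cg Ug]|/(_ f)].
  by apply/funext => x; apply/le_anti; apply/andP; split; exact: (continuous_density_le mU).
by case; split.
Qed.

End partial_sum_density.

(** * Exponential tilting *)

Section tilting_facts.
Context {R : realType} d (T : measurableType d) (P : probability T R).
Notation mu := (@lebesgue_measure R).
Variables (U : {RV P >-> R}) (p : R -> R) (alpha beta : \bar R).
Hypothesis Up : is_density P U p.
Hypothesis Udom : forall t, (Phi P U t < +oo)%E <-> eitv alpha beta t.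
Hypothesis pC1 : class_C1 p.

Let p0 x : 0 <= p x. Proof. by have [_ + _] := Up; exact. Qed.

Let mp : measurable_fun setT p. Proof. by have [] := Up. Qed.

Let mexp t : measurable_fun setT (fun x : R => expR (t * x)).
Proof. by apply: measurableT_comp => //; exact: measurable_funM. Qed.

Lemma density_integral1 : (\int[mu]_x (p x)%:E = 1)%E.
Proof.
have [_ _ /(_ setT measurableT)] := Up.
by rewrite preimage_setT probability_setT.
Qed.

Lemma PhiE t : Phi P U t = (\int[mu]_x (expR (t * x) * p x)%:E)%E.
Proof.
rewrite /Phi /mmt_gen_fun unlock.
rewrite -(ge0_integral_is_density (h := fun x => (expR (t * x))%:E) Up)//.
- by apply: eq_integral => w _ /=; rewrite mulrC.
- exact/measurable_EFinP.
Qed.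

Lemma tilted_integrable t : eitv alpha beta t ->
  mu.-integrable setT (EFin \o (fun x => expR (t * x) * p x)).
Proof.
move=> /Udom; rewrite PhiE => fin; apply/integrableP; split.
  by apply/measurable_EFinP; exact: (measurable_funM (mexp t) mp).
by under eq_integral do rewrite /= ger0_norm ?mulr_ge0 ?expR_ge0//.
Qed.

Lemma fine_PhiE t : fine (Phi P U t) = \int[mu]_x (expR (t * x) * p x).
Proof. by rewrite PhiE. Qed.

(** If the integral of exp (t x) p x vanished, [p] would vanish almost everywhere, against its total
    mass 1. *)
Lemma Phi_gt0 t : eitv alpha beta t -> 0 < fine (Phi P U t).
Proof.
move=> tT.
have F0 : 0 <= fine (Phi P U t).
  by rewrite fine_PhiE; apply: Rintegral_ge0 => x _; rewrite mulr_ge0// expR_ge0.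
rewrite lt_neqAle F0 andbT fine_PhiE.
apply/eqP => e.
have i := tilted_integrable tT.
have e0 : (\int[mu]_x `|(expR (t * x) * p x)%:E| = 0)%E.
  under eq_integral do rewrite gee0_abs ?lee_fin ?mulr_ge0 ?expR_ge0//.
  by rewrite -EFin_Rintegral// -e.
have mep : measurable_fun setT (fun x => (expR (t * x) * p x)%:E).
  by apply/measurable_EFinP; exact: (measurable_funM (mexp t) mp).
have /ae_eq_integral_abs := e0 => /(_ measurableT mep) ae.
have : (\int[mu]_x (p x)%:E = 0)%E.
  have mpE : measurable_fun setT (fun x => (p x)%:E) by exact/measurable_EFinP.
  have := @ae_eq_integral_abs _ _ _ mu setT measurableT _ mpE => -[_ H].
  rewrite -[RHS]H.
    by apply: eq_integral => x _; rewrite gee0_abs// lee_fin.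
  apply: filterS ae => x /(_ I) /= [] /eqP.
  by rewrite mulf_eq0 expR_eq0/= => /eqP -> _.
by rewrite density_integral1 => /eqP; rewrite onee_eq0.
Qed.

(** The inequality is not strict, so that t - e and t + e are themselves admissible tilts. *)
Lemma eitv_open t : eitv alpha beta t ->
  exists2 e, 0 < e & forall s, `|s - t| <= e -> eitv alpha beta s.
Proof.
rewrite /eitv/= => /andP[at' tb].
have [e1 e10 H1] : exists2 e, 0 < e & (alpha < (t - e)%:E)%E.
  case: alpha at' => [r| |]//; last by exists 1; rewrite ?ltNyr.
  rewrite lte_fin => rt; exists ((t - r) / 2); first by rewrite divr_gt0// subr_gt0.
  by rewrite lte_fin; lra.
have [e2 e20 H2] : exists2 e, 0 < e & ((t + e)%:E < beta)%E.
  case: beta tb => [r| |]//; last by exists 1; rewrite ?ltry.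
  rewrite lte_fin => rt; exists ((r - t) / 2); first by rewrite divr_gt0// subr_gt0.
  by rewrite lte_fin; lra.
exists (Num.min e1 e2); first by rewrite lt_min e10.
move=> s; rewrite le_min => /andP[]; rewrite !ler_norml => /andP[a1 a2] /andP[b1 b2].
apply/andP; split.
  by apply: (lt_le_trans H1); rewrite lee_fin; lra.
by apply: le_lt_trans H2; rewrite lee_fin; lra.
Qed.

Let F t := \int[mu]_x (expR (t * x) * p x).

Let is_derive_integrand (s y : R) :
  is_derive s 1 (fun s : R => expR (s * y) * p y) (y * (expR (s * y) * p y)).
Proof.
by apply: is_derive_eq; rewrite /GRing.scale/= !(mul0r, mulr0, addr0, mulr1, mul1r, add0r); ring.
Qed.

(** Differentiation under the integral sign. For |s - t| < h = e / 2 the factor |y| is absorbed by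
    |y| <= h^-1 exp (h |y|), and h + |s - t| < e, so the tilts at t - e and t + e dominate up to the
    factor h^-1. *)
Lemma tilted_first_moment t : eitv alpha beta t ->
  mu.-integrable setT (EFin \o (fun x => x * (expR (t * x) * p x))) /\
  is_derive t 1 F (\int[mu]_x (x * (expR (t * x) * p x))).
Proof.
move=> tT; have [e e0 He] := eitv_open tT.
pose h := e / 2; have h0 : 0 < h by rewrite divr_gt0.
pose G y := h^-1 * (expR ((t - e) * y) * p y) + h^-1 * (expR ((t + e) * y) * p y).
have G0 y : 0 <= G y by rewrite addr_ge0// mulr_ge0 ?invr_ge0 ?(ltW h0)// mulr_ge0 ?expR_ge0.
have iG : mu.-integrable setT (EFin \o G).
  have i1 : mu.-integrable setT (EFin \o (fun x => expR ((t - e) * x) * p x)).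
    by apply: tilted_integrable; apply: He; rewrite addrAC subrr add0r normrN gtr0_norm.
  have i2 : mu.-integrable setT (EFin \o (fun x => expR ((t + e) * x) * p x)).
    by apply: tilted_integrable; apply: He; rewrite addrAC subrr add0r gtr0_norm.
  have j1 := integrableZl measurableT h^-1 i1.
  have j2 := integrableZl measurableT h^-1 i2.
  exact: (integrableD measurableT j1 j2).
have bG s y : `|s - t| < h -> `|y * (expR (s * y) * p y)| <= G y.
  have E0 : 0 <= expR (s * y) * p y by rewrite mulr_ge0// expR_ge0.
  move=> st; rewrite normrM (ger0_norm E0).
  rewrite /G -mulrDr -mulrDl [leLHS]mulrA [leRHS]mulrA ler_wpM2r//.
  have yh : `|y| <= h^-1 * expR (h * `|y|).
    rewrite mulrC ler_pdivlMr// mulrC (le_trans _ (expR_ge1Dx _))//.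
    by rewrite lerDr.
  apply: (@le_trans _ _ (h^-1 * expR (h * `|y|) * expR (s * y))); first by rewrite ler_wpM2r// expR_ge0.
  rewrite -mulrA -expRD ler_wpM2l ?invr_ge0 ?(ltW h0)//.
  move: st; rewrite ltr_norml => /andP[s1 s2].
  have eh : e = 2 * h by rewrite /h; field.
  have [y0|y0] := leP 0 y.
    apply: (@le_trans _ _ (expR ((t + e) * y))); last by rewrite lerDr expR_ge0.
    by rewrite ler_expR (ger0_norm y0) -mulrDl ler_wpM2r//; lra.
  apply: (@le_trans _ _ (expR ((t - e) * y))); last by rewrite lerDl expR_ge0.
  rewrite ler_expR (ltr0_norm y0) mulrN -mulNr -mulrDl.
  apply: ler_wnM2r; [exact: ltW|lra].
have i : mu.-integrable setT (EFin \o (fun x => x * (expR (t * x) * p x))).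
  apply: (le_integrable measurableT) iG => //.
    by apply/measurable_EFinP; apply: measurable_funM => //; exact: (measurable_funM (mexp t) mp).
  move=> y _ /=; rewrite lee_fin (ger0_norm (G0 y)).
  by apply: bG; rewrite subrr normr0.
split=> //.
have tI : (`]t - h, t + h[%classic : set R) t by rewrite /= in_itv/=; apply/andP; split; lra.
have sub (s : R) : (`]t - h, t + h[%classic : set R) s -> `|s - t| < h.
  by rewrite /= in_itv/= ltr_norml => /andP[? ?]; apply/andP; split; lra.
have a1 (s : R) : (`]t - h, t + h[%classic : set R) s -> mu.-integrable setT (EFin \o (fun y => expR (s * y) * p y)).
  by move=> /sub sh; apply: tilted_integrable; apply: He; rewrite (le_trans (ltW sh))// /h; lra.
have a2 (s y : R) : (`]t - h, t + h[%classic : set R) s -> [set: R] y -> derivable (fun s : R => expR (s * y) * p y) s 1.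
  by move=> _ _; apply: ex_derive.
have a3 (s y : R) : derive1 (fun s : R => expR (s * y) * p y) s = y * (expR (s * y) * p y).
  by rewrite derive1E; exact: derive_val.
have a4 (s y : R) : (`]t - h, t + h[%classic : set R) s -> [set: R] y ->
    `|partial1of2 (fun s y : R => expR (s * y) * p y) s y| <= G y.
  by move=> /sub sh _; rewrite /partial1of2 a3; exact: bG.
have D := @derivable_under_integral R _ _ mu (fun s y : R => expR (s * y) * p y) setT measurableT t
  (t - h) (t + h) tI a1 a2 G G0 iG a4.
apply: DeriveDef => //.
rewrite -derive1E (@differentiation_under_integral R _ _ mu (fun s y : R => expR (s * y) * p y) setT measurableT t
  (t - h) (t + h) tI a1 a2 G G0 iG a4).
by apply: eq_Rintegral => y _; rewrite /partial1of2 a3.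
Qed.

Let td t x := tilted_density P U p t x.

Lemma is_derive_kappa t : eitv alpha beta t ->
  is_derive t 1 (kappa P U) (\int[mu]_x (x * td t x)).
Proof.
move=> tT; have [i D] := tilted_first_moment tT.
have F0 : 0 < F t by rewrite /F -fine_PhiE Phi_gt0.
have -> : kappa P U = (fun s => ln (F s)) by apply/funext => s; rewrite /kappa fine_PhiE.
have := is_derive1_comp (is_derive1_ln F0) D.
move=> /is_derive_eq; apply.
rewrite mulrC -(RintegralZr _ _ i)//.
by apply: eq_Rintegral => x _; rewrite /td /tilted_density fine_PhiE -/(F t) [RHS]mulrA.
Qed.

Lemma tilted_meanE t : eitv alpha beta t ->
  tilted_mean P U t = \int[mu]_x (x * td t x).
Proof.
by move=> tT; rewrite /tilted_mean derive1E; have := is_derive_kappa tT => D; exact: derive_val.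
Qed.

End tilting_facts.

(** * Regularity and moments of tilted densities *)

Section tilted_regularity.
Context {R : realType} d (T : measurableType d) (P : probability T R).
Notation mu := (@lebesgue_measure R).
Variables (U : {RV P >-> R}) (p : R -> R) (alpha beta : \bar R).
Hypothesis Up : is_density P U p.
Hypothesis Udom : forall t, (Phi P U t < +oo)%E <-> eitv alpha beta t.
Hypothesis pC1 : class_C1 p.

Let p0 x : 0 <= p x. Proof. by have [_ + _] := Up; exact. Qed.

Let mp : measurable_fun setT p. Proof. by have [] := Up. Qed.

Lemma tilted_class_C1 t : class_C1 (tilted_density P U p t).
Proof.
have [dp cdp] := pC1.
pose df x := (t * (expR (t * x) * p x) + expR (t * x) * derive1 p x) / fine (Phi P U t).
have D (x : R) : is_derive x 1 (tilted_density P U p t) (df x).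
  have Dp : is_derive x 1 p (derive1 p x) by apply: DeriveDef => //; rewrite derive1E.
  rewrite /tilted_density; apply: is_derive_eq.
  rewrite /GRing.scale/= /df; ring.
split=> [x|]; first by have := D x => Dx; exact: ex_derive.
have -> : derive1 (tilted_density P U p t) = df.
  by apply/funext => x; rewrite derive1E; have := D x => Dx; exact: derive_val.
have ce : continuous (fun x : R => expR (t * x)).
  move=> x; apply: (@continuous_comp _ _ _ (fun x => t * x) expR x); last exact: continuous_expR.
  exact: mulrl_continuous.
have cp := class_C1_continuous pC1.
move=> x; apply: cvgM; last exact: cvg_cst.
apply: cvgD; last by apply: cvgM; [exact: ce|exact: cdp].
by apply: cvgM; [exact: cvg_cst|apply: cvgM; [exact: ce|exact: cp]].
Qed.

Lemma tilted_density_ge0 t x : 0 <= tilted_density P U p t x.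
Proof.
rewrite /tilted_density divr_ge0// ?mulr_ge0 ?expR_ge0//.
by rewrite fine_ge0// (PhiE Up) integral_ge0// => y _; rewrite lee_fin mulr_ge0// expR_ge0.
Qed.

Lemma tilted_integral1 t : eitv alpha beta t ->
  (\int[mu]_x (tilted_density P U p t x)%:E = 1)%E.
Proof.
move=> tT; have i := tilted_integrable Up Udom tT.
have F0 := Phi_gt0 Up Udom tT.
have it : mu.-integrable setT (EFin \o tilted_density P U p t).
  exact: (integrableZr measurableT (fine (Phi P U t))^-1 i).
rewrite -(EFin_Rintegral measurableT it) (RintegralZr _ _ i)//.
by rewrite -(fine_PhiE Up) divff// gt_eqF.
Qed.

Lemma tilted_C1_density M t : eitv alpha beta t ->
  ('N[mu]_1 [EFin \o derive1 (tilted_density P U p t)] <= M%:E)%E ->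
  C1_density M (tilted_density P U p t).
Proof.
move=> tT; rewrite Lnorm1 => HM; split.
- exact: tilted_class_C1.
- exact: tilted_density_ge0.
- exact: tilted_integral1.
- exact: HM.
Qed.

(** With b = |x - m|^3, b <= 1 + b^2 bounds the third moment by 1 plus the sixth one. Centring holds
    because the derivative of [kappa] is the mean of the tilted density. *)
Lemma tilted_third_moment V t : eitv alpha beta t ->
  (tilted_abs_moment P 6 U p t <= V%:E)%E ->
  centered_third_moment (1 + V) (tilted_mean P U t) (tilted_density P U p t).
Proof.
move=> tT HV; set f := tilted_density P U p t; set m := tilted_mean P U t.
have f0 x : 0 <= f x by exact: tilted_density_ge0.
have cf : continuous f by exact: class_C1_continuous (tilted_class_C1 t).
have mf := continuous_measurable_fun cf.
have f1 : (\int[mu]_x (f x)%:E = 1)%E by exact: tilted_integral1.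
have i0 : mu.-integrable setT (EFin \o f).
  apply/integrableP; split; first exact/measurable_EFinP.
  by under eq_integral do rewrite /= ger0_norm//; rewrite f1 ltry.
have mn : measurable_fun setT (fun x : R => `|x - m|).
  by apply: measurableT_comp => //; exact: measurable_funB.
have mk k : measurable_fun setT (fun x : R => `|x - m| ^+ k * f x).
  by apply: measurable_funM => //; exact: measurable_funX.
have nk k x : 0 <= `|x - m| ^+ k * f x by rewrite mulr_ge0// exprn_ge0.
have i6 : mu.-integrable setT (EFin \o (fun x => `|x - m| ^+ 6 * f x)).
  apply/integrableP; split; first by apply/measurable_EFinP; exact: mk.
  under eq_integral => x _ do rewrite /= (ger0_norm (nk 6%N x)).
  exact: le_lt_trans HV (ltry _).
have i06 : mu.-integrable setT (EFin \o (fun x => f x + `|x - m| ^+ 6 * f x)).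
  exact: (integrableD measurableT i0 i6).
have le3 x : `|x - m| ^+ 3 * f x <= f x + `|x - m| ^+ 6 * f x.
  rewrite -[X in _ <= X + _]mul1r -mulrDl ler_wpM2r//.
  rewrite (exprM `|x - m| 3 2); set b := `|x - m| ^+ 3.
  by have := sqr_ge0 (b - 1); nra.
have i3 : mu.-integrable setT (EFin \o (fun x => `|x - m| ^+ 3 * f x)).
  apply: (le_integrable measurableT) i06 => //; first by apply/measurable_EFinP; exact: mk.
  move=> x _ /=; rewrite lee_fin (ger0_norm (nk 3%N x)).
  by rewrite (le_trans (le3 x))// ler_norm.
have [i1 _] := tilted_first_moment Up Udom tT.
have ix : mu.-integrable setT (EFin \o (fun x => x * f x)).
  have := integrableZr measurableT (fine (Phi P U t))^-1 i1.
  by apply: eq_integrable => // x _ /=; rewrite -EFinM /f /tilted_density !mulrA.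
split=> //.
- rewrite (_ : \int[mu]_y _ = \int[mu]_y (y * f y - m * f y)); last first.
    by apply: eq_Rintegral => y _; rewrite mulrBl.
  rewrite RintegralB//; last exact: (integrableZl measurableT m i0).
  rewrite (RintegralZl _ _ i0)//.
  rewrite (_ : \int[mu]_x f x = 1); last by rewrite /Rintegral f1.
  by rewrite mulr1 /m (tilted_meanE Up Udom tT) subrr.
- apply: (@le_trans _ _ (\int[mu]_x (f x + `|x - m| ^+ 6 * f x))).
    by apply: le_Rintegral => // x _; exact: le3.
  rewrite RintegralD// (_ : \int[mu]_x f x = 1) ?lerD2l; last by rewrite /Rintegral f1.
  by rewrite -lee_fin EFin_Rintegral.
Qed.

Lemma eitv0 : eitv alpha beta 0.
Proof.
apply/Udom; rewrite (PhiE Up).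
under eq_integral do rewrite mul0r expR0 mul1r.
by rewrite (density_integral1 Up) ltry.
Qed.

(** Lets the assumptions on tilted densities, taken on the compact set {0}, bear on [p] itself. *)
Lemma tilted_density0 : tilted_density P U p 0 = p.
Proof.
have e : fine (Phi P U 0) = 1.
  rewrite (PhiE Up); under eq_integral do rewrite mul0r expR0 mul1r.
  by rewrite (density_integral1 Up).
by apply/funext => x; rewrite /tilted_density e mul0r expR0 mul1r divr1.
Qed.

End tilted_regularity.

(** exp (t (u - y)) exp (t y) = exp (t u): tilting commutes with convolution. *)
Lemma sum_density_tilted {R : realType} d (T : measurableType d) (P : probability T R)
    (X : nat -> {RV P >-> R}) (p : nat -> R -> R) M n t i l u :
  (forall j, (j < n)%N -> C1_density M (p j)) -> (i + l < n)%N ->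
  sum_density (fun j => tilted_density P (X j) (p j) t) i l u =
  expR (t * u) * sum_density p i l u / \prod_(i <= j < (i + l).+1) fine (Phi P (X j) t).
Proof.
move=> pM; elim: l i u => [|l IH] i u il.
  by rewrite addn0 big_nat1.
have il' : (i.+1 + l < n)%N by rewrite addSnnS.
have ii : (i < n)%N by lia.
have [cs sb] := sum_density_regular pM il'.
have gn z : `|sum_density p i.+1 l z| <= 1 + M.
  by have /andP[b0 b1] := sb z; rewrite ger0_norm.
have ig := integrable_conv u (continuous_measurable_fun cs) gn (C1_density_integrable (pM _ ii)).
rewrite /= /conv_op.
have -> : \prod_(i <= j < (i + l.+1).+1) fine (Phi P (X j) t) =
  fine (Phi P (X i) t) * \prod_(i.+1 <= j < (i.+1 + l).+1) fine (Phi P (X j) t).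
  by rewrite big_ltn ?ltnS ?leq_addr// addSnnS.
set Q := \prod_(_ <= _ < _) _.
pose c := expR (t * u) / (fine (Phi P (X i) t) * Q).
rewrite [RHS](_ : _ = c * \int[lebesgue_measure]_y (sum_density p i.+1 l (u - y) * p i y)); last first.
  by rewrite /c; ring.
rewrite -(RintegralZl _ _ ig)//.
apply: eq_Rintegral => y _; rewrite IH// -/Q /tilted_density /c.
have -> : t * u = t * (u - y) + t * y by ring.
by rewrite expRD invfM; ring.
Qed.

(** * Existence and location of the tilting point *)

Section tilting_point_location.
Context {R : realType}.
Implicit Types (alpha beta A B : \bar R) (f : R -> R) (a : R).

Lemma eitv_near_left alpha beta (V : set (\bar R)) : (alpha < beta)%E ->
  nbhs alpha V -> exists2 t, eitv alpha beta t & V t%:E.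
Proof.
case: alpha => [r| |]; [|by rewrite ltNge leey|].
- move=> rb [e /= e0 H].
  have [q q0 rq] : exists2 q, 0 < q & ((r + q)%:E < beta)%E.
    case: beta rb => [b| |]// rb; last by exists 1 => //; rewrite ltry.
    exists ((b - r) / 2); first by rewrite divr_gt0// subr_gt0.
    by move: rb; rewrite !lte_fin; lra.
  pose s := r + Num.min q (e / 2).
  have h0 : 0 < Num.min q (e / 2) by rewrite lt_min q0 divr_gt0.
  have hq : Num.min q (e / 2) <= q by rewrite ge_min lexx.
  have he : Num.min q (e / 2) <= e / 2 by rewrite ge_min lexx orbT.
  exists s.
    rewrite /eitv/= lte_fin ltrDl h0/=; apply: le_lt_trans rq.
    by rewrite lee_fin lerD2l.
  apply: H => /=; rewrite /s opprD addrA subrr add0r normrN gtr0_norm//; lra.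
- move=> nb [M [_ H]].
  have [q qb qM] : exists2 q, (q%:E < beta)%E & q < M.
    case: beta nb => [b| |]// _.
      exists (Num.min b M - 1); last by rewrite ltrBlDr ltr_pwDr// ge_min lexx orbT.
      by rewrite lte_fin ltrBlDr ltr_pwDr// ge_min lexx.
    by exists (M - 1); rewrite ?ltry// ltrBlDr ltrDl.
  exists q; first by rewrite /eitv/= ltNyr.
  by apply: H; rewrite lte_fin.
Qed.

Lemma eitv_near_right alpha beta (V : set (\bar R)) : (alpha < beta)%E ->
  nbhs beta V -> exists2 t, eitv alpha beta t & V t%:E.
Proof.
case: beta => [r| |]; [| |by rewrite ltNge leNye].
- move=> rb [e /= e0 H].
  have [q q0 rq] : exists2 q, 0 < q & (alpha < (r - q)%:E)%E.
    case: alpha rb => [b| |]// rb; last by exists 1 => //; rewrite ltNyr.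
    exists ((r - b) / 2); first by rewrite divr_gt0// subr_gt0.
    by move: rb; rewrite !lte_fin; lra.
  pose s := r - Num.min q (e / 2).
  have h0 : 0 < Num.min q (e / 2) by rewrite lt_min q0 divr_gt0.
  have hq : Num.min q (e / 2) <= q by rewrite ge_min lexx.
  have he : Num.min q (e / 2) <= e / 2 by rewrite ge_min lexx orbT.
  exists s.
    rewrite /eitv/= lte_fin gtrBl h0/= andbT; apply: (lt_le_trans rq).
    by rewrite lee_fin lerD2l lerN2.
  apply: H => /=; rewrite /s opprB addrCA subrr addr0 gtr0_norm//; lra.
- move=> nb [M [_ H]].
  have [q qb qM] : exists2 q, (alpha < q%:E)%E & M < q.
    case: alpha nb => [b| |]// _.
      exists (Num.max b M + 1); last by rewrite ltr_pwDr// le_max lexx orbT.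
      by rewrite lte_fin ltr_pwDr// le_max lexx.
    by exists (M + 1); rewrite ?ltNyr// ltrDl.
  exists q; first by rewrite /eitv/= qb ltry.
  by apply: H; rewrite lte_fin.
Qed.

Lemma property_H_below alpha beta A B f a : (alpha < beta)%E ->
  property_H alpha beta A B f -> (A < a%:E)%E ->
  exists2 t, eitv alpha beta t & f t < a.
Proof.
move=> ab [_ _ fA _] Aa.
have VA : nbhs A [set x | (x < a%:E)%E].
  by apply: open_nbhs_nbhs; split => //; exact: open_ereal_lt_ereal.
have [t tT] := eitv_near_left ab (fA _ VA).
by rewrite /= lte_fin => /(_ tT) ?; exists t.
Qed.

Lemma property_H_above alpha beta A B f a : (alpha < beta)%E ->
  property_H alpha beta A B f -> (a%:E < B)%E ->
  exists2 t, eitv alpha beta t & a < f t.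
Proof.
move=> ab [_ _ _ fB] aB.
have VB : nbhs B [set x | (a%:E < x)%E].
  by apply: open_nbhs_nbhs; split => //; exact: open_ereal_gt_ereal.
have [t tT] := eitv_near_right ab (fB _ VB).
by rewrite /= lte_fin => /(_ tT) ?; exists t.
Qed.

Lemma eitv_convex alpha beta (s t u : R) : eitv alpha beta s -> eitv alpha beta u ->
  s <= t <= u -> eitv alpha beta t.
Proof.
move=> /andP[s1 _] /andP[_ u2] /andP[st tu]; apply/andP; split.
  by apply: (lt_le_trans s1); rewrite lee_fin.
by apply: le_lt_trans u2; rewrite lee_fin.
Qed.

(* A derivative which is negative on the left end of an interval and positive on
   the right end vanishes inside, without being assumed continuous. *)
Lemma derivative_zero (L D : R -> R) (u0 u1 v1 v0 : R) : u0 < u1 -> u1 < v1 -> v1 < v0 ->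
  (forall t, u0 <= t <= v0 -> is_derive t 1 L (D t)) ->
  (forall t, u0 <= t <= u1 -> D t < 0) -> (forall t, v1 <= t <= v0 -> 0 < D t) ->
  exists2 c, u0 <= c <= v0 & D c = 0.
Proof.
move=> u01 uv v10 LD Du Dv.
have uv0 : u0 <= v0 by lra.
have l1 : u1 <= v0 by lra.
have l2 : u0 <= v1 by lra.
have cL x y : u0 <= x -> y <= v0 -> {within `[x, y], continuous L}.
  move=> ux yv; apply: derivable_within_continuous => t; rewrite in_itv/= => /andP[xt ty].
  have Lt : is_derive t 1 L (D t) by apply: LD; apply/andP; split; lra.
  exact: ex_derive.
(* A minimiser of L. It is interior since, by the mean value theorem, L u1 < L u0 and L v1 < L
   v0. *)
have [c /[!in_itv]/= /andP[uc cv] cmin] := EVT_min uv0 (cL _ _ (lexx _) (lexx _)).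
have cu : c != u0.
  apply/eqP => cu.
  have LD' t : t \in `]u0, u1[ -> is_derive t 1 L (D t).
    by rewrite in_itv/= => /andP[x1 x2]; apply: LD; apply/andP; split; lra.
  have [x /[!in_itv]/= /andP[x1 x2] e] := MVT u01 LD' (cL u0 u1 (lexx _) l1).
  have := cmin u1; rewrite in_itv/= => /(_ ltac:(apply/andP; split; lra)).
  rewrite cu -subr_ge0 e; apply/negP; rewrite -ltNge.
  by rewrite nmulr_rlt0 ?subr_gt0//; apply: Du; apply/andP; split; lra.
have cv' : c != v0.
  apply/eqP => cv'.
  have LD' t : t \in `]v1, v0[ -> is_derive t 1 L (D t).
    by rewrite in_itv/= => /andP[x1 x2]; apply: LD; apply/andP; split; lra.
  have [x /[!in_itv]/= /andP[x1 x2] e] := MVT v10 LD' (cL v1 v0 l2 (lexx _)).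
  have := cmin v1; rewrite in_itv/= => /(_ ltac:(apply/andP; split; lra)).
  rewrite cv' -subr_le0 e; apply/negP; rewrite -ltNge.
  by rewrite mulr_gt0 ?subr_gt0//; apply: Dv; apply/andP; split; lra.
have uc' : u0 < c by rewrite lt_neqAle eq_sym cu.
have vc' : c < v0 by rewrite lt_neqAle cv'.
have LDc : is_derive c 1 L (D c) by apply: LD; rewrite uc cv.
exists c; first by rewrite uc cv.
have := @derive1_at_min R L u0 v0 c uv0.
have dL t : t \in `]u0, v0[ -> derivable L t 1.
  rewrite in_itv/= => /andP[t1 t2]; have : is_derive t 1 L (D t) by apply: LD; apply/andP; split; lra.
  by move=> h; exact: ex_derive.
move=> /(_ dL).
rewrite in_itv/= uc' vc' => /(_ isT).
have mn t : t \in `]u0, v0[ -> L c <= L t.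
  by rewrite in_itv/= => /andP[t1 t2]; apply: cmin; rewrite in_itv/= !ltW.
move=> /(_ mn) h; rewrite -(derive_val (is_derive := LDc)).
exact: derive_val.
Qed.

End tilting_point_location.

(** * Total variation *)

Section tilting_point_bounds.
Context {R : realType} d (T : measurableType d) (P : probability T R).
Variables (X : nat -> {RV P >-> R}) (p : nat -> R -> R).
Variables (A B alpha beta : \bar R) (fminus fplus : R -> R).
Hypothesis Xp : forall j, is_density P (X j) (p j).
Hypothesis ab : (alpha < beta)%E.
Hypothesis Xdom : forall j t, (Phi P (X j) t < +oo)%E <-> eitv alpha beta t.
Hypothesis fmH : property_H alpha beta A B fminus.
Hypothesis fpH : property_H alpha beta A B fplus.
Hypothesis mf : forall j t, eitv alpha beta t ->
  fminus t <= tilted_mean P (X j) t <= fplus t.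

(** Up to u1 every m_j is at most f_+ u1 < a, and from v1 on every m_j is at least f_- v1 > a; a
    solution thus lies in [u1, v1], whatever n. One exists because the sum of the m_j minus n a is
    the derivative of L, the sum of the [kappa] minus n a t, and changes sign. *)
Lemma tilting_point_bounds a : eitv A B a ->
  exists u v, [/\ forall t, u <= t <= v -> eitv alpha beta t, u <= v &
    forall n, (0 < n)%N -> let t := tilting_point X alpha beta a n in
      u <= t <= v /\ \sum_(j < n) tilted_mean P (X j) t = n%:R * a].
Proof.
move=> /andP[Aa aB].
have [u1 u1T fu] := property_H_below ab fpH Aa.
have [v1 v1T fv] := property_H_above ab fmH aB.
have [_ fpi _ _] := fpH; have [_ fmi _ _] := fmH.
have fple s t : eitv alpha beta s -> eitv alpha beta t -> s <= t -> fplus s <= fplus t.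
  by move=> sT tT; rewrite le_eqVlt => /predU1P[->//|st]; exact/ltW/fpi.
have fmle s t : eitv alpha beta s -> eitv alpha beta t -> s <= t -> fminus s <= fminus t.
  by move=> sT tT; rewrite le_eqVlt => /predU1P[->//|st]; exact/ltW/fmi.
(* Otherwise a < f_- v1 <= f_- u1 <= f_+ u1 < a. *)
have uv1 : u1 < v1.
  rewrite ltNge; apply/negP => vu.
  have := fmle _ _ v1T u1T vu; have /andP[] := mf 0 u1T; lra.
have [e1 e10 He1] := eitv_open u1T.
have [e2 e20 He2] := eitv_open v1T.
(* Room outside [u1, v1], so that the sign of the derivative is known on intervals of positive
   length. *)
pose u0 := u1 - e1; pose v0 := v1 + e2.
have u0T : eitv alpha beta u0.
  by apply: He1; rewrite /u0 addrAC subrr add0r normrN gtr0_norm.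
have v0T : eitv alpha beta v0.
  by apply: He2; rewrite /v0 addrAC subrr add0r gtr0_norm.
have cvx t : u0 <= t <= v0 -> eitv alpha beta t by exact: eitv_convex.
have u01 : u0 < u1 by rewrite /u0; lra.
have v01 : v1 < v0 by rewrite /v0; lra.
have low n t : (0 < n)%N -> eitv alpha beta t -> t <= u1 ->
    \sum_(j < n) tilted_mean P (X j) t < n%:R * a.
  move=> n0 tT tu; apply: (@le_lt_trans _ _ (\sum_(j < n) fplus u1)).
    by apply: ler_sum => j _; have /andP[_ h] := mf j tT; exact: le_trans h (fple _ _ tT u1T tu).
  by rewrite sumr_const card_ord -[fplus u1 *+ _]mulr_natl ltr_pM2l// ltr0n.
have high n t : (0 < n)%N -> eitv alpha beta t -> v1 <= t ->
    n%:R * a < \sum_(j < n) tilted_mean P (X j) t.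
  move=> n0 tT tu; apply: (@lt_le_trans _ _ (\sum_(j < n) fminus v1)).
    by rewrite sumr_const card_ord -[fminus v1 *+ _]mulr_natl ltr_pM2l// ltr0n.
  by apply: ler_sum => j _; have /andP[h _] := mf j tT; exact: le_trans (fmle _ _ v1T tT tu) h.
exists u1, v1; split.
- by move=> t /andP[t1 t2]; apply: cvx; apply/andP; split; lra.
- exact: ltW.
move=> n n0; rewrite /= /tilting_point; case: xgetP => [t _ [tT te]|H].
  have nn : n%:R != 0 :> R by rewrite pnatr_eq0 -lt0n.
  have e : \sum_(j < n) tilted_mean P (X j) t = n%:R * a by rewrite -te mulVKf.
  split=> //; apply/andP; split; rewrite leNgt; apply/negP => h.
    by have := low n t n0 tT (ltW h); rewrite e ltxx.
  by have := high n t n0 tT (ltW h); rewrite e ltxx.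
(* In this case [xget] returns its default value because there is no solution; a zero of [D]
   contradicts this. *)
exfalso.
pose L t := \sum_(j < n) kappa P (X j) t - n%:R * a * t.
pose D t := \sum_(j < n) tilted_mean P (X j) t - n%:R * a.
have LD t : u0 <= t <= v0 -> is_derive t 1 L (D t).
  move=> /cvx tT.
  have kD j : is_derive t 1 (kappa P (X j)) (tilted_mean P (X j) t).
    rewrite (tilted_meanE (Xp j) (Xdom j) tT).
    exact: (is_derive_kappa (Xp j) (Xdom j) tT).
  have -> : L = (\sum_(j < n) kappa P (X j)) - (n%:R * a) \*: id.
    by apply/funext => s; rewrite /L !fctE fct_sumE.
  rewrite /D; apply: is_derive_eq.
  by rewrite /GRing.scale/= mulr1.
have Dlow t : u0 <= t <= u1 -> D t < 0.
  move=> /andP[t1 t2]; rewrite /D subr_lt0; apply: low => //.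
  by apply: cvx; apply/andP; split; lra.
have Dhigh t : v1 <= t <= v0 -> 0 < D t.
  move=> /andP[t1 t2]; rewrite /D subr_gt0; apply: high => //.
  by apply: cvx; apply/andP; split; lra.
have [c cI Dc] := derivative_zero u01 uv1 v01 LD Dlow Dhigh.
apply: (H c); split; first exact: cvx.
move/eqP: Dc; rewrite /D subr_eq0 => /eqP ->.
by rewrite mulKf// pnatr_eq0 -lt0n.
Qed.

End tilting_point_bounds.

(** * Total variation distance from a density ratio *)

Section density_ratio_tv.
Context {R : realType} d (T : measurableType d) (P : probability T R).
Notation mu := (@lebesgue_measure R).

(** The two laws differ on C by the expectation of 1_C(Y) (r(Y) - 1). Working on the probability
    space of Y lets linearity reduce the bound on r - 1 to one-dimensional moments. *)
Lemma tv_dist_density_ratio k (Y : 'I_k -> {RV P >-> R}) (f : 'I_k -> R -> R)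
    (c : 'I_k -> R) (r : k.-tuple R -> R) (e V : R) :
  mutually_independent Y -> (forall j, is_density P (Y j) (f j)) ->
  measurable_fun setT r -> (forall t, 0 <= r t) -> 0 <= e ->
  (forall t, `|r t - 1| <= e * (\sum_(j < k) `|tnth t j - c j| + k%:R + 1)) ->
  (forall j, (\int[mu]_y (`|y - c j| * f j y)%:E <= V%:E)%E) ->
  (tv_dist (fun C => \int[lebesgue_tuple R k]_(t in C)
       (r t * \prod_(j < k) f j (tnth t j))%:E) (joint_law P Y) <=
   (e * (k%:R * V + k%:R + 1))%:E)%E.
Proof.
move=> Yi Yf mr r0 e0 rb fV.
pose Yt (x : T) : k.-tuple R := [tuple Y j x | j < k].
have mY : measurable_fun setT Yt.
  apply/measurable_fun_tnthP => j.
  rewrite (_ : _ \o _ = Y j); last by apply/funext => x /=; rewrite tnth_mktuple.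
  exact: measurable_funP.
have mf j : measurable_fun setT (f j) by have [] := Yf j.
have f0 j x : 0 <= f j x by have [_ + _] := Yf j; exact.
pose w (t : k.-tuple R) := \prod_(j < k) f j (tnth t j).
have mw : measurable_fun setT w by exact: measurable_prod_tnth.
have w0 t : 0 <= w t by exact: prodr_ge0.
have law C : measurable C -> P (Yt @^-1` C) = (\int[lebesgue_tuple R k]_(x in C) (w x)%:E)%E.
  exact: independent_tuple_law.
pose b (x : T) := \sum_(j < k) `|Y j x - c j| + k%:R + 1.
have mYj j : measurable_fun setT (fun x => `|Y j x - c j|).
  by apply: measurableT_comp => //; apply: measurable_funB => //; exact: measurable_funP.
have mb : measurable_fun setT b.
  by do 2 apply: measurable_funD => //; apply: measurable_sum => j; exact: mYj.
have b0 x : 0 <= b x by rewrite !addr_ge0// sumr_ge0.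
have Eb : (\int[P]_x (e * b x)%:E <= (e * (k%:R * V + k%:R + 1))%:E)%E.
  under eq_integral do rewrite EFinM.
  rewrite ge0_integralZl//; last 2 first.
  - exact/measurable_EFinP.
  - by move=> x _; rewrite lee_fin.
  rewrite EFinM lee_wpmul2l ?lee_fin//.
  have e1 x : (b x)%:E = (\sum_(j < k) `|Y j x - c j|%:E + (k%:R + 1)%:E)%E.
    by rewrite /b -addrA EFinD sumEFin.
  under eq_integral do rewrite e1.
  rewrite ge0_integralD//; last 2 first.
  - by move=> x _; apply: sume_ge0 => j _; rewrite lee_fin.
  - by apply: emeasurable_sum => j; apply/measurable_EFinP; exact: mYj.
  rewrite integral_cst//= probability_setT mule1 -[k%:R * V + _ + _]addrA [(k%:R * V + _)%:E]EFinD leeD2r//.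
  rewrite ge0_integral_sum//; last by move=> j; apply/measurable_EFinP; exact: mYj.
  apply: (@le_trans _ _ (\sum_(j < k) V%:E)%E).
    apply: lee_sum => j _.
    rewrite (ge0_integral_is_density (h := fun y => `|y - c j|%:E) (Yf j))//; first exact: fV.
    by apply/measurable_EFinP; apply: measurableT_comp => //; exact: measurable_funB.
  by rewrite sumEFin sumr_const card_ord -[V *+ _]mulr_natl.
have rYb x : `|r (Yt x) - 1| <= e * b x.
  have := rb (Yt x).
  by under eq_bigr do rewrite tnth_mktuple.
apply: ge_ereal_sup => _ [C mC <-].
have mYC : measurable (Yt @^-1` C) by rewrite -[_ @^-1` _]setTI; exact: mY.
have -> : (\int[lebesgue_tuple R k]_(t in C) (r t * w t)%:E =
    \int[P]_x (\1_C (Yt x) * r (Yt x))%:E)%E.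
  rewrite (ge0_integral_density (U := Yt) (h := fun t => (\1_C t * r t)%:E) mY mw w0 law).
  - rewrite [LHS]integral_mkcond; apply: eq_integral => t _.
    by rewrite /patch indicE; case: ifP => _; rewrite ?mul1r ?mul0r ?mul0e// EFinM.
  - by apply/measurable_EFinP; apply: measurable_funM => //; exact: measurable_indic.
  - by move=> t; rewrite lee_fin mulr_ge0.
have -> : joint_law P Y C = (\int[P]_x (\1_C (Yt x))%:E)%E.
  rewrite /joint_law -[LHS]/(P (Yt @^-1` C)).
  transitivity (\int[P]_x (\1_(Yt @^-1` C) x)%:E)%E => //.
  by rewrite integral_indic// setIT.
have m1 : measurable_fun setT (fun x => \1_C (Yt x) : R).
  have mi : measurable_fun setT (\1_C : k.-tuple R -> R) by exact: measurable_indic.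
  exact: (measurableT_comp mi mY).
have mrY : measurable_fun setT (fun x => r (Yt x)) by exact: measurableT_comp mr mY.
have ib : P.-integrable setT (EFin \o (fun x => e * b x)).
  apply/integrableP; split; first by apply/measurable_EFinP; exact: measurable_funM.
  under eq_integral do rewrite /= ger0_norm ?mulr_ge0//.
  exact: le_lt_trans Eb (ltry _).
have i1 : P.-integrable setT (EFin \o (fun x => \1_C (Yt x) : R)).
  apply: (le_integrable measurableT _ _ (finite_measure_integrable_cst P 1 measurableT)).
    exact/measurable_EFinP.
  by move=> x _ /=; rewrite lee_fin normr1 indicE; case: (_ \in _); rewrite ?normr1 ?normr0.
have i2 : P.-integrable setT (EFin \o (fun x => \1_C (Yt x) * (r (Yt x) - 1))).
  apply: (le_integrable measurableT _ _ ib).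
    by apply/measurable_EFinP; apply: measurable_funM => //; exact: measurable_funB.
  move=> x _ /=; rewrite lee_fin (le_trans _ (ler_norm _))// (le_trans _ (rYb x))//.
  by rewrite indicE; case: (_ \in _); rewrite ?mul1r ?mul0r ?normr0.
have -> : (\int[P]_x (\1_C (Yt x) * r (Yt x))%:E - \int[P]_x (\1_C (Yt x))%:E =
    \int[P]_x (\1_C (Yt x) * (r (Yt x) - 1))%:E)%E.
  (* With r split as 1 + (r - 1), the integral of the indicator is subtracted from itself, which is
     legitimate in [\bar R] because it is finite. *)
  have -> : (\int[P]_x (\1_C (Yt x) * r (Yt x))%:E =
     \int[P]_x ((\1_C (Yt x))%:E + (\1_C (Yt x) * (r (Yt x) - 1))%:E))%E.
    by apply: eq_integral => x _; rewrite -EFinD; congr (_%:E); ring.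
  rewrite integralD_EFin// addeAC subee ?add0e//.
  exact: integrable_fin_num i1.
apply: (le_trans (le_abse_integral P measurableT _)).
  by case/integrableP: i2.
apply: le_trans Eb; apply: ge0_le_integral => //.
- by apply: measurableT_comp => //; case/integrableP: i2.
- by apply/measurable_EFinP; exact: measurable_funM.
move=> x _; rewrite lee_fin (le_trans _ (rYb x))//.
by rewrite indicE; case: (_ \in _); rewrite ?mul1r ?mul0r ?normr0.
Qed.

End density_ratio_tv.

(** The supremum may be -oo, for instance when K is empty; hence the maximum with 0 and the separate
    last case. *)
Lemma sup_sup_bound {R : realType} (g : nat -> R -> \bar R) (K : set R) :
  (ereal_sup (range (fun j => ereal_sup [set g j t | t in K])) < +oo)%E ->
  exists2 M : R, 0 <= M & forall j t, K t -> (g j t <= M%:E)%E.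
Proof.
set S := ereal_sup _ => Soo.
have le j t : K t -> (g j t <= S)%E.
  move=> Kt; apply: (@le_trans _ _ (ereal_sup [set g j t | t in K])).
    by apply: ereal_sup_ubound; exists t.
  by apply: ereal_sup_ubound; exists j.
case: S Soo le => [s| |]// _ le.
  exists (Num.max 0 s); first by rewrite le_max lexx.
  by move=> j t Kt; rewrite (le_trans (le j t Kt))// lee_fin le_max lexx orbT.
by exists 0 => // j t Kt; rewrite (le_trans (le j t Kt))// leNye.
Qed.

(** * The conditional density in tilted form *)

Section conditional_density_ratio.
Context {R : realType} d (T : measurableType d) (P : probability T R).
Variables (X : nat -> {RV P >-> R}) (p : nat -> R -> R) (M0 : R).
Hypothesis X_indep : mutually_independent X.
Hypothesis X_density : forall j, is_density P (X j) (p j).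
Hypothesis pM0 : forall j, C1_density M0 (p j).

Lemma continuous_density_partial_sum i n : (i < n)%N ->
  continuous_density P (partial_sum X i n) = sum_density p i (n - i).-1.
Proof.
move=> ni; have e : n = (i + (n - i).-1).+1 by lia.
rewrite {1}e; apply: continuous_densityE.
- by apply: measurable_sum => j; exact: measurable_funP.
- have il : (i + (n - i).-1 < n)%N by lia.
  by have [] := sum_density_regular (fun j _ => pM0 j) il.
- by apply: (partial_sum_is_density (n := n) X_indep X_density (fun j _ => pM0 j)); lia.
Qed.

Lemma conditional_density_tilted t a n k (x : k.-tuple R) : (k < n)%N ->
  (forall j, 0 < fine (Phi P (X j) t)) ->
  let pt j := tilted_density P (X j) (p j) t in
  conditional_density X p a n x =
  sum_density pt k (n - k).-1 (n%:R * a - \sum_(j < k) tnth x j) /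
    sum_density pt 0 n.-1 (n%:R * a) * \prod_(j < k) pt j (tnth x j).
Proof.
move=> kn Phi0 pt; rewrite /conditional_density.
rewrite !continuous_density_partial_sum//; last by lia.
rewrite subn0.
have kl : (k + (n - k).-1 < n)%N by lia.
have l0 : (0 + n.-1 < n)%N by lia.
rewrite /pt (sum_density_tilted X t _ (fun j _ => pM0 j) kl).
rewrite (sum_density_tilted X t _ (fun j _ => pM0 j) l0).
have -> : (k + (n - k).-1).+1 = n by lia.
have -> : (0 + n.-1).+1 = n by lia.
rewrite (big_cat_nat (n := k) (m := 0%N))//=; last exact: ltnW.
have Q0 m n' : \prod_(m <= j < n') fine (Phi P (X j) t) != 0.
  by apply: lt0r_neq0; exact: prodr_gt0.
set Q1 := \prod_(0 <= j < k) _; set Q2 := \prod_(k <= j < n) _.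
set s := \sum_(j < k) _.
have -> : \prod_(j < k) tilted_density P (X j) (p j) t (tnth x j) =
    (\prod_(j < k) p j (tnth x j)) * expR (t * s) / Q1.
  rewrite /tilted_density big_split/= big_split/= prodfV /Q1 big_mkord.
  by rewrite /s mulr_sumr expR_sum mulrC [in RHS]mulrC; congr (_ * _); rewrite mulrC.
set g0 := sum_density p 0 n.-1 (n%:R * a).
(* If [g0] vanishes, both sides are 0 because the inverse of 0 is 0. *)
have [->|g00] := eqVneq g0 0; first by rewrite !(mulr0, mul0r, invr0).
have e : expR (t * (n%:R * a)) = expR (t * (n%:R * a - s)) * expR (t * s).
  by rewrite -expRD -mulrDr subrK.
rewrite e; field.
by rewrite g00 !Q0 !gt_eqF ?expR_gt0.
Qed.

End conditional_density_ratio.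

Theorem theorem5 (R : realType)
  (d : measure_display) (T : measurableType d) (P : probability T R)
  (X : nat -> {RV P >-> R}) (p : nat -> R -> R)
  (A B alpha beta : \bar R) (fminus fplus : R -> R)
  (X_indep : mutually_independent X)
  (X_density : forall j, is_density P (X j) (p j))
  (X_support : forall j, law_support P (X j) = closure (eitv A B))
  (Theta_nonvoid : (alpha < beta)%E)
  (Phi_domain : forall j t, (Phi P (X j) t < +oo)%E <-> eitv alpha beta t)
  (m_H : forall j, property_H alpha beta A B (tilted_mean P (X j)))
  (fminus_H : property_H alpha beta A B fminus)
  (fplus_H : property_H alpha beta A B fplus)
  (m_bounds : forall j t, eitv alpha beta t ->
    fminus t <= tilted_mean P (X j) t <= fplus t)
  (var_bounds : forall K : set R, compact K -> K `<=` eitv alpha beta ->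
    K !=set0 ->
    let s2 j t := tilted_var P (X j) (p j) t in
    let s2_inf := ereal_inf (range (fun j => ereal_inf [set s2 j t | t in K])) in
    let s2_sup := ereal_sup (range (fun j => ereal_sup [set s2 j t | t in K])) in
    [/\ (0 < s2_inf)%E, (s2_inf <= s2_sup)%E & (s2_sup < +oo)%E])
  (moment6_bound : forall K : set R, compact K -> K `<=` eitv alpha beta ->
    (ereal_sup (range (fun j =>
       ereal_sup [set tilted_abs_moment P 6 (X j) (p j) t | t in K])) < +oo)%E)
  (p_C1 : forall j, class_C1 (p j))
  (dp_L1_bound : forall K : set R, compact K -> K `<=` eitv alpha beta ->
    (ereal_sup (range (fun j => ereal_sup
       [set 'N[lebesgue_measure]_1
          [EFin \o derive1 (tilted_density P (X j) (p j) t)] | t in K]))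
     < +oo)%E)
  (a : R) (a_support : eitv A B a)
  (k : nat -> nat)
  (k_range : forall n, (2 <= n)%N -> (1 <= k n < n)%N)
  (k_infty : k @ \oo --> \oo)
  (rho : R) (rho_range : 0 < rho < 1 / 2)
  (k_small : (fun n => (k n)%:R : R^o) =o_\oo (fun n => n%:R `^ rho : R^o))
  (d' : nat -> measure_display) (T' : forall n, measurableType (d' n))
  (P' : forall n, probability (T' n) R)
  (Xt : forall n, 'I_(k n) -> {RV (P' n) >-> R})
  (Xt_density : forall n, (2 <= n)%N -> forall j : 'I_(k n),
    is_density (P' n) (Xt n j)
      (tilted_density P (X j) (p j) (tilting_point X alpha beta a n)))
  (Xt_indep : forall n, (2 <= n)%N -> mutually_independent (Xt n)) :
  tv_dist (conditional_law X p a n (k n)) (joint_law (P' n) (Xt n))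
    @[n --> \oo] --> 0%E.
Proof.
have z0 : eitv alpha beta 0 := eitv0 (X_density 0%N) (Phi_domain 0%N).
(* A bound on the untilted densities, from the compact set {0}. It gives the partial sums the
   continuous densities that [conditional_density] evaluates. *)
have [M0 M00 HM0] : exists2 M : R, 0 <= M & forall j, C1_density M (p j).
  have sub0 : [set (0 : R)] `<=` eitv alpha beta by move=> _ ->.
  have [M MM H] := sup_sup_bound (dp_L1_bound _ (@compact_set1 _ (0 : R)) sub0).
  exists M => // j.
  have := tilted_C1_density (X_density j) (Phi_domain j) (p_C1 j) z0 (H j 0 erefl).
  by rewrite (tilted_density0 (X_density j)).
have [u [v [uvT uv ptn]]] := tilting_point_bounds X_density Theta_nonvoid Phi_domain
  fminus_H fplus_H m_bounds a_support.
(* One compact interval contains the tilts of all n >= 1, so that [M], [V], [C] and [N] do not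
   depend on n. *)
pose K : set R := `[u, v]%classic.
have cK : compact K by exact: segment_compact.
have KT : K `<=` eitv alpha beta by move=> t; rewrite /K/= in_itv/=; exact: uvT.
have [M MM HM] := sup_sup_bound (dp_L1_bound K cK KT).
have [V VV HV] := sup_sup_bound (moment6_bound K cK KT).
have V1 : 0 <= 1 + V by rewrite addr_ge0.
have [C C0 [N HC]] := sum_density_ratio MM V1.
have ksmall : (k n)%:R / Num.sqrt n%:R @[n --> \oo] --> (0 : R).
  apply/cvgr0Pnorm_le => e e0.
  have /eqoP /(_ e e0) H := k_small.
  near=> n.
  have n1 : (1 <= n)%N by near: n; exact: nbhs_infty_ge.
  have sn : 0 < Num.sqrt n%:R :> R by rewrite sqrtr_gt0 ltr0n.
  rewrite ger0_norm ?divr_ge0 ?sqrtr_ge0// ler_pdivrMr//.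
  have : `|(k n)%:R : R| <= e * `|n%:R `^ rho : R| by near: n; exact: H.
  rewrite !ger0_norm ?powR_ge0// => /le_trans; apply.
  rewrite ler_wpM2l ?(ltW e0)// -powR12_sqrt// ler_powR ?ler1n//.
  by have /andP[_] := rho_range; lra.
(* The factor 4 + V comes from k (2 + V) + k + 1 <= (4 + V) k for k >= 1, where 2 + V bounds the
   first absolute moments when the third ones are at most 1 + V. *)
apply: (@squeeze_cvge _ _ _ _ (cst 0%E) _ (fun n => (C * (4 + V) * ((k n)%:R / Num.sqrt n%:R))%:E)).
- near=> n; apply/andP; split.
    (* The empty event shows that the supremum is nonnegative. *)
    apply: (@le_trans _ _ `|conditional_law X p a n (k n) set0 - joint_law (P' n) (Xt n) set0|%E) => //.
    - exact: abse_ge0.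
    by rewrite /tv_dist; apply: ereal_sup_ubound; exists set0.
  have n2 : (2 <= n)%N by near: n; exact: nbhs_infty_ge.
  have Nn : (N < n)%N by near: n; exact: nbhs_infty_gt.
  have n0 : (0 < n)%N by lia.
  have /andP[k1 kn] := k_range n n2.
  have sn : 0 < Num.sqrt n%:R :> R by rewrite sqrtr_gt0 ltr0n.
  have sn2 : (Num.sqrt n%:R : R) ^+ 2 = n%:R by rewrite sqr_sqrtr.
  (* Eventually k <= sqrt n / 2, and sqrt n <= n. *)
  have k2n : ((k n).*2 <= n)%N.
    have : (k n)%:R / Num.sqrt n%:R <= (2^-1 : R).
      near: n; have := ksmall => /cvgr0Pnorm_le /(_ 2^-1) H.
      by apply: filterS (H _) => // n; apply: le_trans; exact: ler_norm.
    rewrite ler_pdivrMr// => h.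
    rewrite -(ler_nat R) -muln2 natrM -sn2.
    have s1 : 1 <= (Num.sqrt n%:R : R) by rewrite -[leLHS]sqrtr1 ler_sqrt ?ltr0n// ler1n.
    by nra.
  have [/= tuv tsum] := ptn n n0.
  set t := tilting_point X alpha beta a n in tuv tsum.
  have tT : eitv alpha beta t by exact: uvT.
  have tK : K t by rewrite /K/= in_itv/=.
  pose pt j := tilted_density P (X j) (p j) t.
  pose m j := tilted_mean P (X j) t.
  have ptM j : C1_density M (pt j).
    exact: (tilted_C1_density (X_density j) (Phi_domain j) (p_C1 j) tT (HM j t tK)).
  have ptV j : centered_third_moment (1 + V) (m j) (pt j).
    exact: (tilted_third_moment (X_density j) (Phi_domain j) (p_C1 j) tT (HV j t tK)).
  (* The tilting equation puts n a at the centre where [sum_density_ratio] is stated. *)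
  have sumE : n%:R * a = \sum_(0 <= j < n) m j by rewrite big_mkord.
  have HR := fun w => HC pt m n (k n) w (fun j _ => ptM j) (fun j _ => ptV j) Nn k2n n0.
  pose r (x : (k n).-tuple R) := sum_density pt (k n) (n - k n).-1 (n%:R * a - \sum_(j < k n) tnth x j) /
    sum_density pt 0 n.-1 (n%:R * a).
  have kl : (k n + (n - k n).-1 < n)%N by lia.
  have [cs sb] := sum_density_regular (fun j _ => ptM j) kl.
  have mr : measurable_fun setT r.
    apply: measurable_funM => //.
    apply: (measurableT_comp (continuous_measurable_fun cs)).
    by apply: measurable_funB => //; apply: measurable_sum => j; exact: measurable_tnth.
  have r0 x : 0 <= r x.
    have [g0 _] := HR 0; rewrite -sumE in g0.
    by rewrite /r divr_ge0 ?(ltW g0)//; have /andP[] := sb (n%:R * a - \sum_(j < k n) tnth x j).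
  have rb x : `|r x - 1| <= C / Num.sqrt n%:R * (\sum_(j < k n) `|tnth x j - m j| + (k n)%:R + 1).
    have [_ h] := HR (\sum_(j < k n) tnth x j); rewrite -sumE in h.
    apply: (le_trans h); rewrite mulrAC ler_wpM2l ?divr_ge0 ?sqrtr_ge0// lerD2r lerD2r.
    by rewrite big_mkord -sumrB ler_norm_sum.
  have fV (j : 'I_(k n)) : (\int[lebesgue_measure]_y (`|y - m j| * pt j y)%:E <= (2 + V)%:E)%E.
    have mN : measurable_fun setT (fun z : R => `|z - m j|).
      by apply: measurableT_comp => //; exact: measurable_funB.
    have [i1 b1] := @centered_moment_integrable _ _ _ _ _ (fun z => `|z - m j|) 1 isT (ptM j) (ptV j) mN
      (fun y => normr_id _).
    rewrite -EFin_Rintegral// lee_fin (le_trans (ler_norm _))// (le_trans b1)//.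
    lra.
  have eC : 0 <= C / Num.sqrt n%:R by rewrite divr_ge0 ?sqrtr_ge0.
  have := tv_dist_density_ratio (Xt_indep n n2) (Xt_density n n2) mr r0 eC rb fV.
  have -> : conditional_law X p a n (k n) = (fun D => \int[lebesgue_tuple R (k n)]_(x in D)
      (r x * \prod_(j < k n) pt j (tnth x j))%:E)%E.
    apply/funext => D; apply: eq_integral => x _.
    rewrite (conditional_density_tilted X_indep X_density HM0 (t := t))//.
    by move=> j; exact: (Phi_gt0 (X_density j) (Phi_domain j) tT).
  move=> /le_trans; apply; rewrite lee_fin.
  rewrite [leRHS](_ : _ = C / Num.sqrt n%:R * ((4 + V) * (k n)%:R)); last by ring.
  rewrite ler_wpM2l//.
  have : (1 : R) <= (k n)%:R by rewrite ler1n.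
  lra.
- exact: cvg_cst.
- rewrite -[0%E]/((0 : R)%:E); apply: cvg_EFin; first exact: nearW.
  rewrite [X in _ --> X](_ : 0 = C * (4 + V) * 0); last by rewrite mulr0.
  by apply: cvgM; [exact: cvg_cst|exact: ksmall].
Unshelve. all: by end_near.
Qed.
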